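(* Let $G$ be a graph. If $G$ has neither $W_n$ $(n\ge5)$ nor a proper splitting of $W_n$ $(n\ge4)$ as an induced subgraph, then ${\sf sd}(G)\le 2$.
   Context: Graphs are finite, simple and undirected, with nonempty vertex set $V=V(G)=\{1,\dots,n\}$ and edge set $E=E(G)$. ${\cal S}^n_+$ is the set of real symmetric positive semidefinite $n\times n$ matrices. For $c\in[-1,1]^{E}$, the problem ${\rm P}(G,c)$ has feasible set $\{X\in{\cal S}^n_+ : X[i,i]=1\ (i\in V),\ X[i,j]=c(ij)\ (ij\in E)\}$; ${\cal E}(G)$ is the set of $c\in[-1,1]^E$ for which this set is nonempty. A stress is a vector $\omega\in\mathbb{R}^{V\cup E}$; its matrix is $\Omega=\sum_{i\in V}\omega(i)E_{ii}+\sum_{ij\in E}\omega(ij)E_{ij}$, where $E_{ij}=({\bf e}_i{\bf e}_j^{\top}+{\bf e}_j{\bf e}_i^{\top})/2$ (a superscript on $\omega$ is inherited by $\Omega$). For a sequence $\omega^1,\dots,\omega^k$ put ${\cal V}^0=\mathbb{R}^n$ and ${\cal V}^j=\{x\in\mathbb{R}^n : x^{\top}\Omega^i x=0\ (i=1,\dots,j)\}$. Singularity degree: for $c\in{\cal E}(G)$, ${\sf sd}(G,c)=0$ if ${\rm P}(G,c)$ has a positive definite feasible solution; otherwise ${\sf sd}(G,c)$ is the smallest $k$ for which there are stresses $\omega^1,\dots,\omega^k$ such that: (1) for each $j$, $x^{\top}\Omega^j x\ge 0$ for all $x\in{\cal V}^{j-1}$; (2) for each $j$, $\sum_{i\in V}\omega^j(i)+\sum_{ij\in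 E}\omega^j(ij)c(ij)\le 0$; (3) $\dim{\cal V}^k=s$, where $s$ is the maximum rank of a feasible solution of ${\rm P}(G,c)$. Finally ${\sf sd}(G)=\max\{{\sf sd}(G,c) : c\in{\cal E}(G)\}$. The wheel $W_n$ ($n\ge4$) is the graph with $n$ vertices formed by joining one vertex to all vertices of a cycle of length $n-1$ (so $W_4=K_4$). A vertex splitting is the inverse of an edge contraction: a vertex $v$ is replaced by two adjacent vertices $v',v''$, and each edge formerly incident to $v$ is made incident to exactly one of $v',v''$, each of $v',v''$ receiving at least one of these edges. $G'$ is a splitting of $G$ if it is obtained from $G$ by a (possibly empty) sequence of vertex splittings, and a proper splitting if moreover $G'\ne G$. *)

(* Defs.v *)
From HB Require Import structures.
From mathcomp Require Import all_boot all_order all_algebra.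
From mathcomp Require Import reals.

Set Implicit Arguments.
Unset Strict Implicit.
Unset Printing Implicit Defensive.

Import Order.TTheory GRing.Theory Num.Theory.
Local Open Scope ring_scope.

Record sgraph (n : nat) := SGraph {
  adj : rel 'I_n;
  adj_sym : symmetric adj;
  adj_irr : irreflexive adj
}.

(* Each edge ij occurs exactly once, as the pair of its endpoints in
   increasing order. *)
Definition edge n (G : sgraph n) : finType :=
  {p : 'I_n * 'I_n | (p.1 < p.2)%N && adj G p.1 p.2}.

Definition src n (G : sgraph n) (a : edge G) : 'I_n := (val a).1.
Definition tgt n (G : sgraph n) (a : edge G) : 'I_n := (val a).2.

Definition isomorphic m k (H : sgraph m) (G : sgraph k) : Prop :=
  exists f : 'I_m -> 'I_k,
    bijective f /\ forall x y, adj G (f x) (f y) = adj H x y.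

(* G has an induced subgraph isomorphic to H. *)
Definition has_induced m k (H : sgraph m) (G : sgraph k) : Prop :=
  exists f : 'I_m -> 'I_k,
    injective f /\ forall x y, adj G (f x) (f y) = adj H x y.

(* The cycle 0, 1, ..., m - 1, 0, as a relation on numbers. *)
Definition cycle_adj (m : nat) : rel nat :=
  fun i j => (j == i.+1 %% m)%N || (i == j.+1 %% m)%N.

(* W_n: the hub is the vertex 0 and the rim vertex i > 0 is the vertex i - 1 of
   the cycle of length n - 1.  Meaningful for n >= 4 only. *)
Definition wheel_adj (n : nat) : rel 'I_n :=
  fun i j => (i != j) &&
    [|| i == 0%N :> nat, j == 0%N :> nat | cycle_adj n.-1 i.-1 j.-1].

Lemma wheel_adj_sym n : symmetric (@wheel_adj n).
Proof.
by move=> i j; rewrite /wheel_adj /cycle_adj eq_sym orbCA [X in _ || (_ || X)]orbC.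
Qed.

Lemma wheel_adj_irr n : irreflexive (@wheel_adj n).
Proof. by move=> i; rewrite /wheel_adj eqxx. Qed.

Definition wheel (n : nat) : sgraph n :=
  SGraph (@wheel_adj_sym n) (@wheel_adj_irr n).

(* G' arises from G by splitting one vertex v into v1 and v2.  The map f is the
   contraction of the edge v1 v2, so that v = f v1 = f v2; it identifies no
   other vertices.  The formulation is invariant under isomorphism. *)
Definition vertex_split m k (G : sgraph m) (G' : sgraph k) : Prop :=
  exists (v1 v2 : 'I_k) (f : 'I_k -> 'I_m),
    let rest := [pred x | x \notin [:: v1; v2]] in
    [/\ adj G' v1 v2,
        (forall u, exists x, f x = u) /\
        (forall x y, (f x == f y) =
          (x == y) || (x \in [:: v1; v2]) && (y \in [:: v1; v2])),
        {in rest &, forall x y, adj G' x y = adj G (f x) (f y)},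
        {in rest, forall x,
          adj G (f x) (f v1) = adj G' x v1 || adj G' x v2 /\
          ~~ (adj G' x v1 && adj G' x v2)}
      & (exists2 x, x \in rest & adj G' x v1) /\
        (exists2 x, x \in rest & adj G' x v2)].

Inductive splitting m (G : sgraph m) : forall k, sgraph k -> Prop :=
| splitting_refl : splitting G G
| splitting_step k l (H : sgraph k) (H' : sgraph l) :
    splitting G H -> vertex_split H H' -> splitting G H'.

Definition proper_splitting m k (G : sgraph m) (G' : sgraph k) : Prop :=
  splitting G G' /\ ~ isomorphic G G'.

Section SingularityDegree.
Variables (R : realType) (n : nat).

Definition quad (A : 'M[R]_n) (x : 'cV[R]_n) : R := (x^T *m A *m x) 0 0.

Definition psd (A : 'M[R]_n) : Prop := A^T = A /\ forall x, 0 <= quad A x.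

Definition pd (A : 'M[R]_n) : Prop :=
  A^T = A /\ forall x, x != 0 -> 0 < quad A x.

(* The dimension of a set of vectors, defined when it is a subspace. *)
Definition has_dim (P : 'cV[R]_n -> Prop) (d : nat) : Prop :=
  exists2 U : {vspace 'cV[R]_n}, (forall x, x \in U <-> P x) & \dim U = d.

Variable G : sgraph n.

Definition feasible (c : edge G -> R) (X : 'M[R]_n) : Prop :=
  [/\ psd X, forall i, X i i = 1 & forall a : edge G, X (src a) (tgt a) = c a].

(* c belongs to the set E(G) *)
Definition completable (c : edge G -> R) : Prop :=
  (forall a, -1 <= c a <= 1) /\ exists X, feasible c X.

Definition stress : Type := ('I_n + edge G)%type -> R.

Definition sym_unit (i j : 'I_n) : 'M[R]_n :=
  2^-1 *: (delta_mx i j + delta_mx j i).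

Definition stress_mx (w : stress) : 'M[R]_n :=
  \sum_(i < n) w (inl i) *: sym_unit i i +
  \sum_(a : edge G) w (inr a) *: sym_unit (src a) (tgt a).

Definition stress_pairing (w : stress) (c : edge G -> R) : R :=
  \sum_(i < n) w (inl i) + \sum_(a : edge G) w (inr a) * c a.

(* The set V^j.  Stresses are numbered from 0, so w i is
   omega^(i+1). *)
Definition null_set k (w : 'I_k -> stress) (j : nat) (x : 'cV[R]_n) : Prop :=
  forall i : 'I_k, (i < j)%N -> quad (stress_mx (w i)) x = 0.

Definition max_rank (c : edge G -> R) (s : nat) : Prop :=
  (exists2 X, feasible c X & \rank X = s) /\
  (forall X, feasible c X -> (\rank X <= s)%N).

Definition stress_sequence (c : edge G -> R) (k : nat) : Prop :=
  exists w : 'I_k -> stress,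
    [/\ forall (j : 'I_k) x, null_set w j x -> 0 <= quad (stress_mx (w j)) x,
        forall j : 'I_k, stress_pairing (w j) c <= 0
      & exists2 s, max_rank c s & has_dim (null_set w k) s].

Definition has_pd_solution (c : edge G -> R) : Prop :=
  exists2 X, feasible c X & pd X.

(* sd(G, c) = d *)
Definition sd_at_eq (c : edge G -> R) (d : nat) : Prop :=
  (has_pd_solution c /\ d = 0%N) \/
  [/\ ~ has_pd_solution c, stress_sequence c d
    & forall k, stress_sequence c k -> (d <= k)%N].

(* sd(G) = d; in particular sd(G, c) is defined for every completable c, and
   the maximum is attained. *)
Definition sd_eq (d : nat) : Prop :=
  (exists2 c, completable c & sd_at_eq c d) /\
  (forall c, completable c -> exists2 k, sd_at_eq c k & (k <= d)%N).

End SingularityDegree.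

(* Main.v *)
Require Import Defs.
From mathcomp Require Import all_boot all_order all_algebra.
From mathcomp Require Import boolp reals ring lra zify.

Set Implicit Arguments.
Unset Strict Implicit.
Unset Printing Implicit Defensive.
Import Order.TTheory GRing.Theory Num.Theory.

(** For every c two stresses, chosen as follows, suffice. Let X0 be feasible. The first
    stress is the sum of the squares (x_i - X0_ij x_j)^2 over the edges with X0_ij = 1 or
    -1; it vanishes on the columns of every feasible matrix, and its zeros are the
    vectors called collapsed below. The second one has to be a matrix W supported on
    the graph, with <W, X0> <= 0, that is nonnegative on the collapsed vectors and whose
    zeros among them lie in the column space of one feasible matrix X (exposes). Then
    the columns of all feasible matrices are zeros of both stresses, so X has maximal
    rank and two stresses suffice (two_step_sequence).

    Such a W exists when the graph can be decomposed into cliques (decomposable_exposes).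
    On a clique W is read off the kernel of X0. Along a clique separator the matrices X
    are amalgamated and the matrices W are added. The remaining case is a separation by
    a nonadjacent pair u, v. Each side allows an interval of values for the entry uv. If
    the two intervals share a relatively interior value, the sides can be amalgamated at
    it. If not, they meet in a common end, the entry uv is forced, and uv may be treated
    as an edge on both sides, provided that the coefficient of W at uv can be cancelled
    afterwards. This takes a matrix on a side certifying that the entry uv is extremal.
    It exists when the side is a network, built by parallel and series composition from
    edges, up to parts hanging on cliques (network_certifiable). In a series composition
    the two parts can be rotated about their common vertex, so at an extremal solution
    the entries of the parts satisfy a first-order condition, which says which multiples
    of the two certificates to add.

    The graph side has one obstruction: an induced cycle C of length at least 4, and a
    connected set D off C with at least three neighbours on C. When the graph has no such
    pair (cycle_sparse), a component outside an induced cycle has at most two neighbours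
    on it. This yields the cuts of the decomposition (cut_exists), it shows that the
    sides of a cut by two nonadjacent vertices are networks (network_of_paths), and it
    is inherited by the sides with the edge uv added (two_sum_sparse). Among the pairs
    C, D with the least number of vertices there is one in which D is a tree and every
    vertex of C has at most one neighbour in D (no_attaches3). Contracting D to a hub,
    and the arcs of C between consecutive neighbours of D to single vertices, gives a wheel, and each
    contracted edge inverts a vertex splitting (tree_model_splitting). So C and D induce
    a wheel with at least 5 vertices or a proper splitting of a wheel (config_absurd),
    which the hypotheses exclude. *)

Local Open Scope ring_scope.

(** * Positive semidefinite matrices *)

Section Psd.
Variables (R : realType) (n : nat).
Implicit Types (A M X Y : 'M[R]_n) (x y z : 'cV[R]_n).

Definition bil A x y : R := (x^T *m A *m y) 0 0.

Definition frob M X : R := \sum_i \sum_j M i j * X i j.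

Lemma bilE A x y : bil A x y = \sum_i \sum_j A i j * (x i 0 * y j 0).
Proof.
rewrite /bil mxE exchange_big; apply: eq_bigr => j _.
rewrite mxE big_distrl /=; apply: eq_bigr => i _; rewrite !mxE; ring.
Qed.

Lemma quadE A x : quad A x = \sum_i \sum_j A i j * (x i 0 * x j 0).
Proof. exact: bilE. Qed.

Lemma bilDl A x y z : bil A (x + y) z = bil A x z + bil A y z.
Proof. by rewrite /bil linearD /= !mulmxDl mxE. Qed.

Lemma bilDr A x y z : bil A z (x + y) = bil A z x + bil A z y.
Proof. by rewrite /bil !mulmxDr mxE. Qed.

Lemma bilZl A a x y : bil A (a *: x) y = a * bil A x y.
Proof. by rewrite /bil linearZ /= -!scalemxAl mxE. Qed.

Lemma bilZr A a x y : bil A x (a *: y) = a * bil A x y.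
Proof. by rewrite /bil -!scalemxAr mxE. Qed.

Lemma bilC A x y : A^T = A -> bil A x y = bil A y x.
Proof.
move=> sA; have <- : ((y^T *m A *m x)^T) 0 0 = bil A y x by rewrite mxE.
by rewrite !trmx_mul trmxK sA mulmxA.
Qed.

Lemma quadD M N x : quad (M + N) x = quad M x + quad N x.
Proof. by rewrite /quad mulmxDr mulmxDl mxE. Qed.

Lemma quadZ a M x : quad (a *: M) x = a * quad M x.
Proof. by rewrite /quad -scalemxAr -scalemxAl mxE. Qed.

Lemma quad0 x : quad 0 x = 0.
Proof. by rewrite /quad mulmx0 mul0mx mxE. Qed.

Lemma frobD M N X : frob (M + N) X = frob M X + frob N X.
Proof.
rewrite /frob -big_split; apply: eq_bigr => i _.
by rewrite -big_split; apply: eq_bigr => j _; rewrite !mxE mulrDl.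
Qed.

Lemma frobZ a M X : frob (a *: M) X = a * frob M X.
Proof.
rewrite /frob mulr_sumr; apply: eq_bigr => i _.
by rewrite mulr_sumr; apply: eq_bigr => j _; rewrite !mxE mulrA.
Qed.

Lemma frob0 X : frob 0 X = 0.
Proof. by rewrite /frob big1 // => i _; rewrite big1 // => j _; rewrite mxE mul0r. Qed.

Lemma frobC M X : frob M X = frob X M.
Proof. by apply: eq_bigr => i _; apply: eq_bigr => j _; rewrite mulrC. Qed.

Lemma frobDr M X Y : frob M (X + Y) = frob M X + frob M Y.
Proof. by rewrite frobC frobD ![frob _ M]frobC. Qed.

Lemma frobZr a M X : frob M (a *: X) = a * frob M X.
Proof. by rewrite frobC frobZ frobC. Qed.

Lemma frob_rank1 M v : frob M (v *m v^T) = quad M v.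
Proof.
rewrite quadE; apply: eq_bigr => i _; apply: eq_bigr => j _.
by rewrite !mxE big_ord1 !mxE.
Qed.

Lemma quad_rank1 (v x : 'cV[R]_n) : quad (v *m v^T) x = ((v^T *m x) 0 0) ^+ 2.
Proof.
rewrite /quad !mulmxA -mulmxA mxE big_ord1 expr2; congr (_ * _).
have <- : ((x^T *m v)^T) 0 0 = (x^T *m v) 0 0 by rewrite mxE.
by rewrite trmx_mul trmxK.
Qed.

Lemma bil_mulr A x y : bil A x y = (x^T *m (A *m y)) 0 0.
Proof. by rewrite /bil mulmxA. Qed.

Lemma dot_ge0 (p : nat) (x : 'cV[R]_p) : 0 <= (x^T *m x) 0 0.
Proof. by rewrite mxE; apply: sumr_ge0 => i _; rewrite mxE -expr2 sqr_ge0. Qed.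

Lemma dot_eq0 (p : nat) (x : 'cV[R]_p) : (x^T *m x) 0 0 = 0 -> x = 0.
Proof.
rewrite mxE => /eqP; rewrite psumr_eq0; last by move=> i _; rewrite mxE -expr2 sqr_ge0.
move=> /allP xx; apply/colP => i; rewrite mxE; have := xx i (mem_index_enum _).
by rewrite mxE -expr2 sqrf_eq0 => /eqP.
Qed.

Lemma psd_cauchy A x y : psd A -> bil A x y ^+ 2 <= quad A x * quad A y.
Proof.
case=> sA pA; set c := bil A x y.
have H a b : 0 <= a ^+ 2 * quad A x + 2 * a * b * c + b ^+ 2 * quad A y.
  have := pA (a *: x + b *: y).
  rewrite -[quad A (_ + _)]/(bil A _ _) bilDl !bilDr !bilZl !bilZr (bilC y x sA) -/c.
  by rewrite -[bil A x x]/(quad A x) -[bil A y y]/(quad A y) => h; apply: le_trans h _; lra.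
have qx := pA x; have qy := pA y.
have [y0|yN] := eqVneq (quad A y) 0.
  rewrite y0 mulr0; suff -> : c = 0 by rewrite expr0n.
  apply/eqP; apply/negPn/negP => cN.
  have c2 : 0 < c ^+ 2 by rewrite exprn_even_gt0.
  have := H 1 (- (quad A x + 1) / (2 * c ^+ 2) * c).
  rewrite y0 (_ : 2 * 1 * _ * c = - (quad A x + 1)); last by field.
  lra.
have yP : 0 < quad A y by rewrite lt_def yN.
have := H (quad A y) (- c); have := H 0 0.
set a := quad A x in qx *; set b := quad A y in qy yP *.
move=> _ h; have {}h : 0 <= b * (a * b - c ^+ 2) by apply: le_trans h _; lra.
by rewrite -subr_ge0; rewrite pmulr_rge0 in h.
Qed.

Lemma psd_ker A x : psd A -> quad A x = 0 -> A *m x = 0.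
Proof.
move=> pA q0; apply: dot_eq0; apply/eqP; rewrite -sqrf_eq0 eq_le sqr_ge0 andbT.
have := psd_cauchy (A *m x) x pA.
by rewrite q0 mulr0 bil_mulr.
Qed.

Lemma psdD A B : psd A -> psd B -> psd (A + B).
Proof.
move=> [sA pA] [sB pB]; split; first by rewrite linearD /= sA sB.
by move=> x; rewrite quadD addr_ge0.
Qed.

Lemma psdZ a A : 0 <= a -> psd A -> psd (a *: A).
Proof.
move=> a0 [sA pA]; split; first by rewrite linearZ /= sA.
by move=> x; rewrite quadZ mulr_ge0.
Qed.

Lemma psd_rank1 (v : 'cV[R]_n) : psd (v *m v^T).
Proof. by split=> [|x]; rewrite ?trmx_mul ?trmxK ?quad_rank1 ?sqr_ge0. Qed.

Lemma quad_conj (T A : 'M[R]_n) x : quad (T *m A *m T^T) x = quad A (T^T *m x).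
Proof. by rewrite /quad trmx_mul trmxK !mulmxA. Qed.

Lemma psd_conj (T A : 'M[R]_n) : psd A -> psd (T *m A *m T^T).
Proof.
by move=> [sA pA]; split=> [|x]; rewrite ?quad_conj // !trmx_mul trmxK sA mulmxA.
Qed.

(** By Cauchy-Schwarz the form of Y dominates the square of x |-> y^T Y x, up to
    the factor y^T Y y. *)
Lemma psd_deflate Y y e : psd Y -> 0 <= e -> e * quad Y y <= 1 ->
  psd (Y - e *: ((Y *m y) *m (Y *m y)^T)).
Proof.
move=> pY e0 eq1; have [sY qY] := pY; split.
  by rewrite linearB /= linearZ /= trmx_mul trmxK sY.
move=> x; rewrite quadD -scaleNr quadZ quad_rank1.
have -> : ((Y *m y)^T *m x) 0 0 = bil Y x y.
  by rewrite (bilC _ _ sY) /bil trmx_mul sY.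
have := psd_cauchy x y pY; have := qY x; have := qY y.
set a := quad Y x; set b := quad Y y; set c := bil Y x y => b0 a0 h.
have : e * c ^+ 2 <= e * (a * b) by apply: ler_wpM2l.
have : e * b * a <= 1 * a by apply: ler_wpM2r.
lra.
Qed.

Lemma quad_delta Y i : quad Y (delta_mx i 0) = Y i i.
Proof.
rewrite quadE (bigD1 i) //= (bigD1 i) //=.
rewrite !mxE !eqxx mulr1 big1 ?addr0 ?big1 ?addr0 ?mulr1 //.
  by move=> k ki; rewrite big1 // => j _; rewrite !mxE (negPf ki) mul0r mulr0.
by move=> k ki; rewrite !mxE (negPf ki) mulr0 mulr0.
Qed.

Lemma psd_diag_ge0 Y i : psd Y -> 0 <= Y i i.
Proof. by case=> _ /(_ (delta_mx i 0)); rewrite quad_delta. Qed.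

Lemma deflateE Y e (u : 'cV[R]_n) i j :
  (Y - e *: (u *m u^T)) i j = Y i j - e * (u i 0 * u j 0).
Proof. by rewrite !mxE big_ord1 !mxE. Qed.

Lemma mul_delta Y i k : (Y *m (delta_mx i 0 : 'cV_n)) k 0 = Y k i.
Proof. by rewrite -colE mxE. Qed.

(** Symmetric elimination. The factors stay in the column space of Y, so that a form
    that is nonnegative only on this space can still be paired with Y through them. *)
Lemma psd_factor Y : psd Y -> exists2 s : seq 'cV[R]_n,
  Y = \sum_(v <- s) v *m v^T & forall v, v \in s -> exists y, v = Y *m y.
Proof.
have [k] := ubnP #|[pred i | Y i i != 0]|; elim: k Y => // k IH Y lek pY.
(* each step clears a diagonal entry and revives none, since a zero diagonal entry
   of a psd matrix has a zero column *)
have [/existsP[i Yi]|] := boolP [exists i, Y i i != 0]; last first.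
  rewrite negb_exists => /forallP Y0; exists [::] => //; rewrite big_nil.
  apply/matrixP => i j; rewrite mxE -mul_delta psd_ker ?mxE // quad_delta.
  by apply/eqP; have := Y0 j; rewrite negbK.
have Yi0 : 0 < Y i i by rewrite lt_def Yi psd_diag_ge0.
pose d : 'cV[R]_n := delta_mx i 0.
have pY' : psd (Y - (Y i i)^-1 *: ((Y *m d) *m (Y *m d)^T)).
  apply: psd_deflate => //; first by rewrite invr_ge0 ltW.
  by rewrite quad_delta mulVf.
set Y' := (X in psd X) in pY'.
have diag j : Y' j j = Y j j - (Y i i)^-1 * (Y j i) ^+ 2.
  by rewrite deflateE mul_delta expr2.
have [] := IH Y' _ pY'.
  rewrite ltnS in lek; apply: leq_trans lek; apply: proper_card; apply/properP; split.
    apply/subsetP => j; rewrite !inE; apply: contraNneq => Yj.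
    rewrite diag Yj -mul_delta -[Y *m _]/(Y *m _).
    have [sY _] := pY; have -> : Y j i = 0.
      have : Y *m (delta_mx j 0 : 'cV_n) = 0 by apply: psd_ker; rewrite ?quad_delta.
      move=> /colP/(_ i); rewrite mul_delta mxE => <-.
      by rewrite -[in LHS]sY mxE.
    by rewrite expr0n mulr0 subrr.
  exists i; rewrite !inE ?Yi // diag expr2 mulKf ?subrr ?eqxx //.
move=> s Ys sY'; exists (((Num.sqrt (Y i i))^-1 *: (Y *m d)) :: s).
  rewrite big_cons -Ys /Y' linearZ /= -scalemxAl -scalemxAr scalerA -invfM -expr2.
  by rewrite sqr_sqrtr ?ltW // addrC subrK.
move=> v; rewrite inE => /predU1P[->|/sY'[y ->]].
  by exists ((Num.sqrt (Y i i))^-1 *: d); rewrite scalemxAr.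
exists (y - ((Y i i)^-1 *: (d *m ((Y *m d)^T *m y)))).
by rewrite mulmxBr mulmxBl -scalemxAl -scalemxAr !mulmxA.
Qed.

Lemma frob_sum M (s : seq 'cV[R]_n) :
  frob M (\sum_(v <- s) v *m v^T) = \sum_(v <- s) quad M v.
Proof.
elim: s => [|v s IH]; first by rewrite !big_nil frobC frob0.
by rewrite !big_cons frobDr frob_rank1 IH.
Qed.

Lemma frob_ge0 M Y : psd Y -> (forall y, 0 <= quad M (Y *m y)) -> 0 <= frob M Y.
Proof.
move=> pY MY; have [s Ys sY] := psd_factor pY; rewrite Ys frob_sum big_seq.
by apply: sumr_ge0 => v /sY [y ->].
Qed.

(** If the form were positive at Y y, then deflating Y slightly along Y y would
    leave a psd matrix, with its columns still in the column space of Y, whose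
    pairing with M is negative. *)
Lemma frob_le0 M Y : psd Y -> (forall y, 0 <= quad M (Y *m y)) -> frob M Y <= 0 ->
  forall y, quad M (Y *m y) = 0.
Proof.
move=> pY MY FY y; apply/eqP; rewrite eq_le MY andbT.
have q0 : 0 <= quad Y y by case: pY.
pose e := (quad Y y + 1)^-1.
have e0 : 0 < e by rewrite invr_gt0 ltr_wpDl.
have /(frob_ge0 (M := M)) : psd (Y - e *: ((Y *m y) *m (Y *m y)^T)).
  apply: psd_deflate => //; first exact: ltW.
  rewrite /e mulrC ler_pdivrMr ?ltr_wpDl //.
  by rewrite mul1r lerDl.
move=> h; have : 0 <= frob M (Y - e *: ((Y *m y) *m (Y *m y)^T)).
  apply: h => z; set u := _ *m z.
  suff [w ->] : exists w, u = Y *m w by [].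
  exists (z - (e *: (y *m ((Y *m y)^T *m z)))).
  by rewrite /u mulmxBr mulmxBl -scalemxAl -scalemxAr !mulmxA.
rewrite frobDr -scaleNr frobZr frob_rank1 => h2.
have {h2} : e * quad M (Y *m y) <= 0 by lra.
by rewrite pmulr_rle0.
Qed.

Lemma incolP Y x : Y^T = Y -> (forall z, Y *m z = 0 -> (z^T *m x) 0 0 = 0) ->
  exists y, x = Y *m y.
Proof.
move=> sY h; have /submxP[D xD] : (x^T <= Y)%MS.
  rewrite submxE; apply/eqP/rowP => j; rewrite [RHS]mxE.
  have : Y *m col j (cokermx Y) = 0 by rewrite colE mulmxA mulmx_coker mul0mx.
  move/h => <-; rewrite !mxE; apply: eq_bigr => k _; rewrite !mxE; ring.
by exists D^T; rewrite -[in RHS]sY -trmx_mul -xD trmxK.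
Qed.

End Psd.

(** * Amalgamating correlation matrices *)

Section Amalgam.
Variables (R : realType) (n : nat).
Implicit Types (A M X Y : 'M[R]_n) (x y z : 'cV[R]_n) (K : {set 'I_n}).

Definition correlation X := psd X /\ forall i, X i i = 1.

Definition setproj K : 'M[R]_n := diag_mx (\row_i (i \in K)%:R).

Lemma setproj_sym K : (setproj K)^T = setproj K.
Proof. exact: tr_diag_mx. Qed.

Lemma setprojE K p (Z : 'M[R]_(n, p)) i j : (setproj K *m Z) i j = (i \in K)%:R * Z i j.
Proof. by rewrite mul_diag_mx !mxE. Qed.

Lemma setprojEr K p (Z : 'M[R]_(p, n)) i j : (Z *m setproj K) i j = Z i j * (j \in K)%:R.
Proof. by rewrite mul_mx_diag !mxE. Qed.

(** A vector in the kernel of the K-block, extended by zero, is isotropic for X,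
    hence killed by all of X. *)
Lemma psd_block_factor K X : psd X -> exists T : 'M[R]_n,
  X *m setproj K = T *m (setproj K *m X *m setproj K).
Proof.
move=> pX; set P := setproj K; apply/submxP; rewrite submxE.
apply/eqP/matrixP => i j; set C := cokermx _.
have PXPc : P *m X *m P *m col j C = 0 by rewrite colE mulmxA mulmx_coker mul0mx.
have /colP/(_ i) : X *m (P *m col j C) = 0.
  apply: psd_ker => //; rewrite /quad trmx_mul setproj_sym -/P.
  by rewrite -!mulmxA [P *m _]mulmxA [P *m X *m _]mulmxA PXPc mulmx0 mxE.
by rewrite mulmxA colE mulmxA -colE mxE => ->; rewrite !mxE.
Qed.

(** S is the Schur complement of the K-block; the factorization avoids inverting a
    block that may be singular. *)
Lemma psd_block_decomp K X : psd X -> exists T S : 'M[R]_n,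
  [/\ X = T *m (setproj K *m X *m setproj K) *m T^T + S, psd S,
      setproj K *m S = 0
    & X *m setproj K = T *m (setproj K *m X *m setproj K)].
Proof.
move=> pX; have [T TX] := psd_block_factor K pX; have [sX _] := pX.
set P := setproj K in TX *; have sP : P^T = P := setproj_sym K.
have TX' : P *m X = P *m X *m P *m T^T.
  by apply: trmx_inj; rewrite !trmx_mul trmxK sX sP !mulmxA TX !mulmxA.
exists T, (X - T *m (P *m X *m P) *m T^T); split=> //; first by rewrite addrC subrK.
- have -> : X - T *m (P *m X *m P) *m T^T = (1%:M - T *m P) *m X *m (1%:M - T *m P)^T.
    set W := T *m (P *m X *m P) *m T^T.
    have e1 : X *m (P *m T^T) = W by rewrite mulmxA TX.
    have e2 : T *m P *m X = W by rewrite -mulmxA TX' /W !mulmxA.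
    have e3 : T *m P *m X *m (P *m T^T) = W by rewrite /W !mulmxA.
    rewrite linearB /= trmx1 trmx_mul sP mulmxBr mulmx1 mulmxBl mul1mx mulmxBl.
    by rewrite e3 e1 e2 subrr subr0.
  exact: psd_conj.
- by rewrite mulmxBr -TX mulmxA [P *m (_ *m _)]mulmxA -TX' subrr.
Qed.

(** The two matrices share their K-block Y. Write each as T Y T^T plus its Schur
    complement, take the rows of T from the first matrix on A and from the second
    one outside, and add both complements: this is the completion in which the two
    sides are independent given K. Its form vanishes only where all three summands
    do, and this is why its column space is as large as the two sides permit. *)
Lemma amalgam_core (A K : {set 'I_n}) X1 X2 : K \subset A -> psd X1 -> psd X2 ->
  {in K &, forall i j, X1 i j = X2 i j} -> exists X,
  [/\ psd X, {in A &, forall i j, X i j = X1 i j},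
      {in ~: A :|: K &, forall i j, X i j = X2 i j}
    & forall x y1 y2, {in A, forall i, x i 0 = (X1 *m y1) i 0} ->
        {in ~: A :|: K, forall i, x i 0 = (X2 *m y2) i 0} ->
        exists y, x = X *m y].
Proof.
move=> /subsetP KA pX1 pX2 X12; set P := setproj K.
have sP : P^T = P := setproj_sym K.
have XK : P *m X1 *m P = P *m X2 *m P.
  apply/matrixP => i j; rewrite !setprojEr !setprojE.
  case: (boolP (i \in K)) => iK; last by rewrite !mul0r.
  by case: (boolP (j \in K)) => jK; rewrite ?mulr0 // X12.
have [T1 [S1 [X1E pS1 PS1 T1E]]] := psd_block_decomp K pX1.
have [T2 [S2 [X2E pS2 PS2 T2E]]] := psd_block_decomp K pX2.
rewrite -/P in X1E PS1 T1E X2E PS2 T2E.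
rewrite -XK in X2E T2E; set Y := P *m X1 *m P in XK X1E T1E X2E T2E *.
have pY : psd Y by rewrite /Y -{2}sP; apply: psd_conj.
have YE : Y = P *m X1 *m P by [].
clearbody Y; have [sY _] := pY.
pose D1 := setproj A; pose D2 := setproj (~: A).
have sD1 : D1^T = D1 := setproj_sym _.
have sD2 : D2^T = D2 := setproj_sym _.
have D12 : D1 + D2 = 1%:M.
  apply/matrixP => i j; rewrite !mxE -mulrnDl -natrD !inE.
  by case: (i \in A); rewrite ?addr0 ?add0r.
pose T := D1 *m T1 + D2 *m T2.
have rowA p (V : 'M[R]_(n, p)) i j : i \in A -> (T *m V) i j = (T1 *m V) i j.
  by move=> iA; rewrite mulmxDl mxE -!mulmxA !setprojE inE iA mul1r mul0r addr0.
have rowB p (V : 'M[R]_(n, p)) i j : i \notin A -> (T *m V) i j = (T2 *m V) i j.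
  by move=> iA; rewrite mulmxDl mxE -!mulmxA !setprojE inE (negPf iA) mul1r mul0r add0r.
have KP p (V : 'M[R]_(n, p)) i j : i \in K -> (P *m V) i j = V i j.
  by move=> iK; rewrite setprojE iK mul1r.
have T1Y : P *m (T1 *m Y) = Y by rewrite -T1E mulmxA -YE.
have T2Y : P *m (T2 *m Y) = Y by rewrite -T2E mulmxA -XK.
have rowYA i j : i \in A -> (T *m Y) i j = (T1 *m Y) i j by exact: rowA.
have rowYB i j : i \in ~: A :|: K -> (T *m Y) i j = (T2 *m Y) i j.
  rewrite !inE; case: (boolP (i \in A)) => iA /= iK; last exact: rowB.
  by rewrite rowA // -(KP _ (T1 *m Y)) // T1Y -(KP _ (T2 *m Y)) // T2Y.
have TYT i j (I : {set 'I_n}) (T' : 'M[R]_n) :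
    (forall i j, i \in I -> (T *m Y) i j = (T' *m Y) i j) -> i \in I -> j \in I ->
    (T *m Y *m T^T) i j = (T' *m Y *m T'^T) i j.
  move=> h iI jI; have e p (V : 'M[R]_(n, p)) k l : k \in I ->
      (T *m (Y *m V)) k l = (T' *m (Y *m V)) k l.
    by move=> kI; rewrite !mulmxA mxE [RHS]mxE; apply: eq_bigr => q _; rewrite h.
  have t (B : 'M[R]_n) (k l : 'I_n) : B k l = B^T l k by rewrite mxE.
  rewrite -!mulmxA e // t [RHS]t !trmx_mul !trmxK sY -!mulmxA e //.
have SK (S : 'M[R]_n) p (V : 'M[R]_(n, p)) i j : P *m S = 0 -> i \in K -> (S *m V) i j = 0.
  by move=> PS iK; rewrite -(KP _ (S *m V)) // mulmxA PS mul0mx mxE.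
pose X := T *m Y *m T^T + D1 *m S1 *m D1^T + D2 *m S2 *m D2^T.
have pX : psd X by rewrite /X; do ![apply: psdD|apply: psd_conj].
have XE i j : X i j = (T *m Y *m T^T) i j + (D1 *m S1 *m D1^T) i j + (D2 *m S2 *m D2^T) i j.
  by rewrite /X mxE [(_ + D1 *m S1 *m _) _ _]mxE.
exists X; split=> //.
- move=> i j iA jA; rewrite XE.
  rewrite [in RHS]X1E [in RHS]mxE (TYT _ _ A T1 rowYA) // sD1 sD2.
  by rewrite !setprojEr !setprojE !inE iA jA !mul1r !mulr1 mulr0 addr0.
- move=> i j iB jB; rewrite XE.
  rewrite [in RHS]X2E [in RHS]mxE (TYT _ _ _ T2 rowYB) // sD1 sD2 -addrA; congr (_ + _).
  rewrite !setprojEr !setprojE !inE.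
  move: iB jB; rewrite !inE.
  have S1r k l : k \in K -> S1 k l = 0 by move=> kK; rewrite -(mulmx1 S1) SK.
  have S2r k l : k \in K -> S2 k l = 0 by move=> kK; rewrite -(mulmx1 S2) SK.
  have S1c k l : l \in K -> S1 k l = 0.
    by move=> lK; have [sS _] := pS1; rewrite -sS mxE S1r.
  have S2c k l : l \in K -> S2 k l = 0.
    by move=> lK; have [sS _] := pS2; rewrite -sS mxE S2r.
  case: (boolP (i \in A)) => iA /= iK.
    by rewrite S1r // S2r // !(mul0r, mulr0) addr0.
  case: (boolP (j \in A)) => jA /= jK.
    by rewrite S1c // S2c // !(mul0r, mulr0) addr0.
  by rewrite !(mul0r, mulr0) add0r mul1r mulr1.
(* a vector lies in the column space if it is orthogonal to the kernel, and a
   kernel vector of X kills each of the three summands *)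
move=> x y1 y2 x1 x2; have [sX _] := pX.
apply: incolP => // z Xz; have : quad X z = 0 by rewrite /quad -mulmxA Xz mulmx0 mxE.
rewrite /X !quadD !quad_conj => /eqP.
have [_ qY] := pY; have [_ q1] := pS1; have [_ q2] := pS2.
rewrite paddr_eq0 ?addr_ge0 // paddr_eq0 // => /andP[/andP[/eqP zY /eqP z1] /eqP z2].
move/(psd_ker pY): zY => zY; move/(psd_ker pS1): z1 => z1; move/(psd_ker pS2): z2 => z2.
have Px1 : P *m x = Y *m (T1^T *m y1).
  apply/colP => i; case: (boolP (i \in K)) => iK.
    rewrite KP // x1 ?KA // X1E mulmxDl mxE (SK S1) // addr0 -!mulmxA.
    by rewrite -(KP _ (T1 *m _)) // !mulmxA -(mulmxA P) T1Y.
  by rewrite setprojE (negPf iK) mul0r YE -!mulmxA setprojE (negPf iK) mul0r.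
have Px2 : P *m x = Y *m (T2^T *m y2).
  apply/colP => i; case: (boolP (i \in K)) => iK.
    rewrite KP // x2 ?inE ?iK ?orbT // X2E mulmxDl mxE (SK S2) // addr0 -!mulmxA.
    by rewrite -(KP _ (T2 *m _)) // !mulmxA -(mulmxA P) T2Y.
  by rewrite setprojE (negPf iK) mul0r YE -!mulmxA setprojE (negPf iK) mul0r.
have -> : x = T *m (P *m x) + D1 *m S1 *m y1 + D2 *m S2 *m y2.
  apply/colP => i; rewrite mxE [(_ + D1 *m S1 *m y1) i 0]mxE -!mulmxA !setprojE !inE.
  case: (boolP (i \in A)) => iA.
    by rewrite rowA // Px1 x1 // {1}X1E mulmxDl mxE -!mulmxA mul1r mul0r addr0.
  rewrite rowB // Px2 x2 ?inE ?iA // {1}X2E mulmxDl mxE -!mulmxA mul1r mul0r.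
  by rewrite addr0.
rewrite Px1 !mulmxDr !mulmxA.
have [sS1 _] := pS1; have [sS2 _] := pS2.
have -> : z^T *m T *m Y = 0.
  by apply: trmx_inj; rewrite !trmx_mul trmxK sY trmx0 zY.
have -> : z^T *m D1 *m S1 = 0.
  by apply: trmx_inj; rewrite !trmx_mul trmxK sS1 trmx0 z1.
have -> : z^T *m D2 *m S2 = 0.
  by apply: trmx_inj; rewrite !trmx_mul trmxK sS2 trmx0 z2.
by rewrite !mul0mx !addr0 mxE.
Qed.

Lemma amalgam (A1 A2 : {set 'I_n}) X1 X2 : correlation X1 -> correlation X2 ->
  {in A1 :&: A2 &, forall i j, X1 i j = X2 i j} -> exists X,
  [/\ correlation X, {in A1 &, forall i j, X i j = X1 i j},
      {in A2 &, forall i j, X i j = X2 i j}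
    & forall x y1 y2, {in A1, forall i, x i 0 = (X1 *m y1) i 0} ->
        {in A2, forall i, x i 0 = (X2 *m y2) i 0} ->
        exists y, {in A1 :|: A2, forall i, x i 0 = (X *m y) i 0}].
Proof.
move=> [pX1 d1] [pX2 d2] X12.
have [X [pX XA XB Xc]] := amalgam_core (subsetIl A1 A2) pX1 pX2 X12.
have A2B i : i \in A2 -> i \in ~: A1 :|: (A1 :&: A2).
  by move=> iA; rewrite !inE iA andbT orNb.
exists X; split=> //.
- split=> // i; case: (boolP (i \in A1)) => iA; first by rewrite XA.
  by rewrite XB // !inE iA.
- by move=> i j iA jA; rewrite XB ?A2B.
move=> x y1 y2 x1 x2.
have [|| y xE] := Xc (\col_i (if i \in A1 :|: A2 then x i 0 else (X2 *m y2) i 0)) y1 y2.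
- by move=> i iA; rewrite mxE inE iA /= x1.
- move=> i; rewrite mxE !inE; case: (boolP (i \in A2)) => iA2; first by rewrite orbT x2.
  by rewrite andbF !orbF => /negPf ->.
by exists y => i iA; rewrite -xE mxE iA.
Qed.

End Amalgam.

(** * Separations and two-terminal networks *)

Section RelSep.
Variables (T : finType).
Implicit Types (e : rel T) (A B : {set T}).

Definition clique e A := {in A &, forall i j, i != j -> e i j}.

Definition separation e A A1 A2 :=
  A = A1 :|: A2 /\ {in A1 :\: A2 & A2 :\: A1, forall i j, ~~ e i j}.

Lemma separation_edge e A A1 A2 i j : symmetric e -> separation e A A1 A2 ->
  i \in A -> j \in A -> e i j ->
  (i \in A1) && (j \in A1) || (i \in A2) && (j \in A2).
Proof.
move=> es [-> nc]; rewrite !inE => iA jA eij.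
apply: contraT; move: (nc i j) (nc j i); rewrite [e j i]es eij /= !inE.
move: iA jA; do 4![case: (_ \in _)] => //= _ _ a b;
  by first [have := a isT isT | have := b isT isT].
Qed.

Lemma separationC e A A1 A2 : symmetric e -> separation e A A1 A2 -> separation e A A2 A1.
Proof.
by move=> es [-> h]; split; [exact: setUC|move=> i j i2 j1; rewrite es; apply: h].
Qed.

(** Generalized series-parallel networks: the shape of a side of a separation by a
    nonadjacent pair u, v for which the extreme values of the entry uv can be
    certified by one matrix. A part attached along a clique does not influence the
    entry uv at all. *)
Inductive network e : {set T} -> T -> T -> Prop :=
| network_edge A u v : u \in A -> v \in A -> u != v -> e u v -> network e A u v
| network_pendant A A' B u v : separation e A A' B -> clique e (A' :&: B) ->
    network e A' u v -> network e A u v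
| network_parallel A A1 A2 u v : separation e A A1 A2 -> A1 :&: A2 = [set u; v] ->
    network e A1 u v -> network e A2 u v -> network e A u v
| network_series A A1 A2 u w v : separation e A A1 A2 -> A1 :&: A2 = [set w] ->
    network e A1 u w -> network e A2 w v -> network e A u v.

Lemma network_ends e A u v : network e A u v -> [/\ u \in A, v \in A & u != v].
Proof.
elim=> {A u v} [//|A A' B u v [-> _] _ _ [uA vA uv]|A A1 A2 u v [-> _] _ _ [uA vA uv] _ _|
    A A1 A2 u w v [-> _] K _ [uA wA uw] _ [wA2 vA wv]].
- by rewrite !inE uA vA.
- by rewrite !inE uA vA.
rewrite !inE uA vA orbT; split=> //; apply: contraNneq uw => uv.
by rewrite -in_set1 -K inE uA uv.
Qed.

End RelSep.

(** * Correlation matrices with prescribed entries *)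

Section Matrices.
Variables (R : realType) (n : nat).
Implicit Types (A : {set 'I_n}) (M X Y : 'M[R]_n) (x y z : 'cV[R]_n) (e : rel 'I_n).

Definition supported A e M := M^T = M /\
  forall i j, ~~ [&& i \in A, j \in A & (i == j) || e i j] -> M i j = 0.

Definition agree A e X Y := {in A &, forall i j, e i j -> X i j = Y i j}.

(** The vectors left by the first stress: unit vectors with inner product 1 or -1
    are equal or opposite, so an edge with such a value ties two coordinates of every
    vector in the column space of a solution. *)
Definition collapsed A e X x :=
  {in A &, forall i j, e i j -> X i j ^+ 2 = 1 -> x i 0 = X i j * x j 0}.

Lemma supported0 A e : supported A e 0.
Proof. by split=> [|i j _]; rewrite ?trmx0 ?mxE. Qed.

Lemma supportedD A e M N : supported A e M -> supported A e N -> supported A e (M + N).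
Proof.
by move=> [sM zM] [sN zN]; split=> [|i j h]; rewrite ?linearD /= ?sM ?sN // mxE zM ?zN ?addr0.
Qed.

Lemma supportedZ A e a M : supported A e M -> supported A e (a *: M).
Proof.
by move=> [sM zM]; split=> [|i j h]; rewrite ?linearZ /= ?sM // mxE zM ?mulr0.
Qed.

Lemma supported_sub A A' e M : A \subset A' -> supported A e M -> supported A' e M.
Proof.
move=> /subsetP AA [sM zM]; split=> // i j h; apply: zM; apply: contra h => /and3P[iA jA ->].
by rewrite !AA.
Qed.

Lemma supported_sym_unit A e i j : symmetric e -> i \in A -> j \in A ->
  (i == j) || e i j -> supported A e (sym_unit R i j).
Proof.
move=> es iA jA ij; split=> [|k l h].
  by rewrite /sym_unit linearZ linearD /= !trmx_delta addrC.
have H k' l' : (k', l') = (i, j) \/ (k', l') = (j, i) ->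
    [&& k' \in A, l' \in A & (k' == l') || e k' l'].
  by case=> [[-> ->]|[-> ->]]; rewrite iA jA //= eq_sym es.
rewrite !mxE; case: (boolP ((k == i) && (l == j))) => [/andP[/eqP ki /eqP lj]|_].
  by rewrite H ?ki ?lj // in h; left.
case: (boolP ((k == j) && (l == i))) => [/andP[/eqP ki /eqP lj]|_].
  by rewrite H ?ki ?lj // in h; right.
by rewrite addr0 mulr0.
Qed.

Lemma bil_delta X i j : bil X (delta_mx i 0) (delta_mx j 0) = X i j.
Proof. by rewrite bil_mulr trmx_delta -rowE mxE mul_delta. Qed.

Lemma bil_deltal X i y : bil X (delta_mx i 0) y = (X *m y) i 0.
Proof. by rewrite bil_mulr trmx_delta -rowE mxE. Qed.

Lemma quad_sym_unit i j x : quad (sym_unit R i j) x = x i 0 * x j 0.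
Proof.
rewrite quadZ quadD.
have H k l : quad (delta_mx k l) x = x k 0 * x l 0.
  rewrite quadE (bigD1 k) //= (bigD1 l) //= !mxE !eqxx mul1r.
  rewrite big1 ?addr0 ?big1 ?addr0 //.
    by move=> p pk; rewrite big1 // => q _; rewrite !mxE (negPf pk) mul0r.
  by move=> p pk; rewrite !mxE (negPf pk) andbF mul0r.
by rewrite !H; field.
Qed.

Lemma frob_sym_unit i j X : X^T = X -> frob (sym_unit R i j) X = X i j.
Proof.
move=> sX; rewrite frobZ frobD.
have H k l : frob (delta_mx k l) X = X k l.
  rewrite /frob (bigD1 k) //= (bigD1 l) //= !mxE !eqxx mul1r.
  rewrite big1 ?addr0 ?big1 ?addr0 //.
    by move=> p pk; rewrite big1 // => q _; rewrite !mxE (negPf pk) mul0r.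
  by move=> p pk; rewrite !mxE (negPf pk) andbF mul0r.
by rewrite !H -[in X j i]sX mxE; field.
Qed.

Lemma frob_agree A e M X Y : supported A e M -> correlation X -> correlation Y ->
  agree A e X Y -> frob M X = frob M Y.
Proof.
move=> [_ zM] [_ dX] [_ dY] XY; apply: eq_bigr => i _; apply: eq_bigr => j _.
have [/and3P[iA jA /orP[/eqP ->|eij]]|h] := boolP [&& i \in A, j \in A & (i == j) || e i j].
- by rewrite dX dY.
- by rewrite XY.
- by rewrite zM ?mul0r.
Qed.

Lemma corr_sym X i j : correlation X -> X i j = X j i.
Proof. by move=> [[sX _] _]; rewrite -[in LHS]sX mxE. Qed.

Lemma corr_sqr_le1 X i j : correlation X -> X i j ^+ 2 <= 1.
Proof.
move=> [pX dX]; have := psd_cauchy (delta_mx i 0) (delta_mx j 0) pX.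
by rewrite bil_delta !quad_delta !dX mulr1.
Qed.

(** The vector e_i - X_ij e_j is isotropic, hence in the kernel of X. *)
Lemma corr_tied X i j y : correlation X -> X i j ^+ 2 = 1 ->
  (X *m y) i 0 = X i j * (X *m y) j 0.
Proof.
move=> cX x1; have [pX dX] := cX; have [sX _] := pX.
pose d : 'cV[R]_n := delta_mx i 0 + (- X i j) *: delta_mx j 0.
have q0 : quad X d = 0.
  rewrite -[quad X _]/(bil X _ _) /d bilDl !bilDr !bilZl !bilZr !bil_delta !dX.
  rewrite (corr_sym j i cX); lra.
have : bil X d y = 0.
  rewrite /bil -[in d^T *m X]sX -trmx_mul (psd_ker pX q0).
  by rewrite trmx0 mul0mx mxE.
by rewrite bilDl bilZl !bil_deltal mulNr => /eqP; rewrite subr_eq0 => /eqP.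
Qed.

Lemma corr_collapsed A e X Y y : correlation Y -> agree A e Y X ->
  collapsed A e X (Y *m y).
Proof. by move=> cY YX i j iA jA eij; rewrite -YX // => ?; apply: corr_tied. Qed.

Lemma collapsed_sub A A' e X x : A \subset A' -> collapsed A' e X x -> collapsed A e X x.
Proof. by move=> /subsetP AA h i j iA jA; apply: h; apply: AA. Qed.

Lemma corr_convex X Y l : 0 <= l <= 1 -> correlation X -> correlation Y ->
  correlation (l *: Y + (1 - l) *: X).
Proof.
move=> /andP[l0 l1] [pX dX] [pY dY]; split=> [|i].
  by apply: psdD; apply: psdZ; rewrite ?subr_ge0.
rewrite !mxE dX dY; ring.
Qed.

Lemma agree_convex A e X Y l : agree A e Y X -> agree A e (l *: Y + (1 - l) *: X) X.
Proof. by move=> h i j iA jA eij; rewrite !mxE h //; ring. Qed.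

Lemma separationS (e : rel 'I_n) A A1 A2 : separation e A A1 A2 -> A1 \subset A /\ A2 \subset A.
Proof. by case=> -> _; rewrite subsetUl subsetUr. Qed.

Lemma glue A A1 A2 e X Y1 Y2 : symmetric e -> separation e A A1 A2 ->
  correlation Y1 -> correlation Y2 -> agree A1 e Y1 X -> agree A2 e Y2 X ->
  {in A1 :&: A2 &, forall i j, Y1 i j = Y2 i j} -> exists Y,
  [/\ correlation Y, agree A e Y X, {in A1 &, forall i j, Y i j = Y1 i j},
      {in A2 &, forall i j, Y i j = Y2 i j}
    & forall x y1 y2, {in A1, forall i, x i 0 = (Y1 *m y1) i 0} ->
        {in A2, forall i, x i 0 = (Y2 *m y2) i 0} ->
        exists y, {in A, forall i, x i 0 = (Y *m y) i 0}].
Proof.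
move=> es sep c1 c2 a1 a2 K12; have [Y [cY Y1E Y2E Yc]] := amalgam c1 c2 K12.
exists Y; split=> //; last by case: sep => ->.
move=> i j iA jA eij; have /orP[/andP[i1 j1]|/andP[i1 j1]] := separation_edge es sep iA jA eij.
  by rewrite Y1E // a1.
by rewrite Y2E // a2.
Qed.

(** The Gram matrix of unit vectors in a plane. All vertices other than u and v are
    sent to the vector (1, 0); the sign k says whether u and v lie on the same side of
    this vector or on opposite sides. *)
Lemma triangle_corr (u w v : 'I_n) (s1 s2 k : R) : u != w -> v != w -> u != v ->
  s1 ^+ 2 <= 1 -> s2 ^+ 2 <= 1 -> k ^+ 2 = 1 -> exists Z : 'M[R]_n,
  [/\ correlation Z, Z u w = s1, Z w v = s2
    & Z u v = s1 * s2 + k * Num.sqrt (1 - s1 ^+ 2) * Num.sqrt (1 - s2 ^+ 2)].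
Proof.
move=> uw vw uv h1 h2 hk.
pose r1 := Num.sqrt (1 - s1 ^+ 2); pose r2 := Num.sqrt (1 - s2 ^+ 2).
have r1E : r1 ^+ 2 = 1 - s1 ^+ 2 by rewrite sqr_sqrtr // subr_ge0.
have r2E : r2 ^+ 2 = 1 - s2 ^+ 2 by rewrite sqr_sqrtr // subr_ge0.
pose a : 'cV[R]_n := \col_i (if i == u then s1 else if i == v then s2 else 1).
pose b : 'cV[R]_n := \col_i (if i == u then r1 else if i == v then k * r2 else 0).
exists (a *m a^T + b *m b^T).
have ZE i j : (a *m a^T + b *m b^T) i j = a i 0 * a j 0 + b i 0 * b j 0.
  by rewrite mxE [in X in X + _]mxE [in X in _ + X]mxE !big_ord1 ![_^T _ _]mxE.
have wu : w != u by rewrite eq_sym.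
have wv : w != v by rewrite eq_sym.
have vu : v != u by rewrite eq_sym.
split; rewrite ?ZE ?mxE ?eqxx ?(negPf uw) ?(negPf uv) ?(negPf vw) ?(negPf wu) ?(negPf vu) ?(negPf wv).
- split; first by apply: psdD; exact: psd_rank1.
  move=> i; rewrite ZE !mxE -!expr2; case: ifP => _; first by rewrite r1E; ring.
  by case: ifP => _; rewrite ?exprMn ?hk ?r2E; ring.
- ring.
- ring.
- by rewrite /r1 /r2; ring.
Qed.

End Matrices.

(** * One-sided optimality on the unit interval *)

Section RealIneq.
Variable R : realType.
Implicit Types a b c d l s t : R.

Lemma ge0_of_small a c : (forall l, 0 < l <= 1 -> 0 <= a + c * l) -> 0 <= a.
Proof.
move=> h; rewrite leNgt; apply/negP => a0.
have c0 : 0 < `|c| + 1 - a by have := normr_ge0 c; lra.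
pose l := - a / (2 * (`|c| + 1 - a)).
have l0 : 0 < l by rewrite divr_gt0 //; lra.
have cl : (`|c| + 1 - a) * l = - a / 2 by rewrite /l; field; rewrite gt_eqF.
have l1 : l <= 1.
  by rewrite /l ler_pdivrMr; [have := normr_ge0 c; lra|lra].
have /h : 0 < l <= 1 by rewrite l0 l1.
have : c * l <= `|c| * l by rewrite ler_pM2r // ler_norm.
have : (1 - a) * l >= 0 by rewrite mulr_ge0 ?ltW //; lra.
lra.
Qed.

(** The derivative at t1, in direction d, of s |-> g s t2 - sqrt (1 - s^2) r2, where
    r2 = sqrt (1 - t2^2), is nonnegative at a minimum, even when only the segment from
    t1 to t1 + d is admissible. *)
Lemma first_order g t1 t2 d :
  t1 ^+ 2 < 1 -> t2 ^+ 2 <= 1 -> g ^+ 2 = 1 ->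
  (forall l, 0 < l <= 1 ->
     g * t1 * t2 - Num.sqrt (1 - t1 ^+ 2) * Num.sqrt (1 - t2 ^+ 2) <=
     g * (t1 + l * d) * t2 -
       Num.sqrt (1 - (t1 + l * d) ^+ 2) * Num.sqrt (1 - t2 ^+ 2)) ->
  (forall l, 0 < l <= 1 -> (t1 + l * d) ^+ 2 <= 1) ->
  0 <= d * (g * t2 * Num.sqrt (1 - t1 ^+ 2) + t1 * Num.sqrt (1 - t2 ^+ 2)).
Proof.
move=> t1l t2l g2 h hs.
set r1 := Num.sqrt (1 - t1 ^+ 2); set r2 := Num.sqrt (1 - t2 ^+ 2).
have r1E : r1 ^+ 2 = 1 - t1 ^+ 2 by rewrite sqr_sqrtr // subr_ge0 ltW.
have r1P : 0 < r1 by rewrite sqrtr_gt0 subr_gt0.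
have r2P : 0 <= r2 by apply: sqrtr_ge0.
(* C l bounds the error of the first-order expansion at t1 + l d *)
pose C := r2 * d ^+ 2 + d ^+ 2 * (2 + `|d|) / r1.
suff : 0 <= 2 * (d * (g * t2 * r1 + t1 * r2)) by rewrite pmulr_rge0.
apply: (@ge0_of_small _ C) => l l01; have := h l l01; have hsl := hs l l01.
set s := t1 + l * d in hsl *; set p := Num.sqrt (1 - s ^+ 2).
rewrite -/r1 -/r2 => h1; have /andP[l0 l1] := l01.
have pE : p ^+ 2 = 1 - s ^+ 2 by rewrite sqr_sqrtr // subr_ge0.
have pP : 0 <= p by apply: sqrtr_ge0.
have rp : 0 < r1 + p by lra.
have key : 0 <= d * (r2 * (2 * t1 + l * d) + g * t2 * (r1 + p)).
  rewrite -(pmulr_rge0 _ l0).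
  have : 0 <= (r1 + p) * (r2 * (r1 - p) + g * t2 * (l * d)).
    by rewrite mulr_ge0 ?(ltW rp) //; rewrite /s in h1; lra.
  have -> : (r1 + p) * (r2 * (r1 - p) + g * t2 * (l * d)) =
     r2 * (r1 ^+ 2 - p ^+ 2) + g * t2 * (l * d) * (r1 + p) by ring.
  rewrite r1E pE /s => h2; apply: le_trans h2 _; rewrite le_eqVlt; apply/orP; left.
  by apply/eqP; ring.
have bnd : `|g * t2 * d * (p - r1)| <= d ^+ 2 * (2 + `|d|) / r1 * l.
  have -> : p - r1 = - (l * d * (2 * t1 + l * d)) / (r1 + p).
    apply: (mulIf (lt0r_neq0 rp)); rewrite divfK ?lt0r_neq0 //.
    have -> : (p - r1) * (r1 + p) = p ^+ 2 - r1 ^+ 2 by ring.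
    by rewrite pE r1E /s; ring.
  have g1 : `|g| = 1.
    by apply/eqP; rewrite -(@eqrXn2 _ 2) // ?normr_ge0 // real_normK ?num_real // g2 expr1n.
  have nt2 : `|t2| <= 1 by rewrite -(@expr_le1 _ 2) // real_normK ?num_real.
  have nt1 : `|t1| <= 1 by rewrite -(@expr_le1 _ 2) // real_normK ?num_real // ltW.
  rewrite !normrM g1 mul1r normrN !normrM (ger0_norm (ltW l0)) normfV (gtr0_norm rp).
  have n1 : `|2 * t1 + l * d| <= 2 + `|d|.
    apply: le_trans (ler_normD _ _) _; rewrite !normrM (ger0_norm (ltW l0)).
    rewrite ger0_norm //; have : l * `|d| <= 1 * `|d| by rewrite ler_wpM2r.
    by move=> ?; lra.
  have dd : d ^+ 2 = `|d| * `|d| by rewrite -expr2 real_normK ?num_real.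
  have ir : (r1 + p)^-1 <= r1^-1 by rewrite lef_pV2 ?posrE //; lra.
  rewrite dd.
  have -> : `|t2| * `|d| * (l * `|d| * `|2 * t1 + l * d| / (r1 + p)) =
     (`|t2| * (`|2 * t1 + l * d| * (r1 + p)^-1)) * (`|d| * `|d| * l) by ring.
  have -> : `|d| * `|d| * (2 + `|d|) / r1 * l = (1 * ((2 + `|d|) / r1)) * (`|d| * `|d| * l).
    by ring.
  apply: ler_wpM2r; first by rewrite !mulr_ge0 // ltW.
  apply: ler_pM => //; first by rewrite mulr_ge0 // invr_ge0 ltW.
  by apply: ler_pM => //; rewrite invr_ge0 ltW.
move: bnd; rewrite ler_norml => /andP[_ bnd]; rewrite /C.
have l2 : 0 <= r2 * d ^+ 2 * l by rewrite mulr_ge0 ?(ltW l0) // mulr_ge0 ?sqr_ge0.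
lra.
Qed.

(** At t1 = 1 or -1 the square root has infinite slope: moving away from t1 by l d
    lowers the right-hand side by the order of sqrt l, while its linear term only
    changes by the order of l. *)
Lemma rigid_endpoint g t1 t2 d :
  t1 ^+ 2 = 1 -> t2 ^+ 2 < 1 -> g ^+ 2 = 1 ->
  (forall l, 0 < l <= 1 -> g * t1 * t2 <=
     g * (t1 + l * d) * t2 -
       Num.sqrt (1 - (t1 + l * d) ^+ 2) * Num.sqrt (1 - t2 ^+ 2)) ->
  (t1 + d) ^+ 2 <= 1 -> d = 0.
Proof.
move=> t1E t2l g2 h hs; have td : 2 * t1 * d + d ^+ 2 <= 0 by lra.
set r2 := Num.sqrt (1 - t2 ^+ 2) in h.
have r2E : r2 ^+ 2 = 1 - t2 ^+ 2 by rewrite sqr_sqrtr // subr_ge0 ltW.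
have d2 : 0 <= d ^+ 2 by apply: sqr_ge0.
have hsl l : 0 < l <= 1 -> (t1 + l * d) ^+ 2 <= 1.
  move=> /andP[l0 l1].
  have -> : (t1 + l * d) ^+ 2 = t1 ^+ 2 + l * (2 * t1 * d + l * d ^+ 2) by ring.
  rewrite t1E gerDl pmulr_rle0 //; have : l * d ^+ 2 <= 1 * d ^+ 2 by rewrite ler_wpM2r.
  lra.
have : 0 <= r2 ^+ 2 * (2 * t1 * d).
  apply: (@ge0_of_small _ (d ^+ 2)) => l l01; have := h l l01; have := hsl l l01.
  have /andP[l0 l1] := l01; set s := t1 + l * d; set p := Num.sqrt (1 - s ^+ 2) => sl h1.
  have pE : p ^+ 2 = 1 - s ^+ 2 by rewrite sqr_sqrtr // subr_ge0.
  have pr : 0 <= p * r2 by rewrite mulr_ge0 ?sqrtr_ge0.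
  have : (p * r2) ^+ 2 <= (g * t2 * (l * d)) ^+ 2.
    rewrite ler_sqr ?nnegrE //; rewrite /s in h1 *; lra.
  rewrite !exprMn g2 pE r2E /s => h2.
  have : 0 <= l * ((1 - t2 ^+ 2) * (2 * t1 * d) + d ^+ 2 * l).
    have e : (t1 + l * d) ^+ 2 = t1 ^+ 2 + l * (2 * t1 * d + l * d ^+ 2) by ring.
    rewrite e t1E in h2; lra.
  by rewrite pmulr_rge0 // r2E.
rewrite pmulr_rge0; last by rewrite r2E subr_gt0.
move=> ?; apply/eqP; rewrite -sqrf_eq0 eq_le d2 andbT; lra.
Qed.

End RealIneq.

(** * Certificates for the extreme entries of a network *)

Section NetworkCertificate.
Variables (R : realType) (n : nat) (e : rel 'I_n).
Hypothesis es : symmetric e.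
Implicit Types (A : {set 'I_n}) (M X Y : 'M[R]_n) (x y z : 'cV[R]_n).

Definition extremal A X u v (g : R) :=
  forall Y, correlation Y -> agree A e Y X -> 0 <= g * (Y u v - X u v).

(** A dual proof that the entry uv is extremal: pairing M + g E_uv with any solution
    shows that g X_uv is minimal. Only the vectors tied by the edges of value 1 and
    -1 are considered; without this restriction duality may fail. *)
Definition certificate A X u v (g : R) M :=
  [/\ supported A e M,
      forall x, collapsed A e X x -> 0 <= quad M x + g * (x u 0 * x v 0)
    & frob M X + g * X u v <= 0].

Lemma sqr_eq1 (g : R) : g ^+ 2 = 1 -> g = 1 \/ g = -1.
Proof. by move/eqP; rewrite sqrf_eq1 => /orP[] /eqP; [left|right]. Qed.

Lemma quad_sym_unit_diag (a b c : R) u v w x :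
  quad (a *: sym_unit R u u + b *: sym_unit R v v + c *: sym_unit R w w : 'M[R]_n) x =
  a * x u 0 ^+ 2 + b * x v 0 ^+ 2 + c * x w 0 ^+ 2.
Proof. by rewrite !quadD (quadZ a) (quadZ b) (quadZ c) !quad_sym_unit !expr2. Qed.

Lemma frob_sym_unit_diag (a b c : R) u v w X : correlation X ->
  frob (a *: sym_unit R u u + b *: sym_unit R v v + c *: sym_unit R w w : 'M[R]_n) X = a + b + c.
Proof.
by move=> [[sX _] dX]; rewrite !frobD (frobZ a) (frobZ b) (frobZ c) !frob_sym_unit // !dX !mulr1.
Qed.

Lemma supported_diag A (a b c : R) u v w : u \in A -> v \in A -> w \in A ->
  supported A e (a *: sym_unit R u u + b *: sym_unit R v v + c *: sym_unit R w w).
Proof.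
move=> uA vA wA.
by do 2?apply: supportedD; apply: supportedZ; apply: supported_sym_unit; rewrite ?eqxx.
Qed.

(** If X_uv = - g then g X_uv is the least value that any correlation matrix allows,
    and the square (x_u + g x_v)^2 proves it. *)
Lemma certificate_opposite A X u v (g : R) : g ^+ 2 = 1 -> correlation X ->
  u \in A -> v \in A -> X u v = - g -> exists M, certificate A X u v g M.
Proof.
move=> g2 cX uA vA Xuv.
exists (2^-1 *: sym_unit R u u + 2^-1 *: sym_unit R v v + 0 *: sym_unit R u u); split.
- exact: supported_diag.
- move=> x _; rewrite quad_sym_unit_diag.
  have : 0 <= (x u 0 + g * x v 0) ^+ 2 by apply: sqr_ge0.
  have -> : (x u 0 + g * x v 0) ^+ 2 =
    x u 0 ^+ 2 + g ^+ 2 * x v 0 ^+ 2 + 2 * (g * (x u 0 * x v 0)) by ring.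
  rewrite g2; lra.
- by rewrite frob_sym_unit_diag // Xuv mulrN -expr2 g2; lra.
Qed.

(** If x_u = g x_v is forced then x_u x_v can be replaced by squares. *)
Lemma certificate_tied A X u v (g : R) : g ^+ 2 = 1 -> correlation X ->
  u \in A -> v \in A -> X u v = g ->
  (forall x, collapsed A e X x -> x u 0 = g * x v 0) ->
  exists M, certificate A X u v g M.
Proof.
move=> g2 cX uA vA Xuv tied.
exists ((- 2^-1) *: sym_unit R u u + (- 2^-1) *: sym_unit R v v + 0 *: sym_unit R u u); split.
- exact: supported_diag.
- move=> x /tied xu; rewrite quad_sym_unit_diag xu.
  have -> : g * (g * x v 0 * x v 0) = g ^+ 2 * x v 0 ^+ 2 by ring.
  by rewrite exprMn g2; lra.
- by rewrite frob_sym_unit_diag // Xuv -expr2 g2; lra.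
Qed.

(** If both sides could lower g X_uv then, the values on each side forming an
    interval, they could lower it to the same value, and be glued there. *)
Lemma extremal_parallel A A1 A2 u v X g : g ^+ 2 = 1 -> correlation X ->
  separation e A A1 A2 -> A1 :&: A2 = [set u; v] ->
  extremal A X u v g -> extremal A1 X u v g \/ extremal A2 X u v g.
Proof.
move=> g2 cX sep K ext; apply: contrapT => /not_orP[].
move=> /existsNP[Y1 /not_implyP[c1 /not_implyP[a1 n1]]].
move=> /existsNP[Y2 /not_implyP[c2 /not_implyP[a2 n2]]].
have {n1} : g * (Y1 u v - X u v) < 0 by rewrite ltNge; apply/negP.
have {n2} : g * (Y2 u v - X u v) < 0 by rewrite ltNge; apply/negP.
wlog le12 : A1 A2 sep K Y1 Y2 c1 c2 a1 a2 / g * (Y1 u v - X u v) <= g * (Y2 u v - X u v).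
  move=> H h2 h1; have [le12|/ltW le21] := leP (g * (Y1 u v - X u v)) (g * (Y2 u v - X u v)).
    exact: (H A1 A2 sep K Y1 Y2).
  by apply: (H A2 A1 _ _ Y2 Y1) => //; [exact: separationC|rewrite setIC].
set d1 := g * (Y1 u v - _) in le12 *; set d2 := g * (Y2 u v - _) in le12 * => h2 h1.
pose l := d2 / d1.
have l01 : 0 <= l <= 1.
  have -> : l = (- d2) / (- d1) by rewrite invrN mulrNN.
  apply/andP; split; first by rewrite divr_ge0 ?oppr_ge0 ?ltW.
  by rewrite ler_pdivrMr ?oppr_gt0 // mul1r lerN2.
pose Y := l *: Y1 + (1 - l) *: X.
have cY : correlation Y by apply: corr_convex.
have YE : Y u v = Y2 u v.
  have gK a : g * (g * a) = a by rewrite mulrA -expr2 g2 mul1r.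
  have -> : Y u v = X u v + l * (Y1 u v - X u v) by rewrite !mxE; ring.
  rewrite -[Y1 u v - X u v]gK mulrCA -/d1 /l divfK ?lt_eqF // gK; ring.
have aY : agree A1 e Y X by apply: agree_convex.
have [|Z [cZ aZ Z1 Z2 _]] := glue es sep cY c2 aY a2.
  move=> i j; rewrite K !inE => /orP[]/eqP-> /orP[]/eqP->; rewrite ?YE //.
  - by rewrite cY.2 c2.2.
  - by rewrite (corr_sym _ _ cY) YE (corr_sym _ _ c2).
  - by rewrite cY.2 c2.2.
have := ext Z cZ aZ; rewrite Z2.
- by rewrite -/d2 leNgt h2.
- by have := set21 u v; rewrite -K inE => /andP[].
- by have := set22 u v; rewrite -K inE => /andP[].
Qed.

Lemma extremal_pendant A A' B u v X g : correlation X ->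
  separation e A A' B -> clique e (A' :&: B) -> u \in A' -> v \in A' ->
  extremal A X u v g -> extremal A' X u v g.
Proof.
move=> cX sep K uA vA ext Y cY aY.
have [|Z [cZ aZ Z1 Z2 _]] := glue es sep cY cX aY (fun _ _ _ _ _ => erefl).
  move=> i j iK jK; have [->|ij] := eqVneq i j; first by rewrite cY.2 cX.2.
  by move: (iK) (jK); rewrite !inE => /andP[iA' _] /andP[jA' _]; rewrite aY // K.
by rewrite -(Z1 u v) //; apply: ext.
Qed.

Section Series.
Variables (A A1 A2 : {set 'I_n}) (u w v : 'I_n) (X : 'M[R]_n) (g : R).
Hypotheses (sep : separation e A A1 A2) (K : A1 :&: A2 = [set w]).
Hypotheses (uw : u != w) (wv : w != v) (uv : u != v).
Hypotheses (uA : u \in A1) (vA : v \in A2).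
Hypotheses (cX : correlation X) (g2 : g ^+ 2 = 1).

Lemma mid_in1 : w \in A1. Proof. by have := set11 w; rewrite -K inE => /andP[]. Qed.
Lemma mid_in2 : w \in A2. Proof. by have := set11 w; rewrite -K inE => /andP[]. Qed.

(** Two sides that share only w can be rotated about w, so that the angle uv becomes
    the sum or the difference of the angles uw and wv. *)
Lemma series_rotate Y1 Y2 k : correlation Y1 -> correlation Y2 ->
  agree A1 e Y1 X -> agree A2 e Y2 X -> k ^+ 2 = 1 -> exists Y,
  [/\ correlation Y, agree A e Y X & Y u v = Y1 u w * Y2 w v +
   k * Num.sqrt (1 - Y1 u w ^+ 2) * Num.sqrt (1 - Y2 w v ^+ 2)].
Proof.
move=> c1 c2 a1 a2 k2; have [AE nc] := sep.
have notin1 i : i \in A2 -> i != w -> i \notin A1.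
  by move=> i2; apply: contra => i1; rewrite -in_set1 -K inE i1.
have notin2 i : i \in A1 -> i != w -> i \notin A2.
  by move=> i1; apply: contra => i2; rewrite -in_set1 -K inE i1.
have [Z [cZ Z1 Z2 Z3]] := triangle_corr uw (negbT (introF eqP (nesym (elimN eqP wv))))
  uv (corr_sqr_le1 u w c1) (corr_sqr_le1 w v c2) k2.
have [|Y3 [c3 Y31 Y32 _]] := @amalgam R n A1 [set u; w; v] Y1 Z c1 cZ.
  have U i : i \in A1 :&: [set u; w; v] -> i = u \/ i = w.
    rewrite !inE => /andP[i1 /orP[/orP[]|]/eqP iE]; subst i; [by left|by right|].
    by have := notin1 v vA; rewrite i1 eq_sym wv => /(_ isT).
  move=> i j /U[]-> /U[]->; rewrite ?c1.2 ?cZ.2 ?Z1 //.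
  by rewrite (corr_sym _ _ c1) (corr_sym _ _ cZ) Z1.
have [|Y [cY Y1E Y2E _]] := @amalgam R n (v |: A1) A2 Y3 Y2 c3 c2.
  have U i : i \in (v |: A1) :&: A2 -> i = v \/ i = w.
    rewrite !inE => /andP[/orP[/eqP|i1] i2]; first by left.
    by right; apply/eqP; apply: contraT => iw; rewrite (negPf (notin2 i i1 iw)) in i2.
  have V : Y3 w v = Y2 w v by rewrite Y32 ?Z2 // !inE eqxx ?orbT.
  move=> i j /U[]-> /U[]->; rewrite ?c3.2 ?c2.2 ?V //.
  by rewrite (corr_sym _ _ c3) (corr_sym _ _ c2) V.
exists Y; split=> //.
  move=> i j iA jA eij.
  have /orP[/andP[i1 j1]|/andP[i1 j1]] := separation_edge es sep iA jA eij.
    by rewrite Y1E ?inE ?i1 ?j1 ?orbT // Y31 // a1.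
  by rewrite Y2E // a2.
by rewrite Y1E ?inE ?eqxx ?uA ?orbT // Y32 ?Z3 // !inE eqxx ?orbT.
Qed.

Hypothesis ext : extremal A X u v g.

Lemma series_ineq Y1 Y2 : correlation Y1 -> correlation Y2 ->
  agree A1 e Y1 X -> agree A2 e Y2 X ->
  g * X u v <= g * Y1 u w * Y2 w v
     - Num.sqrt (1 - Y1 u w ^+ 2) * Num.sqrt (1 - Y2 w v ^+ 2).
Proof.
move=> c1 c2 a1 a2; have [|Y [cY aY YE]] := series_rotate (k := - g) c1 c2 a1 a2.
  by rewrite sqrrN.
have := ext cY aY; rewrite YE.
set r1 := Num.sqrt _; set r2 := Num.sqrt _.
have -> : g * (Y1 u w * Y2 w v + - g * r1 * r2 - X u v) =
   g * Y1 u w * Y2 w v - g ^+ 2 * (r1 * r2) - g * X u v by ring.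
by rewrite g2; lra.
Qed.

Lemma convex_entry Y l i j : (l *: Y + (1 - l) *: X) i j = X i j + l * (Y i j - X i j).
Proof. by rewrite !mxE; ring. Qed.

Lemma l01W (l : R) : 0 < l <= 1 -> 0 <= l <= 1.
Proof. by case/andP=> /ltW -> ->. Qed.

(** If u is tied to w then X_uv is a multiple of X_wv alone; a solution on the first
    side in which u leaves w could be rotated so that g X_uv decreases, by the infinite
    slope of the square root. *)
Lemma series_rigid1 Y1 : X u w ^+ 2 = 1 -> X w v ^+ 2 < 1 -> correlation Y1 ->
  agree A1 e Y1 X -> Y1 u w = X u w.
Proof.
move=> t1 t2 c1 a1.
have Xuv : X u v = X u w * X w v.
  by have := corr_tied (delta_mx v 0) cX t1; rewrite !mul_delta.
apply/eqP; rewrite -subr_eq0; apply/eqP.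
apply: (@rigid_endpoint _ g (X u w) (X w v)) => //.
  move=> l l01; rewrite -convex_entry -mulrA -Xuv; apply: series_ineq => //.
    by apply: corr_convex => //; apply: l01W.
  exact: agree_convex.
by rewrite addrC subrK corr_sqr_le1.
Qed.

(** Positivity of X on the vector d below is the converse of series_ineq: in an
    extremal solution u, w and v are coplanar. *)
Lemma series_tight : X u w ^+ 2 < 1 -> X w v ^+ 2 < 1 ->
  g * X u v = g * X u w * X w v
     - Num.sqrt (1 - X u w ^+ 2) * Num.sqrt (1 - X w v ^+ 2).
Proof.
move=> t1 t2; apply/eqP; rewrite eq_le series_ineq //=.
set r1 := Num.sqrt (1 - X u w ^+ 2); set r2 := Num.sqrt (1 - X w v ^+ 2).
have r1E : r1 ^+ 2 = 1 - X u w ^+ 2 by rewrite sqr_sqrtr // subr_ge0 ltW.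
have r2E : r2 ^+ 2 = 1 - X w v ^+ 2 by rewrite sqr_sqrtr // subr_ge0 ltW.
have r1P : 0 < r1 by rewrite sqrtr_gt0 subr_gt0.
have r2P : 0 < r2 by rewrite sqrtr_gt0 subr_gt0.
pose q := g * X w v * r1 + X u w * r2.
(* the coefficients of a linear dependence between three vectors of the plane
   that realize the extreme value *)
pose d : 'cV[R]_n := r2 *: delta_mx u 0 + ((- q) *: delta_mx w 0 + (g * r1) *: delta_mx v 0).
have [[_ qX] dX] := cX; have := qX d.
rewrite -[quad X d]/(bil X d d) /d !bilDl !bilDr !bilZl !bilZr !bil_delta !dX.
rewrite (corr_sym w u cX) (corr_sym v u cX) (corr_sym v w cX) => h.
have : 0 <= (r1 * r2) * (g * X u v - (g * X u w * X w v - r1 * r2)).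
  rewrite -(pmulr_rge0 _ (ltr0Sn R 1)); apply: le_trans h _; rewrite le_eqVlt; apply/orP; left.
  apply/eqP; rewrite /q.
  transitivity (r2 ^+ 2 * (1 - X u w ^+ 2) + g ^+ 2 * r1 ^+ 2 * (1 - X w v ^+ 2)
     + 2 * r1 * r2 * (g * X u v) - 2 * g * r1 * r2 * X u w * X w v); first by ring.
  by rewrite -r1E -r2E g2; ring.
by rewrite pmulr_rge0 ?mulr_gt0 // subr_ge0.
Qed.

Lemma series_slope1 Y1 : X u w ^+ 2 < 1 -> X w v ^+ 2 < 1 -> correlation Y1 ->
  agree A1 e Y1 X ->
  0 <= (Y1 u w - X u w) *
    (g * X w v * Num.sqrt (1 - X u w ^+ 2) + X u w * Num.sqrt (1 - X w v ^+ 2)).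
Proof.
move=> t1 t2 c1 a1; apply: first_order => //; first exact: ltW.
  move=> l l01; rewrite -series_tight // -convex_entry; apply: series_ineq => //.
    by apply: corr_convex => //; apply: l01W.
  exact: agree_convex.
move=> l l01; rewrite -convex_entry; apply: corr_sqr_le1.
by apply: corr_convex => //; apply: l01W.
Qed.

End Series.

Lemma extremalC A X u v g : correlation X -> extremal A X u v g -> extremal A X v u g.
Proof.
by move=> cX h Y cY aY; rewrite (corr_sym v u cY) (corr_sym v u cX); apply: h.
Qed.

Lemma certificateC A X u v g M : correlation X -> certificate A X u v g M ->
  certificate A X v u g M.
Proof.
move=> cX [sM M1 M2]; split=> //; last by rewrite (corr_sym v u cX).
by move=> x /M1; rewrite [x u 0 * _]mulrC.
Qed.

Lemma certificate_sub A A' X u v g M : A \subset A' -> certificate A X u v g M ->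
  certificate A' X u v g M.
Proof.
move=> AA [sM M1 M2]; split=> //; first exact: supported_sub sM.
by move=> x cx; apply: M1; apply: collapsed_sub cx.
Qed.

(** The second clause concerns an extreme value that is itself 1 or -1: then u and v
    are tied, through the edges of the network, as if they were joined by an exact
    edge. *)
Definition certifiable A u v := forall X g, correlation X -> g ^+ 2 = 1 ->
  extremal A X u v g ->
  (exists M, certificate A X u v g M) /\
  (X u v = g -> forall x, collapsed A e X x -> x u 0 = g * x v 0).

Lemma certifiableC A u v : certifiable A u v -> certifiable A v u.
Proof.
move=> h X g cX g2 /(extremalC cX) /(h X g cX g2)[[M cM] tied]; split.
  by exists M; apply: certificateC.
move=> Xg x cx; have {}Xg : X u v = g by rewrite (corr_sym _ _ cX).
by rewrite (tied Xg x cx) mulrA -expr2 g2 mul1r.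
Qed.

(** The certificates are stated for a sign g, while series composition needs them for
    a derivative q of arbitrary size: scale by its absolute value. *)
Lemma certifiable_slope A u v X q : certifiable A u v -> correlation X ->
  (forall Y, correlation Y -> agree A e Y X -> 0 <= (Y u v - X u v) * q) ->
  exists M, certificate A X u v q M.
Proof.
move=> cert cX hq; have [->|q0] := eqVneq q 0.
  exists 0; split; first exact: supported0.
    by move=> x _; rewrite quad0 mul0r addr0.
  by rewrite frob0 mul0r addr0.
have nq : 0 < `|q| by rewrite normr_gt0.
have qE : q = `|q| * Num.sg q by rewrite mulrC -numEsg.
have [|| [M [sM M1 M2]] _] := cert X (Num.sg q) cX.
- by rewrite sqr_sg q0.
- move=> Y cY aY; rewrite -(pmulr_rge0 _ nq) mulrA -qE mulrC; exact: hq.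
exists (`|q| *: M); split; first exact: supportedZ.
  move=> x cx; rewrite quadZ {2}qE -mulrA -mulrDr mulr_ge0 // ?M1 //.
by rewrite frobZ {2}qE -mulrA -mulrDr pmulr_rle0.
Qed.

Section SeriesStep.
Variables (A A1 A2 : {set 'I_n}) (u w v : 'I_n) (X : 'M[R]_n) (g : R).
Hypotheses (sep : separation e A A1 A2) (K : A1 :&: A2 = [set w]).
Hypotheses (uw : u != w) (wv : w != v) (uv : u != v).
Hypotheses (uA : u \in A1) (vA : v \in A2).
Hypotheses (cX : correlation X) (g2 : g ^+ 2 = 1).
Hypotheses (cert1 : certifiable A1 u w) (cert2 : certifiable A2 w v).
Hypothesis ext : extremal A X u v g.

(** The entries uw and wv of an extremal solution are extremal on their own sides, in
    the directions given by the partial derivatives of the extreme value of uv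
    (first_order). The two certificates, weighted by these derivatives, add up to one
    for uv after the square of r2 x_u + g r1 x_v - q x_w is added, which is the linear
    dependence of the three coplanar vectors. *)
Lemma series_generic : X u w ^+ 2 < 1 -> X w v ^+ 2 < 1 ->
  (exists M, certificate A X u v g M) /\ X u v <> g.
Proof.
move=> t1 t2; have [A1s A2s] := separationS sep.
have tight := series_tight sep K uw wv uv uA vA cX g2 ext t1 t2.
have slope1 Y := series_slope1 (Y1 := Y) sep K uw wv uv uA vA cX g2 ext t1 t2.
set r1 := Num.sqrt (1 - X u w ^+ 2) in tight slope1.
set r2 := Num.sqrt (1 - X w v ^+ 2) in tight slope1.
have r1E : r1 ^+ 2 = 1 - X u w ^+ 2 by rewrite sqr_sqrtr // subr_ge0 ltW.
have r2E : r2 ^+ 2 = 1 - X w v ^+ 2 by rewrite sqr_sqrtr // subr_ge0 ltW.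
have r1P : 0 < r1 by rewrite sqrtr_gt0 subr_gt0.
have r2P : 0 < r2 by rewrite sqrtr_gt0 subr_gt0.
pose q := g * X w v * r1 + X u w * r2.
have slope2 Y : correlation Y -> agree A2 e Y X -> 0 <= (Y w v - X w v) * (g * q).
  move=> cY aY; have wu : w != u by rewrite eq_sym.
  have vw : v != w by rewrite eq_sym.
  have vu : v != u by rewrite eq_sym.
  have K' : A2 :&: A1 = [set w] by rewrite setIC.
  have := series_slope1 (Y1 := Y) (separationC es sep) K' vw wu vu vA uA cX g2
    (extremalC cX ext).
  rewrite (corr_sym v w cX) (corr_sym w u cX) (corr_sym v w cY) => /(_ t2 t1 cY aY).
  rewrite -/r1 -/r2 /q; have -> : g * (g * X w v * r1 + X u w * r2) =
     g ^+ 2 * X w v * r1 + g * X u w * r2 by ring.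
  by rewrite g2 mul1r [g * _ * _ + _]addrC.
have [N1 [sN1 N1p N1f]] := certifiable_slope cert1 cX slope1.
have [N2 [sN2 N2p N2f]] := certifiable_slope cert2 cX slope2.
rewrite -/q in N1p N1f.
split; last first.
  move=> Xg; rewrite Xg -expr2 g2 in tight.
  have : (g * X u w * X w v) ^+ 2 < 1.
    rewrite !exprMn g2 mul1r; apply: le_lt_trans t2.
    by rewrite ler_piMl ?sqr_ge0 // ltW.
  have rr : 0 < r1 * r2 by rewrite mulr_gt0.
  have -> : g * X u w * X w v = 1 + r1 * r2 by lra.
  have : 0 < (r1 * r2) * (r1 * r2) by rewrite mulr_gt0.
  lra.
have wA := mid_in1 K; have wB := mid_in2 K.
(* the diagonal of the square; its mixed terms are what turns the certificates for
   uw and wv into one for uv *)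
exists (r1^-1 *: N1 + r2^-1 *: N2 + ((r2 / (2 * r1)) *: sym_unit R u u +
   (r1 / (2 * r2)) *: sym_unit R v v + (q ^+ 2 / (2 * r1 * r2)) *: sym_unit R w w)); split.
- apply: supportedD.
    apply: supportedD; apply: supportedZ; first exact: supported_sub sN1.
    exact: supported_sub sN2.
  by apply: supported_diag; [apply: (subsetP A1s)|apply: (subsetP A2s)|apply: (subsetP A1s)].
- move=> x cx; have {N1p} := N1p x (collapsed_sub A1s cx).
  have {N2p} := N2p x (collapsed_sub A2s cx).
  rewrite quadD quad_sym_unit_diag quadD !quadZ.
  move: (quad N1 x) (quad N2 x) (x u 0) (x v 0) (x w 0) => a b xu xv xw h2 h1.
  have -> : r1^-1 * a + r2^-1 * b + (r2 / (2 * r1) * xu ^+ 2 + r1 / (2 * r2) * xv ^+ 2 +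
      q ^+ 2 / (2 * r1 * r2) * xw ^+ 2) + g * (xu * xv) =
     (a + q * (xu * xw)) / r1 + (b + g * q * (xw * xv)) / r2 +
     ((r2 * xu + g * r1 * xv - q * xw) ^+ 2 + (1 - g ^+ 2) * (r1 * xv) ^+ 2) / (2 * r1 * r2).
    by field; rewrite !lt0r_neq0.
  rewrite g2 subrr mul0r addr0 !addr_ge0 ?divr_ge0 ?sqr_ge0 ?(ltW r1P) ?(ltW r2P) //.
  by rewrite mulr_ge0 ?mulr_ge0 ?(ltW r1P) ?(ltW r2P).
- rewrite frobD frob_sym_unit_diag // frobD !frobZ tight.
  move: (frob N1 X) (frob N2 X) N1f N2f => a b h1 h2.
  have -> : r1^-1 * a + r2^-1 * b + (r2 / (2 * r1) + r1 / (2 * r2) + q ^+ 2 / (2 * r1 * r2)) +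
      (g * X u w * X w v - r1 * r2) =
     (a + q * X u w) / r1 + (b + g * q * X w v) / r2 +
     (r1 ^+ 2 * (1 - g ^+ 2 * X w v ^+ 2) + r2 ^+ 2 * (1 - X u w ^+ 2)
         - 2 * r1 ^+ 2 * r2 ^+ 2) / (2 * r1 * r2).
    by rewrite /q; field; rewrite !lt0r_neq0.
  have -> : r1 ^+ 2 * (1 - g ^+ 2 * X w v ^+ 2) + r2 ^+ 2 * (1 - X u w ^+ 2)
         - 2 * r1 ^+ 2 * r2 ^+ 2 = 0 by rewrite g2 mul1r -r1E -r2E; ring.
  rewrite mul0r addr0; have : (a + q * X u w) / r1 <= 0 by rewrite ler_pdivrMr // mul0r.
  have : (b + g * q * X w v) / r2 <= 0 by rewrite ler_pdivrMr // mul0r.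
  lra.
Qed.

(** The side of u is rigid, so u is a copy of w up to sign, and a certificate for
    the other side serves as it stands. *)
Lemma series_half_rigid : X u w ^+ 2 = 1 -> X w v ^+ 2 < 1 ->
  (exists M, certificate A X u v g M) /\ X u v <> g.
Proof.
move=> t1 t2; have [A1s A2s] := separationS sep.
have Xuv : X u v = X u w * X w v.
  by have := corr_tied (delta_mx v 0) cX t1; rewrite !mul_delta.
split; last first.
  move=> Xg; have : X u v ^+ 2 = 1 by rewrite Xg.
  by rewrite Xuv exprMn t1 mul1r => t21; rewrite t21 ltxx in t2.
have tied : forall x, collapsed A1 e X x -> x u 0 = X u w * x w 0.
  apply: (cert1 cX t1 _).2 => // Y cY aY.
  by rewrite (series_rigid1 sep K uw wv uv uA vA cX g2 ext) // subrr mulr0.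
have [||[M [sM M1 M2]] _] := cert2 (g := g * X u w) cX.
- by rewrite exprMn g2 t1 mul1r.
- move=> Y cY aY.
  have := series_ineq sep K uw wv uv uA vA g2 ext cX cY (fun _ _ _ _ _ => erefl) aY.
  by rewrite t1 subrr sqrtr0 mul0r Xuv subr0; lra.
exists M; split; first exact: supported_sub sM.
  move=> x cx; have := M1 x (collapsed_sub A2s cx).
  by rewrite (tied x (collapsed_sub A1s cx)) !mulrA.
by rewrite Xuv mulrA.
Qed.

Lemma series_rigid : X u w ^+ 2 = 1 -> X w v ^+ 2 = 1 ->
  (exists M, certificate A X u v g M) /\
  (X u v = g -> forall x, collapsed A e X x -> x u 0 = g * x v 0).
Proof.
move=> t1 t2; have [A1s A2s] := separationS sep.
have uAA := subsetP A1s u uA; have vAA := subsetP A2s v vA.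
have Xuv : X u v = X u w * X w v.
  by have := corr_tied (delta_mx v 0) cX t1; rewrite !mul_delta.
have tied : X u v = g -> forall x, collapsed A e X x -> x u 0 = g * x v 0.
  move=> Xg x cx.
  have e1 : X u w = g * X w v by rewrite -Xg Xuv -mulrA -expr2 t2 mulr1.
  have e2 : X w v = g * X u w by rewrite e1 mulrA -expr2 g2 mul1r.
  have x1 : x u 0 = X u w * x w 0.
    apply: (cert1 cX t1 _).2 => //; last exact: collapsed_sub cx.
    move=> Y cY aY.
    have := series_ineq sep K uw wv uv uA vA g2 ext cY cX aY (fun _ _ _ _ _ => erefl).
    rewrite t2 subrr sqrtr0 mulr0 subr0 Xg -expr2 g2 mulrBr -expr2 t1 => h.
    by rewrite {1}e1 subr_ge0; apply: le_trans h _; rewrite le_eqVlt; apply/orP; left; apply/eqP; ring.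
  have x2 : x w 0 = X w v * x v 0.
    apply: (cert2 cX t2 _).2 => //; last exact: collapsed_sub cx.
    move=> Y cY aY.
    have := series_ineq sep K uw wv uv uA vA g2 ext cX cY (fun _ _ _ _ _ => erefl) aY.
    rewrite t1 subrr sqrtr0 mul0r subr0 Xg -expr2 g2 mulrBr -expr2 t2 => h.
    by rewrite {1}e2 subr_ge0.
  by rewrite x1 x2 mulrA -Xuv Xg.
split=> //.
have /eqP : X u v ^+ 2 = g ^+ 2 by rewrite Xuv exprMn t1 t2 g2 mulr1.
rewrite eqf_sqr => /orP[/eqP Xg|/eqP Xg].
  by apply: certificate_tied => //; apply: tied.
exact: certificate_opposite.
Qed.

End SeriesStep.

Lemma network_certifiable A u v : network e A u v -> certifiable A u v.
Proof.
elim=> {A u v}.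
- move=> A u v uA vA uv euv X g cX g2 ext; split; last first.
    by move=> Xg x cx; rewrite (cx u v) ?Xg.
  exists ((- g) *: sym_unit R u v); split.
  + by apply: supportedZ; apply: supported_sym_unit; rewrite ?euv ?orbT.
  + by move=> x _; rewrite (quadZ (- g)) quad_sym_unit; lra.
  + by rewrite (frobZ (- g)) frob_sym_unit ?cX.1.1 //; lra.
- move=> A A' B u v sep K net IH X g cX g2 ext; have [AA _] := separationS sep.
  have [uA vA _] := network_ends net.
  have [[M cM] tied] := IH X g cX g2 (extremal_pendant cX sep K uA vA ext).
  split; first by exists M; apply: certificate_sub cM.
  by move=> Xg x cx; apply: tied => //; apply: collapsed_sub cx.
- move=> A A1 A2 u v sep K _ IH1 _ IH2 X g cX g2 ext; have [A1s A2s] := separationS sep.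
  have [ext'|ext'] := extremal_parallel g2 cX sep K ext.
    have [[M cM] tied] := IH1 X g cX g2 ext'; split; first by exists M; apply: certificate_sub cM.
    by move=> Xg x cx; apply: tied => //; apply: collapsed_sub cx.
  have [[M cM] tied] := IH2 X g cX g2 ext'; split; first by exists M; apply: certificate_sub cM.
  by move=> Xg x cx; apply: tied => //; apply: collapsed_sub cx.
move=> A A1 A2 u w v sep K net1 IH1 net2 IH2 X g cX g2 ext.
have [uA wA uw] := network_ends net1; have [wB vB wv] := network_ends net2.
have [_ _ uv] := network_ends (network_series sep K net1 net2).
have le1 := corr_sqr_le1 u w cX; have le2 := corr_sqr_le1 w v cX.
have [t1|t1] := eqVneq (X u w ^+ 2) 1; have [t2|t2] := eqVneq (X w v ^+ 2) 1.
- exact: (series_rigid sep K uw wv uv uA vB).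
- have {}t2 : X w v ^+ 2 < 1 by rewrite lt_neqAle t2.
  by have [? ?] := series_half_rigid sep K uw wv uv uA vB cX g2 IH1 IH2 ext t1 t2.
- have {}t1 : X u w ^+ 2 < 1 by rewrite lt_neqAle t1.
  have K' : A2 :&: A1 = [set w] by rewrite setIC.
  have vw : v != w by rewrite eq_sym.
  have wu : w != u by rewrite eq_sym.
  have vu : v != u by rewrite eq_sym.
  have [||[M cM] Xg] := series_half_rigid (separationC es sep) K' vw wu vu vB uA cX g2
    (certifiableC IH2) (certifiableC IH1) (extremalC cX ext).
  + by rewrite (corr_sym _ _ cX).
  + by rewrite (corr_sym _ _ cX).
  rewrite (corr_sym _ _ cX) in Xg.
  by split=> //; exists M; apply: certificateC cM.
have {}t1 : X u w ^+ 2 < 1 by rewrite lt_neqAle t1.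
have {}t2 : X w v ^+ 2 < 1 by rewrite lt_neqAle t2.
by have [? ?] := series_generic sep K uw wv uv uA vB cX g2 IH1 IH2 ext t1 t2.
Qed.

End NetworkCertificate.

(** * Decomposable graphs *)

Section Decomposable.
Variable T : finType.

Definition add_edge (e : rel T) (u v : T) : rel T :=
  fun i j => e i j || ((i == u) && (j == v) || (i == v) && (j == u)).

Lemma add_edge_sym e u v : symmetric e -> symmetric (add_edge e u v).
Proof.
move=> es i j; rewrite /add_edge es; congr (_ || _).
by rewrite orbC andbC [X in _ || X]andbC.
Qed.

(** In a 2-sum the sides are required to decompose in both forms, without and with
    the edge uv: when the two sides leave a common range of values for the entry uv
    the edge is absent, and when they force its value it behaves as an edge. *)
Inductive decomposable : rel T -> {set T} -> Prop :=
| decomposable_clique e A : clique e A -> decomposable e A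
| decomposable_clique_sum e A A1 A2 : separation e A A1 A2 -> clique e (A1 :&: A2) ->
    decomposable e A1 -> decomposable e A2 -> decomposable e A
| decomposable_two_sum e A A1 A2 u v : separation e A A1 A2 ->
    A1 :&: A2 = [set u; v] -> ~~ e u v -> network e A1 u v -> network e A2 u v ->
    decomposable e A1 -> decomposable e A2 ->
    decomposable (add_edge e u v) A1 -> decomposable (add_edge e u v) A2 ->
    decomposable e A.

End Decomposable.

(** * The second stress *)

Section Exposed.
Variables (R : realType) (n : nat).
Implicit Types (A : {set 'I_n}) (M X Y : 'M[R]_n) (x y z : 'cV[R]_n) (e : rel 'I_n).

(** W is the second stress: on the vectors left by the first one it is nonnegative,
    and its zeros are no more than the column space of a single solution X, read on
    A. *)
Definition exposes A e X0 X W :=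
  [/\ correlation X, agree A e X X0, supported A e W,
      frob W X0 <= 0
    & forall x, collapsed A e X0 x -> 0 <= quad W x /\
       (quad W x = 0 -> exists y, {in A, forall i, x i 0 = (X *m y) i 0})].

Lemma frob_eq0 M Y : psd Y -> (forall y, quad M (Y *m y) = 0) -> frob M Y = 0.
Proof.
move=> pY h; apply/eqP; rewrite eq_le frob_ge0 ?andbT => // [|y]; last by rewrite h.
rewrite -oppr_ge0 -mulN1r -(frobZ (-1)) frob_ge0 // => y.
by rewrite (quadZ (-1)) h mulr0.
Qed.

(** On a clique everything is prescribed, and W can be the Gram matrix of a spanning
    set of the kernel of the block of X on A. *)
Lemma exposes_clique A e X : clique e A -> correlation X -> exists W, exposes A e X X W.
Proof.
move=> cl cX; have [pX dX] := cX; have [sX _] := pX.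
pose P : 'M[R]_n := setproj R A; have sP : P^T = P := setproj_sym _ _.
pose Y := P *m X *m P.
have [C YC subC] : exists2 C : 'M[R]_n, Y *m C = 0 &
    forall z : 'rV[R]_n, z *m C = 0 -> (z <= Y)%MS.
  exists (cokermx Y); first exact: mulmx_coker.
  by move=> z zC; rewrite submxE zC.
have sY : Y^T = Y by rewrite /Y !trmx_mul sP sX mulmxA.
have quadW x : quad (P *m C *m (P *m C)^T) x = ((C^T *m P *m x)^T *m (C^T *m P *m x)) 0 0.
  by rewrite /quad !trmx_mul !trmxK sP !mulmxA.
have XPC : X *m P *m C = 0.
  apply/matrixP => i j; rewrite [RHS]mxE.
  have /colP/(_ i) : X *m (P *m col j C) = 0.
    apply: psd_ker => //; rewrite /quad trmx_mul sP.
    have YCj : Y *m col j C = 0 by rewrite colE mulmxA YC mul0mx.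
    by rewrite -!mulmxA [P *m (X *m _)]mulmxA [P *m X *m _]mulmxA -/Y YCj mulmx0 mxE.
  have -> : (X *m P *m C) i j = (X *m (P *m col j C)) i 0.
    by rewrite [in RHS]mulmxA [in RHS]colE [in RHS]mulmxA -[in RHS]colE [RHS]mxE.
  by move=> ->; rewrite mxE.
have CPX : C^T *m P *m X = 0.
  by apply: trmx_inj; rewrite !trmx_mul trmxK sP sX trmx0 mulmxA XPC.
exists (P *m C *m (P *m C)^T); split=> //.
- split; first by rewrite trmx_mul trmxK.
  move=> i j; rewrite trmx_mul sP !mulmxA setprojEr -!mulmxA setprojE.
  case: (boolP (i \in A)) => iA; last by rewrite !mul0r.
  case: (boolP (j \in A)) => jA; last by rewrite mulr0.
  by have [//|ij] := eqVneq i j; rewrite cl.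
- rewrite frob_eq0 // => y; rewrite quadW.
  by rewrite [C^T *m P *m _]mulmxA CPX mul0mx mulmx0 mxE.
move=> x _; rewrite quadW dot_ge0; split=> // /dot_eq0 CPx.
have : ((P *m x)^T <= Y)%MS.
  by apply: subC; apply: trmx_inj; rewrite trmx_mul trmxK trmx0 mulmxA.
case/submxP => D PxD; exists (P *m D^T) => i iA.
have /colP/(_ i) : P *m x = P *m (X *m (P *m D^T)).
  by apply: trmx_inj; rewrite PxD !trmx_mul trmxK sP sX /Y !mulmxA.
by rewrite !setprojE iA !mul1r.
Qed.

Section OneRel.
Variable e : rel 'I_n.
Hypothesis es : symmetric e.

(** The zeros of W1 + W2 are common zeros, and the amalgam of X1 and X2 has the
    largest column space that the two sides permit. *)
Lemma exposes_clique_sum A A1 A2 X0 X1 W1 X2 W2 : correlation X0 ->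
  separation e A A1 A2 ->
  {in A1 :&: A2 &, forall i j, X1 i j = X2 i j} ->
  exposes A1 e X0 X1 W1 -> exposes A2 e X0 X2 W2 ->
  exists X W, exposes A e X0 X W.
Proof.
move=> c0 sep K12 [c1 a1 s1 f1 q1] [c2 a2 s2 f2 q2]; have [A1s A2s] := separationS sep.
have [X [cX aX _ _ Xc]] := glue es sep c1 c2 a1 a2 K12.
exists X, (W1 + W2); split=> //.
- by apply: supportedD; [apply: supported_sub s1|apply: supported_sub s2].
- by rewrite frobD -[0]addr0 lerD.
move=> x cx; have [p1 k1] := q1 x (collapsed_sub A1s cx).
have [p2 k2] := q2 x (collapsed_sub A2s cx).
rewrite quadD addr_ge0 //; split=> // /eqP; rewrite paddr_eq0 // => /andP[/eqP z1 /eqP z2].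
by have [y1 y1E] := k1 z1; have [y2 y2E] := k2 z2; apply: Xc y1E y2E.
Qed.

Definition reaches A X0 u v (P : pred R) :=
  exists Y, [/\ correlation Y, agree A e Y X0 & P (Y u v)].

(** The values of the entry uv form an interval, and t is either interior to it or its
    only point. Mixing X with a solution from the other side of t moves the entry to t;
    a proper mixture does not lose column space. *)
Lemma exposes_at A X0 X W u v t : exposes A e X0 X W ->
  (reaches A X0 u v (fun s => s < t) <-> reaches A X0 u v (fun s => t < s)) ->
  exists2 X', exposes A e X0 X' W & X' u v = t.
Proof.
move=> ex iff; have [cX aX sW fW qW] := ex.
suff mix Y : correlation Y -> agree A e Y X0 -> (Y u v - t) * (X u v - t) < 0 ->
    exists2 X', exposes A e X0 X' W & X' u v = t.
  have [Xt|Xt|Xt] := ltgtP (X u v) t; last by exists X.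
    have [|Y [cY aY tY]] := iff.1; first by exists X.
    by apply: (mix Y) => //; rewrite pmulr_rlt0 ?subr_gt0 ?subr_lt0.
  have [|Y [cY aY tY]] := iff.2; first by exists X.
  by apply: (mix Y) => //; rewrite pmulr_llt0 ?subr_gt0 ?subr_lt0.
move=> cY aY; set a := Y u v - t; set b := X u v - t => ab.
have ba : b - a != 0.
  apply: contraTneq ab => /eqP; rewrite subr_eq0 => /eqP ->.
  by rewrite -leNgt -expr2 sqr_ge0.
have ba2 : 0 < (b - a) ^+ 2 by rewrite exprn_even_gt0.
pose l := - a / (b - a).
have lE : l = (a ^+ 2 - a * b) / (b - a) ^+ 2 by rewrite /l; field.
have l1E : 1 - l = (b ^+ 2 - a * b) / (b - a) ^+ 2 by rewrite /l; field.
have a2 : 0 <= a ^+ 2 by apply: sqr_ge0.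
have b2 : 0 <= b ^+ 2 by apply: sqr_ge0.
have l0 : 0 < l by rewrite lE divr_gt0 //; lra.
have l1 : 0 <= 1 - l by rewrite l1E divr_ge0 ?ltW //; lra.
have l01 : 0 <= l <= 1 by rewrite (ltW l0) -subr_ge0.
pose X' := l *: X + (1 - l) *: Y.
have cX' : correlation X' by apply: corr_convex.
exists X'; last first.
  rewrite /X' !mxE.
  have -> : l * X u v + (1 - l) * Y u v = t + (l * (b - a) + a) by rewrite /a /b; ring.
  by rewrite /l divfK // addNr addr0.
split=> //.
  by move=> i j iA jA eij; rewrite !mxE aX // aY //; ring.
move=> x cx; have [p k] := qW x cx; split=> // z; have [y yE] := k z.
have [sX' _] := cX'.1.
have [z' X'z'|w wE] := @incolP _ _ X' (X *m y) sX'; last by exists w => i iA; rewrite yE // wE.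
have /eqP : quad X' z' = 0 by rewrite /quad -mulmxA X'z' mulmx0 mxE.
have [qX qY] := (cX.1.2 z', cY.1.2 z').
rewrite quadD (quadZ l) (quadZ (1 - l)).
rewrite (paddr_eq0 (mulr_ge0 (ltW l0) qX) (mulr_ge0 l1 qY)) mulf_eq0 gt_eqF //= => /andP[/eqP /(psd_ker cX.1) Xz _].
rewrite mulmxA; have -> : z'^T *m X = 0.
  by apply: trmx_inj; rewrite trmx_mul trmxK cX.1.1 trmx0.
by rewrite mul0mx mxE.
Qed.

(** Each side allows an interval of values for the entry uv, and the intervals share
    the value t0 of X0. If they share a point that is relatively interior to both, the
    solutions can be moved there; otherwise t0 is the upper end of one and the lower
    end of the other. *)
Lemma two_sum_dichotomy A1 A2 X0 u v X1 W1 X2 W2 : correlation X0 ->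
  exposes A1 e X0 X1 W1 -> exposes A2 e X0 X2 W2 ->
  (exists X1' X2', [/\ exposes A1 e X0 X1' W1, exposes A2 e X0 X2' W2 & X1' u v = X2' u v]) \/
  (exists g, [/\ g ^+ 2 = 1, extremal e A1 X0 u v g & extremal e A2 X0 u v (- g)]).
Proof.
move=> c0 ex1 ex2; pose t0 := X0 u v.
pose above A := reaches A X0 u v (fun s => t0 < s).
pose below A := reaches A X0 u v (fun s => s < t0).
have r0 A (P : pred R) : P t0 -> reaches A X0 u v P by exists X0; split.
have common t : (forall A, A = A1 \/ A = A2 -> (reaches A X0 u v (fun s => s < t) <->
    reaches A X0 u v (fun s => t < s))) -> exists X1' X2',
    [/\ exposes A1 e X0 X1' W1, exposes A2 e X0 X2' W2 & X1' u v = X2' u v].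
  move=> h; have [X1' e1 x1] := exposes_at ex1 (h A1 (or_introl erefl)).
  have [X2' e2 x2] := exposes_at ex2 (h A2 (or_intror erefl)).
  by exists X1', X2'; split=> //; rewrite x1.
have noA A : ~ above A -> extremal e A X0 u v (-1).
  move=> na Y cY aY; rewrite mulN1r oppr_ge0 subr_le0 leNgt; apply/negP => lt.
  by apply: na; exists Y.
have noB A : ~ below A -> extremal e A X0 u v 1.
  move=> na Y cY aY; rewrite mul1r subr_ge0 leNgt; apply/negP => lt.
  by apply: na; exists Y.
(* both intervals go beyond t0 on the same side: half-way to the nearer of the two
   values is interior to both *)
have [[[Y1 [c1 a1 t1]] [Y2 [c2 a2 t2]]]|naa] := EM (above A1 /\ above A2).
  left; pose m := Num.min (Y1 u v) (Y2 u v).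
  have tm : t0 < m by rewrite lt_min t1.
  have m1 : m <= Y1 u v by rewrite ge_min lexx.
  have m2 : m <= Y2 u v by rewrite ge_min lexx orbT.
  apply: (common ((t0 + m) / 2)) => A [] ->; split=> _; try (by apply: r0; lra).
    by exists Y1; split=> //; lra.
  by exists Y2; split=> //; lra.
have [[[Y1 [c1 a1 t1]] [Y2 [c2 a2 t2]]]|nbb] := EM (below A1 /\ below A2).
  left; pose m := Num.max (Y1 u v) (Y2 u v).
  have tm : m < t0 by rewrite gt_max t1.
  have m1 : Y1 u v <= m by rewrite le_max lexx.
  have m2 : Y2 u v <= m by rewrite le_max lexx orbT.
  apply: (common ((t0 + m) / 2)) => A [] ->; split=> _; try (by apply: r0; lra).
    by exists Y1; split=> //; lra.
  by exists Y2; split=> //; lra.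
have [h1|h1] := EM (below A1 <-> above A1); have [h2|h2] := EM (below A2 <-> above A2).
- by left; apply: (common t0) => A [] ->.
- right; have [a2|a2] := EM (above A2); have [b2|b2] := EM (below A2).
  + by case: h2.
  + exists (-1); split; rewrite ?sqrrN ?expr1n ?opprK //; last exact: noB.
    by apply: noA => a1; apply: naa.
  + exists 1; split; rewrite ?expr1n //; last exact: noA.
    by apply: noB => b1; apply: nbb.
  + by case: h2.
all: right; have [a1|a1] := EM (above A1); have [b1|b1] := EM (below A1).
1,5: by case: h1.
3,6: by case: h1.
1,3: exists 1; split; rewrite ?expr1n //; first exact: noB.
1,2: by apply: noA => a2; apply: naa.
all: exists (-1); split; rewrite ?sqrrN ?expr1n ?opprK //; first exact: noA.
all: by apply: noB => b2; apply: nbb.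
Qed.

Lemma supported_rel A e' M : subrel e e' -> supported A e M -> supported A e' M.
Proof.
move=> ee [sM zM]; split=> // i j h; apply: zM; apply: contra h => /and3P[-> ->] /=.
by case/orP=> [->|/ee ->]; rewrite ?orbT.
Qed.

Lemma agree_rel A e' X Y : subrel e e' -> agree A e' X Y -> agree A e X Y.
Proof. by move=> ee h i j iA jA /ee; apply: h. Qed.

(** When the two sides force the entry uv, treat it as an edge on either side. The sum
    W1 + W2 then has an unwanted coefficient at uv. The extremality certificates of the
    two sides are forms that vanish at X0 with coefficients of opposite signs at uv,
    so a multiple of one of them cancels it. *)
Lemma exposes_two_sum A A1 A2 X0 u v g X1 W1 X2 W2 : correlation X0 ->
  separation e A A1 A2 -> A1 :&: A2 = [set u; v] -> ~~ e u v ->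
  network e A1 u v -> network e A2 u v ->
  g ^+ 2 = 1 -> extremal e A1 X0 u v g -> extremal e A2 X0 u v (- g) ->
  exposes A1 (add_edge e u v) X0 X1 W1 -> exposes A2 (add_edge e u v) X0 X2 W2 ->
  exists X W, exposes A e X0 X W.
Proof.
move=> c0 sep K neuv net1 net2 g2 ext1 ext2 [c1 a1 s1 f1 q1] [c2 a2 s2 f2 q2].
have [A1s A2s] := separationS sep.
have [uA1 vA1 uv] := network_ends net1; have [uA2 vA2 _] := network_ends net2.
set e' := add_edge e u v in a1 s1 q1 a2 s2 q2.
have ee : subrel e e' by move=> i j eij; rewrite /e' /add_edge eij.
have e'uv : e' u v by rewrite /e' /add_edge !eqxx orbT.
have es' : symmetric e' by apply: add_edge_sym.
have g2N : (- g) ^+ 2 = 1 by rewrite sqrrN.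
have [[M1 [sM1 M1p M1f]] tied1] := network_certifiable es net1 c0 g2 ext1.
have [[M2 [sM2 M2p M2f]] tied2] := network_certifiable es net2 c0 g2N ext2.
have X12 : {in A1 :&: A2 &, forall i j, X1 i j = X2 i j}.
  have t12 : X1 u v = X2 u v by rewrite a1 // a2.
  move=> i j; rewrite K !inE => /orP[]/eqP-> /orP[]/eqP->; rewrite ?c1.2 ?c2.2 //.
  by rewrite (corr_sym _ _ c1) (corr_sym _ _ c2).
have [X [cX aX _ _ Xc]] := glue es sep c1 c2 (agree_rel ee a1) (agree_rel ee a2) X12.
have sX0 : X0^T = X0 by have [[]] := c0.
have [N [sN Np Nf Nuv]] : exists N, [/\ supported A e' N,
    forall x, collapsed A e X0 x -> 0 <= quad N x, frob N X0 <= 0 & N u v = - (W1 u v + W2 u v)].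
  set k := W1 u v + W2 u v.
  have sE : supported A e' (sym_unit R u v).
    apply: supported_sym_unit => //; first exact: (subsetP A1s).
      exact: (subsetP A1s).
    by rewrite e'uv orbT.
  have suv : sym_unit R u v u v = 2^-1.
    by rewrite !mxE !eqxx (negPf uv) /= addr0 mulr1.
  have zero A' M : supported A' e M -> M u v = 0.
    by move=> [_ zM]; apply: zM; rewrite (negPf uv) (negPf neuv) !andbF.
  have g1 : `|g| = 1 by case: (sqr_eq1 g2) => ->; rewrite ?normrN1 ?normr1.
  have [gk|gk] := leP (g * k) 0.
    exists (2 * `|k| *: (M1 + g *: sym_unit R u v)); split.
    - apply: supportedZ; apply: supportedD; last exact: supportedZ.
      by apply: supported_rel ee _; apply: supported_sub sM1.
    - move=> x cx; rewrite quadZ mulr_ge0 ?mulr_ge0 // quadD (quadZ g) quad_sym_unit.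
      by apply: M1p; apply: collapsed_sub cx.
    - rewrite frobZ; apply: mulr_ge0_le0; first by rewrite mulr_ge0.
      by rewrite frobD (frobZ g) frob_sym_unit.
    - rewrite mxE [(M1 + _) u v]mxE (zero _ _ sM1) mxE suv add0r.
      have -> : `|k| = - (g * k).
        by rewrite -(ler0_norm gk) normrM g1 mul1r.
      have -> : 2 * - (g * k) * (g * 2^-1) = - (g ^+ 2 * k) by field.
      by rewrite g2 mul1r.
  exists (2 * `|k| *: (M2 + (- g) *: sym_unit R u v)); split.
  - apply: supportedZ; apply: supportedD; last exact: supportedZ.
    by apply: supported_rel ee _; apply: supported_sub sM2.
  - move=> x cx; rewrite quadZ mulr_ge0 ?mulr_ge0 // quadD (quadZ (- g)) quad_sym_unit.
    by apply: M2p; apply: collapsed_sub cx.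
  - rewrite frobZ; apply: mulr_ge0_le0; first by rewrite mulr_ge0.
    by rewrite frobD (frobZ (- g)) frob_sym_unit.
  - rewrite mxE [(M2 + _) u v]mxE (zero _ _ sM2) mxE suv add0r.
    have -> : `|k| = g * k by rewrite -(gtr0_norm gk) normrM g1 mul1r.
    have -> : 2 * (g * k) * (- g * 2^-1) = - (g ^+ 2 * k) by field.
    by rewrite g2 mul1r.
(* the new edge ties no further coordinates: if its value is 1 or -1 then the
   networks tie u and v already *)
have col A' x : A' \subset A -> collapsed A e X0 x -> collapsed A' e' X0 x.
  move=> AA cx; apply: (collapsed_sub AA); move=> i j iA jA.
  have tied : X0 u v ^+ 2 = 1 -> x u 0 = X0 u v * x v 0.
    rewrite -g2 => /eqP; rewrite eqf_sqr => /orP[/eqP t|/eqP t]; rewrite t.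
      by apply: tied1 => //; apply: collapsed_sub cx.
    by apply: tied2 => //; apply: collapsed_sub cx.
  rewrite /e' /add_edge => /orP[eij|/orP[]/andP[/eqP-> /eqP->]] t1; first exact: cx.
    exact: tied.
  rewrite (corr_sym v u c0) in t1 *.
  by rewrite tied // mulrA -expr2 t1 mul1r.
exists X, (W1 + W2 + N); split=> //.
- have [sW zW] : supported A e' (W1 + W2 + N).
    apply: supportedD => //; apply: supportedD; first exact: supported_sub s1.
    exact: supported_sub s2.
  split=> // i j h; have [/and3P[iA jA ij]|h'] := boolP [&& i \in A, j \in A & (i == j) || e' i j]; last exact: zW.
  have zuv : (W1 + W2 + N) u v = 0 by rewrite mxE [(W1 + W2) u v]mxE Nuv subrr.
  move: h ij; rewrite iA jA /= /e' /add_edge.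
  case: (i == j) => //=; case: (e i j) => //= _ /orP[]/andP[/eqP-> /eqP->] //.
  by rewrite -sW mxE.
- by rewrite !frobD -[0]addr0 lerD // -[0]addr0 lerD.
move=> x cx; have [p1 k1] := q1 x (col _ _ A1s cx); have [p2 k2] := q2 x (col _ _ A2s cx).
have pN := Np x cx; rewrite !quadD !addr_ge0 //; split=> // /eqP.
rewrite paddr_eq0 ?addr_ge0 // paddr_eq0 // => /andP[/andP[/eqP z1 /eqP z2] _].
by have [y1 y1E] := k1 z1; have [y2 y2E] := k2 z2; apply: Xc y1E y2E.
Qed.

End OneRel.

Lemma decomposable_exposes e A X0 : symmetric e -> correlation X0 ->
  decomposable e A -> exists X W, exposes A e X0 X W.
Proof.
move=> es c0 dec; elim: dec es => {e A}.
- by move=> e A cl _; exists X0; apply: exposes_clique.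
- move=> e A A1 A2 sep cl _ IH1 _ IH2 es.
  have [X1 [W1 ex1]] := IH1 es; have [X2 [W2 ex2]] := IH2 es.
  apply: (exposes_clique_sum es c0 sep _ ex1 ex2) => i j iK jK.
  have [c1 a1 _ _ _] := ex1; have [c2 a2 _ _ _] := ex2.
  have [->|ij] := eqVneq i j; first by rewrite c1.2 c2.2.
  have eij := cl i j iK jK ij.
  by move: iK jK; rewrite !inE => /andP[? ?] /andP[? ?]; rewrite a1 // a2.
move=> e A A1 A2 u v sep K neuv net1 net2 _ IH1 _ IH2 _ IH3 _ IH4 es.
have [X1 [W1 ex1]] := IH1 es; have [X2 [W2 ex2]] := IH2 es.
have [[X1' [X2' [ex1' ex2' uvE]]]|[g [g2 ext1 ext2]]] := two_sum_dichotomy u v c0 ex1 ex2.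
  apply: (exposes_clique_sum es c0 sep _ ex1' ex2') => i j.
  have [c1 _ _ _ _] := ex1'; have [c2 _ _ _ _] := ex2'.
  rewrite K !inE => /orP[]/eqP-> /orP[]/eqP->; rewrite ?c1.2 ?c2.2 //.
  by rewrite (corr_sym _ _ c1) (corr_sym _ _ c2).
have es' := add_edge_sym u v es.
have [X3 [W3 ex3]] := IH3 es'; have [X4 [W4 ex4]] := IH4 es'.
exact: (exposes_two_sum es c0 sep K neuv net1 net2 g2 ext1 ext2 ex3 ex4).
Qed.

End Exposed.

(** * From exposing matrices to stresses *)

Section Final.
Variables (R : realType) (n : nat) (G : sgraph n).
Implicit Types (M X Y : 'M[R]_n) (x y : 'cV[R]_n) (c : edge G -> R).

Local Notation adj := (adj G).

Lemma edge_of i j : adj i j -> (i < j)%N -> exists a : edge G, src a = i /\ tgt a = j.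
Proof.
move=> aij ij; have P : ((i, j).1 < (i, j).2)%N && adj (i, j).1 (i, j).2 by rewrite /= ij.
by exists (exist _ (i, j) P).
Qed.

Lemma edge_adj (a : edge G) : adj (src a) (tgt a).
Proof. by have /andP[] := valP a. Qed.

Lemma double_sum_edges (F : 'I_n -> 'I_n -> R) : (forall i j, F i j = F j i) ->
  (forall i j, ~~ ((i == j) || adj i j) -> F i j = 0) ->
  \sum_i \sum_j F i j = \sum_i F i i + \sum_(a : edge G) 2 * F (src a) (tgt a).
Proof.
move=> sF zF; rewrite pair_big /= (bigID (fun p : 'I_n * 'I_n => p.1 == p.2)) /=; congr (_ + _).
  rewrite (reindex (fun i : 'I_n => (i, i))) /=; last first.
    exists (fun p => p.1) => [i _|[i j]] //=; rewrite inE /=.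
    by move=> /eqP ->.
  by apply: eq_bigl => i; rewrite eqxx.
rewrite (bigID (fun p : 'I_n * 'I_n => (p.1 < p.2)%N)) /=.
have -> : \sum_(p : 'I_n * 'I_n | (p.1 != p.2) && ~~ (p.1 < p.2)%N) F p.1 p.2 =
          \sum_(p : 'I_n * 'I_n | (p.1 != p.2) && (p.1 < p.2)%N) F p.1 p.2.
  rewrite (reindex (fun p : 'I_n * 'I_n => (p.2, p.1))) /=; last first.
    by exists (fun p : 'I_n * 'I_n => (p.2, p.1)) => [[i j]|[i j]].
  apply: eq_big => [[i j]|[i j] _] /=; last by rewrite sF.
  by rewrite -leqNgt eq_sym -val_eqE /=; case: ltngtP.
set S := \sum_(p | _) _; have -> : S + S = 2 * S by ring.
rewrite /S mulr_sumr.
pose P (p : 'I_n * 'I_n) := (p.1 < p.2)%N && adj p.1 p.2.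
transitivity (\sum_(p | P p) 2 * F p.1 p.2).
  rewrite [LHS](bigID P) /= [X in _ + X]big1 ?addr0 => [|[i j] /andP[/andP[/= ij lt]]].
    by apply: eq_bigl => [[i j]]; rewrite /P -val_eqE /=; case: ltngtP => //= _; rewrite andbT.
  by rewrite /P /= lt /= => nadj; rewrite zF ?mulr0 // (negPf ij).
rewrite (reindex_omap (val : edge G -> _) insub) /=; last first.
  by move=> p Pp; rewrite insubT.
by apply: eq_bigl => a; rewrite valK eqxx andbT; exact: (valP a).
Qed.

Lemma stress_of_supported M : supported [set: 'I_n] adj M -> exists w : stress R G,
  (forall x, quad (stress_mx w) x = quad M x) /\
  (forall c X, feasible c X -> stress_pairing w c = frob M X).
Proof.
move=> [sM zM]; have symM i j : M i j = M j i by rewrite -[in LHS]sM mxE.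
have zM' i j : ~~ ((i == j) || adj i j) -> M i j = 0.
  by move=> h; apply: zM; rewrite !inE.
exists (fun z => match z with inl i => M i i | inr a => 2 * M (src a) (tgt a) end); split.
  move=> x; rewrite [RHS]quadE (double_sum_edges (F := fun i j => M i j * (x i 0 * x j 0))).
  - have qs (I : finType) (f : I -> R) (E : I -> 'M[R]_n) :
      quad (\sum_i f i *: E i) x = \sum_i f i * quad (E i) x.
      by rewrite (big_morph (fun N => quad N x) (id1 := 0) (op1 := +%R)) ?quad0 // => [|N N'];
        rewrite ?quadD //; apply: eq_bigr => i _; rewrite quadZ.
    rewrite /stress_mx quadD !qs; congr (_ + _); apply: eq_bigr => i _; rewrite quad_sym_unit //.
    by rewrite -mulrA.
  - by move=> i j; rewrite symM [x i 0 * _]mulrC.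
  - by move=> i j h; rewrite zM' ?mul0r.
move=> c X [[sX _] dX eX]; rewrite /frob (double_sum_edges (F := fun i j => M i j * X i j)).
- rewrite /stress_pairing; congr (_ + _); apply: eq_bigr => i _; first by rewrite dX mulr1.
  by rewrite -mulrA eX.
- by move=> i j; rewrite symM -[in X i j]sX [X^T i j]mxE.
- by move=> i j h; rewrite zM' ?mul0r.
Qed.

Lemma feasible_agree c X0 Y : feasible c X0 ->
  feasible c Y <-> correlation Y /\ agree [set: 'I_n] adj Y X0.
Proof.
move=> [[sX pX] dX eX]; split.
  move=> [pY dY eY]; split=> // i j _ _ aij; have [sY _] := pY.
  have [ij|ji|ij] := ltngtP i j.
  - by have [a [<- <-]] := edge_of aij ij; rewrite eY eX.
  - rewrite -sY mxE -[in RHS]sX [RHS]mxE.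
    by rewrite adj_sym in aij; have [a [<- <-]] := edge_of aij ji; rewrite eY eX.
  - by rewrite (val_inj ij) dX dY.
move=> [[pY dY] aY]; split=> // a; rewrite aY ?inE // ?eX //.
exact: edge_adj.
Qed.

(** The first stress: the sum of the squares (x_i - X0_ij x_j)^2 over the edges of
    value 1 or -1. *)
Definition tie_mx X0 : 'M[R]_n := \sum_i \sum_(j | adj i j && (X0 i j ^+ 2 == 1))
  (sym_unit R i i + sym_unit R j j + (- (2 * X0 i j)) *: sym_unit R i j).

Lemma quad_tie X0 x : quad (tie_mx X0) x =
  \sum_i \sum_(j | adj i j && (X0 i j ^+ 2 == 1)) (x i 0 - X0 i j * x j 0) ^+ 2.
Proof.
have qs (I : finType) (P : pred I) (E : I -> 'M[R]_n) :
    quad (\sum_(i | P i) E i) x = \sum_(i | P i) quad (E i) x.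
  by apply: (big_morph (fun N => quad N x)) => [N N'|]; rewrite ?quad0 ?quadD.
rewrite /tie_mx qs; apply: eq_bigr => i _; rewrite qs; apply: eq_bigr => j /andP[_ /eqP t].
rewrite !quadD (quadZ (- (2 * X0 i j))) !quad_sym_unit.
have -> : x j 0 * x j 0 = X0 i j ^+ 2 * (x j 0 * x j 0) by rewrite t mul1r.
ring.
Qed.

Lemma supported_tie X0 : supported [set: 'I_n] adj (tie_mx X0).
Proof.
have sS (I : finType) (P : pred I) (E : I -> 'M[R]_n) :
    (forall i, P i -> supported [set: 'I_n] adj (E i)) ->
    supported [set: 'I_n] adj (\sum_(i | P i) E i).
  move=> h; apply: (big_ind (supported [set: 'I_n] adj)) => //.
    exact: supported0.
  exact: supportedD.
apply: (sS) => i _; apply: (sS) => j /andP[aij _].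
have su k l : (k == l) || adj k l -> supported [set: 'I_n] adj (sym_unit R k l).
  by move=> kl; apply: supported_sym_unit; rewrite ?inE //; exact: adj_sym.
by apply: supportedD; [apply: supportedD|apply: supportedZ]; apply: su; rewrite ?eqxx ?aij ?orbT.
Qed.

Lemma frob_tie X0 : correlation X0 -> frob (tie_mx X0) X0 = 0.
Proof.
move=> [[sX _] dX].
have fs (I : finType) (P : pred I) (E : I -> 'M[R]_n) :
    frob (\sum_(i | P i) E i) X0 = \sum_(i | P i) frob (E i) X0.
  by apply: (big_morph (fun N => frob N X0)) => [N N'|]; rewrite ?frob0 ?frobD.
rewrite /tie_mx fs big1 // => i _; rewrite fs big1 // => j /andP[_ /eqP t].
rewrite !frobD (frobZ (- (2 * X0 i j))) !frob_sym_unit // !dX.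
transitivity (1 + 1 - 2 * X0 i j ^+ 2); first by ring.
by rewrite t; ring.
Qed.

Lemma quad_tie_ge0 X0 x : 0 <= quad (tie_mx X0) x.
Proof.
by rewrite quad_tie; apply: sumr_ge0 => i _; apply: sumr_ge0 => j _; exact: sqr_ge0.
Qed.

Lemma quad_tie_eq0 X0 x :
  quad (tie_mx X0) x = 0 <-> collapsed [set: 'I_n] adj X0 x.
Proof.
rewrite quad_tie; split; last first.
  move=> cx; rewrite big1 // => i _; rewrite big1 // => j /andP[aij /eqP t].
  by rewrite (cx i j) ?inE // subrr expr0n.
move=> /eqP; rewrite psumr_eq0 => [/allP h i j _ _ aij t|i _]; last first.
  by apply: sumr_ge0 => j _; exact: sqr_ge0.
have := h i (mem_index_enum _); rewrite /= psumr_eq0 => [/allP hi|j' _]; last exact: sqr_ge0.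
have := hi j (mem_index_enum _); rewrite aij t eqxx /= sqrf_eq0 subr_eq0.
by move/eqP.
Qed.

Lemma has_dim_col X (P : 'cV[R]_n -> Prop) : X^T = X ->
  (forall x, P x <-> exists y, x = X *m y) -> has_dim P (\rank X).
Proof.
move=> sX PX; pose B := row_base X.
pose b := [tuple (row i B)^T | i < \rank X].
have sumE (k : 'rV[R]_(\rank X)) : \sum_(i < \rank X) k 0 i *: b`_i = (k *m B)^T.
  apply: trmx_inj; rewrite trmxK mulmx_sum_row linear_sum /=; apply: eq_bigr => i _.
  by rewrite linearZ /= (nth_map i) ?size_enum_ord // nth_ord_enum trmxK.
exists <<b>>%VS.
  move=> x; rewrite PX; split.
    move=> xb; have xE := coord_span xb.
    have : (x^T <= X)%MS.
      rewrite -(eq_row_base X); apply/submxP; exists (\row_i coord b i x).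
      apply: trmx_inj; rewrite trmxK -sumE {1}xE; apply: eq_bigr => i _.
      by rewrite mxE.
    case/submxP => D xD; exists D^T; apply: trmx_inj.
    by rewrite trmx_mul trmxK sX.
  move=> [y xy]; have : (x^T <= row_base X)%MS.
    by rewrite eq_row_base xy trmx_mul sX submxMl.
  case/submxP => D xD; rewrite -(trmxK x) xD -sumE.
  apply: memv_suml => i _; apply: memvZ; apply: memv_span; apply: mem_nth.
  by rewrite size_tuple.
have : free b.
  apply/freeP => k k0 i.
  have := sumE (\row_i k i); under eq_bigr do rewrite mxE.
  rewrite k0 => /(congr1 trmx); rewrite trmxK trmx0 => h.
  have /row_free_inj inj : row_free B by exact: row_base_free.
  have : (\row_i k i) *m B = 0 *m B by rewrite mul0mx.
  by move/inj => /rowP/(_ i); rewrite !mxE.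
by rewrite /free => /eqP ->; rewrite size_tuple.
Qed.

(** The columns of every feasible matrix are zeros of the first stress, and then, by
    frob_le0, of the second. All zeros of both are columns of the feasible matrix X,
    so X has maximal rank and the null space is its column space. *)
Lemma two_step_sequence c X0 : decomposable adj [set: 'I_n] -> feasible c X0 ->
  stress_sequence c 2.
Proof.
move=> dec f0; have [p0 d0 e0] := f0; have c0 : correlation X0 by split.
have as_ : symmetric adj := @adj_sym _ G.
have [X [W [cX aX sW fW qW]]] := decomposable_exposes as_ c0 dec.
have fX : feasible c X by apply/(feasible_agree _ f0).
have [w1 [w1q w1p]] := stress_of_supported (supported_tie X0).
have [w2 [w2q w2p]] := stress_of_supported sW.
pose w (i : 'I_2) : stress R G := if i == 0 then w1 else w2.
have colC Y y : feasible c Y -> collapsed [set: 'I_n] adj X0 (Y *m y).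
  by move=> /(feasible_agree _ f0)[cY aY]; apply: corr_collapsed.
have colW Y y : feasible c Y -> quad W (Y *m y) = 0.
  move=> fY; have /(feasible_agree _ f0)[cY aY] := fY; move: y.
  apply: frob_le0; first by case: cY.
    by move=> y; have [] := qW _ (colC Y y fY).
  by rewrite (frob_agree sW cY c0 aY).
have nullE x : null_set w 2 x <-> exists y, x = X *m y.
  split.
    move=> h; have := h 0 isT; have := h 1 isT; rewrite /w /= w1q w2q => W0.
    move=> /quad_tie_eq0 cx; have [_ /(_ W0)[y yE]] := qW x cx.
    by exists y; apply/colP => i; rewrite yE.
  move=> [y ->] i _; rewrite /w; case: ifP => _; rewrite ?w1q ?w2q.
    by apply/quad_tie_eq0; apply: colC.
  exact: colW.
exists w; split.
- move=> j x null; rewrite /w; case: ifP => j0; first by rewrite w1q quad_tie_ge0.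
  rewrite w2q; have /quad_tie_eq0 cx : quad (tie_mx X0) x = 0.
    by have := null 0; rewrite /w /= w1q; apply; rewrite lt0n -val_eqE /= in j0 *; rewrite j0.
  by have [] := qW x cx.
- move=> j; rewrite /w; case: ifP => _; first by rewrite (w1p _ X0) // frob_tie.
  by rewrite (w2p _ X0).
exists (\rank X); last by apply: has_dim_col => //; case: cX => [[]].
split; first by exists X.
move=> Y fY; apply: mxrankS; apply/row_subP => j.
have [y yE] : exists y, Y *m delta_mx j 0 = X *m y.
  by apply/nullE => i _; rewrite /w; case: ifP => _; rewrite ?w1q ?w2q ?colW //;
    apply/quad_tie_eq0; apply: colC.
have sY : Y^T = Y by case: fY => [[]].
have sX : X^T = X by case: cX => [[]].
have -> : row j Y = (Y *m (delta_mx j 0 : 'cV_n))^T.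
  by rewrite trmx_mul trmx_delta sY -rowE.
by rewrite yE trmx_mul sX submxMl.
Qed.

Lemma decomposable_sd : decomposable adj [set: 'I_n] ->
  exists2 d : nat, sd_eq R G d & (d <= 2)%N.
Proof.
move=> dec.
have sdc (c : edge G -> R) : completable c -> exists2 k, sd_at_eq c k & (k <= 2)%N.
  move=> [_ [X0 f0]]; have [pd|npd] := EM (has_pd_solution c).
    by exists 0%N => //; left.
  have s2 := two_step_sequence dec f0.
  have ex : exists k, `[< stress_sequence c k >] by exists 2%N; apply/asboolP.
  have [k /asboolP sk kmin] := ex_minnP ex.
  exists k; last by apply: kmin; apply/asboolP.
  by right; split=> // k' sk'; apply: kmin; apply/asboolP.
pose P d := `[< exists2 c : edge G -> R, completable c & sd_at_eq c d >].
have uniq_sd (c : edge G -> R) k l : sd_at_eq c k -> sd_at_eq c l -> k = l.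
  case=> [[p ->]|[np sk mk]] [[p' ->]|[np' sl ml]] //.
  by apply/eqP; rewrite eqn_leq mk // ml.
have Ple d : P d -> (d <= 2)%N.
  move=> /asboolP[c cc sd]; have [k sk k2] := sdc c cc.
  by rewrite (uniq_sd _ _ _ sd sk).
have exP : exists d, P d.
  have c0 : completable (fun _ : edge G => 0 : R).
    split; first by move=> _; rewrite lerN10 ler01.
    exists 1%:M; split; last first.
    - move=> a; rewrite mxE; case: eqP => // st; have := edge_adj a.
      by rewrite st adj_irr.
    - by move=> i; rewrite mxE eqxx.
    - split; first exact: trmx1.
      by move=> x; rewrite /quad mulmx1 dot_ge0.
  by have [k sk _] := sdc _ c0; exists k; apply/asboolP; exists (fun _ => 0).
have [d /asboolP[c cc sd] dmax] := ex_maxnP exP Ple.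
exists d; last by apply: Ple; apply/asboolP; exists c.
split; first by exists c.
move=> c' cc'; have [k sk _] := sdc c' cc'; exists k => //.
by apply: dmax; apply/asboolP; exists c'.
Qed.

End Final.

Local Close Scope ring_scope.

(** * Induced paths, induced cycles and connected sets *)

Section InducedPaths.
Variables (T : finType) (e : rel T).
Hypotheses (es : symmetric e) (ei : irreflexive e).
Implicit Types (s t c : seq T) (x y z u v : T) (A B D : {set T}).

Fixpoint ipath s :=
  if s is x :: s' then
    [&& x \notin s', all (fun y => e x y == (y == head x s')) s' & ipath s']
  else true.

Definition linked s t a b := {in s & t, forall x y, (x != y) && (e x y == (x == a) && (y == b))}.

Lemma ipath_cons x y s : ipath (x :: y :: s) <-> ipath (y :: s) /\ linked [:: x] (y :: s) x y.
Proof.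
split.
  move=> /and3P[xn /allP xa p]; split=> // x' z; rewrite inE => /eqP -> zs.
  by rewrite (eqP (xa z zs)) eqxx /= eqxx andbT; apply: contraNneq xn => ->.
move=> [p l]; apply/and3P; split=> //.
  by apply/negP => xs; have := l x x (mem_head _ _) xs; rewrite eqxx.
by apply/allP => z zs; have /andP[_ /eqP ->] := l x z (mem_head _ _) zs; rewrite eqxx.
Qed.

Lemma ipath_uniq s : ipath s -> uniq s.
Proof. by elim: s => //= x s IH /and3P[-> _ /IH]. Qed.

Lemma ipath_cat x s y t : ipath (x :: s ++ y :: t) <->
  [/\ ipath (x :: s), ipath (y :: t) & linked (x :: s) (y :: t) (last x s) y].
Proof.
elim: s x => [|z s IH] x.
  by rewrite cat0s; split=> [/ipath_cons[p l]|[_ p l]]; [split|apply/ipath_cons; split].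
rewrite cat_cons; split.
  move=> /ipath_cons[/IH[pz py l] lx]; split=> //.
    apply/ipath_cons; split=> // a b ax bz; apply: lx => //.
    by rewrite -cat_cons mem_cat bz.
  move=> a b; rewrite inE => /predU1P[->|az] bt; last exact: l.
  have bzt : b \in z :: s ++ y :: t by rewrite -cat_cons mem_cat bt orbT.
  have /andP[-> /eqP ->] := lx x b (mem_head _ _) bzt; rewrite eqxx /=.
  have bz : b != z by have /andP[] := l z b (mem_head _ _) bt; rewrite eq_sym.
  have xl : x != last z s.
    have : last z s \in z :: s ++ y :: t by rewrite -cat_cons mem_cat mem_last.
    by move=> h; have /andP[] := lx x _ (mem_head _ _) h.
  by rewrite (negPf bz) (negPf xl).
move=> [/ipath_cons[pz lx] py l]; apply/ipath_cons; split.
  apply/IH; split=> // a b az bt; apply: l => //.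
  by rewrite inE az orbT.
move=> a b; rewrite inE => /eqP -> {a}; rewrite -cat_cons mem_cat => /orP[bz|bt].
  exact: lx (mem_head _ _) bz.
have /andP[-> /eqP ->] := l x b (mem_head _ _) bt; rewrite eqxx /=.
have zx : z \in x :: z :: s by rewrite !inE eqxx orbT.
have bz : b != z by have /andP[] := l z b zx bt; rewrite eq_sym.
have xl : x != last z s by have /andP[] := lx x _ (mem_head _ _) (mem_last z s).
by rewrite (negPf bz) (negPf xl).
Qed.

Lemma linkedC s t a b : linked s t a b -> linked t s b a.
Proof.
move=> l x y xt ys; have /andP[h /eqP E] := l y x ys xt.
by rewrite eq_sym h es E /= andbC eqxx.
Qed.

Lemma linked_mem s s' t t' a b : s =i s' -> t =i t' -> linked s t a b -> linked s' t' a b.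
Proof. by move=> ss tt l x y; rewrite -ss -tt; apply: l. Qed.

Lemma ipath_suffix s t : ipath (s ++ t) -> ipath t.
Proof. by elim: s => //= x s IH /and3P[_ _ /IH]. Qed.

Lemma ipath_prefix s t : ipath (s ++ t) -> ipath s.
Proof.
case: s => // x s; case: t => [|y t]; first by rewrite cats0.
by move=> /ipath_cat[].
Qed.

Lemma rev_cons_last x s : exists t, rev (x :: s) = last x s :: t /\ last (last x s) t = x.
Proof.
case: (lastP s) => [|r z]; first by exists [::].
by rewrite last_rcons rev_cons rev_rcons /=; exists (rcons (rev r) x); rewrite last_rcons.
Qed.

Lemma ipath_rev s : ipath s -> ipath (rev s).
Proof.
elim: s => // x [|y s] IH // p; have /ipath_cons[py l] := p.
rewrite rev_cons -cats1; have := IH py.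
have revE : last y (rev s ++ [:: y]) = y by rewrite last_cat.
case: {-1}(rev (y :: s)) (erefl (rev (y :: s))) => // z t rE pz.
apply/ipath_cat; split=> //.
have -> : last z t = y by have := last_rcons y (rev s) y; rewrite -rev_cons rE.
apply: linkedC; apply: linked_mem l => // w.
by rewrite -rE mem_rev.
Qed.

Definition icycle c :=
  if c is x :: s then
    [&& ipath s, x \notin s & all (fun y => e x y == (y == head x s) || (y == last x s)) s]
  else true.

Definition linked2 s t a b a' b' := {in s & t, forall x y,
  (x != y) && (e x y == (x == a) && (y == b) || (x == a') && (y == b'))}.

Lemma icycle_cons x y s : icycle (x :: y :: s) <->
  ipath (y :: s) /\ linked2 [:: x] (y :: s) x y x (last y s).
Proof.
split.
  move=> /and3P[p xn /allP xa]; split=> // x' z; rewrite inE => /eqP -> zs.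
  by rewrite (eqP (xa z zs)) !eqxx /= ?eqxx andbT; apply: contraNneq xn => ->.
move=> [p l]; apply/and3P; split=> //.
  by apply/negP => xs; have := l x x (mem_head _ _) xs; rewrite eqxx.
by apply/allP => z zs; have /andP[_ /eqP ->] := l x z (mem_head _ _) zs; rewrite !eqxx.
Qed.

Lemma icycle_cat x s y t : icycle (x :: s ++ y :: t) <->
  [/\ ipath (x :: s), ipath (y :: t) & linked2 (x :: s) (y :: t) (last x s) y x (last y t)].
Proof.
case: s => [|z s].
  by rewrite cat0s; split=> [/icycle_cons[p l]|[_ p l]]; [split|apply/icycle_cons; split].
rewrite cat_cons; split.
  move=> /icycle_cons[/ipath_cat[pz py l]]; rewrite last_cat [last _ (y :: t)]/= => lx.
  split=> //.
    apply/ipath_cons; split=> // a b; rewrite inE => /eqP -> {a} bz.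
    have bzt : b \in z :: s ++ y :: t by rewrite -cat_cons mem_cat bz.
    have /andP[-> /eqP ->] := lx x b (mem_head _ _) bzt; rewrite eqxx /=.
    have bl : b != last y t by have /andP[] := l b _ bz (mem_last y t).
    by rewrite (negPf bl) orbF.
  move=> a b; rewrite inE => /predU1P[->|az] bt.
    have bzt : b \in z :: s ++ y :: t by rewrite -cat_cons mem_cat bt orbT.
    have /andP[-> /eqP ->] := lx x b (mem_head _ _) bzt; rewrite eqxx /=.
    have bz : b != z by have /andP[] := l z b (mem_head _ _) bt; rewrite eq_sym.
    have xl : x != last z s.
      have : last z s \in z :: s ++ y :: t by rewrite -cat_cons mem_cat mem_last.
      by move=> h; have /andP[] := lx x _ (mem_head _ _) h.
    by rewrite (negPf bz) (negPf xl).
  have /andP[-> /eqP ->] := l a b az bt.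
  have xa : a != x.
    have azt : a \in z :: s ++ y :: t by rewrite -cat_cons mem_cat az.
    by have /andP[] := lx x a (mem_head _ _) azt; rewrite eq_sym.
  by rewrite (negPf xa) orbF eqxx.
move=> [/ipath_cons[pz lx] py l]; apply/icycle_cons; split.
  apply/ipath_cat; split=> // a b az bt; have ax : a \in x :: z :: s by rewrite inE az orbT.
  have /andP[-> /eqP ->] := l a b ax bt.
  have xa : a != x by have /andP[] := lx x a (mem_head _ _) az; rewrite eq_sym.
  by rewrite (negPf xa) orbF eqxx.
rewrite last_cat [last _ (y :: t)]/=.
move=> a b; rewrite inE => /eqP -> {a}; rewrite -cat_cons mem_cat => /orP[bz|bt].
  have /andP[-> /eqP ->] := lx x b (mem_head _ _) bz; rewrite eqxx /=.
  have bx : b \in x :: z :: s by rewrite inE bz orbT.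
  have bl : b != last y t by have /andP[] := l b _ bx (mem_last y t).
  by rewrite (negPf bl) orbF.
have /andP[-> /eqP ->] := l x b (mem_head _ _) bt; rewrite eqxx /=.
have zx : z \in x :: z :: s by rewrite !inE eqxx orbT.
have bz : b != z by have /andP[] := l z b zx bt; rewrite eq_sym.
have xl : x != last z s by have /andP[] := lx x _ (mem_head _ _) (mem_last z s).
by rewrite (negPf bz) (negPf xl).
Qed.

Lemma linked2C s t a b a' b' : linked2 s t a b a' b' -> linked2 t s b' a' b a.
Proof.
move=> l x y xt ys; have /andP[yx /eqP eyx] := l y x ys xt.
by rewrite eq_sym yx es eyx orbC [X in X || _]andbC [X in _ || X]andbC eqxx.
Qed.

Lemma icycle_rot s t : icycle (s ++ t) -> icycle (t ++ s).
Proof.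
case: s => [|x s]; first by rewrite cats0.
case: t => [|y t]; first by rewrite cats0.
move=> /icycle_cat[px py l]; apply/icycle_cat; split=> //.
exact: linked2C.
Qed.

Lemma icycle_uniq c : icycle c -> uniq c.
Proof. by case: c => // x s /and3P[/ipath_uniq us xs _]; rewrite /= xs. Qed.

Lemma icycle_rev c : icycle c -> icycle (rev c).
Proof.
case: c => // x [|y s] // /icycle_cons[p l].
rewrite rev_cons -cats1; case rE : (rev (y :: s)) => [|z t].
  by have := size_rev (y :: s); rewrite rE.
apply/icycle_cat; split=> //; first by rewrite -rE; apply: ipath_rev.
have -> : last z t = y by have := last_rcons y (rev s) y; rewrite -rev_cons rE.
have zE : z = last y s by have := last_rcons z (rev t) z; rewrite -rev_cons -rE revK.
move=> w x'; rewrite -rE mem_rev => wy; rewrite inE => /eqP -> {x'}.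
have /andP[xw /eqP exw] := l x w (mem_head _ _) wy.
by rewrite eq_sym xw es exw zE /= eqxx !andTb !andbT eqxx.
Qed.

(** Connectivity by cuts: this form passes to unions without any manipulation of paths. *)
Variant conn D : Prop := Conn of forall B x y,
  x \in D -> x \in B -> y \in D -> y \notin B ->
  exists u v, [/\ u \in D, u \in B, v \in D, v \notin B & e u v].

Lemma conn_cut D B x y : conn D -> x \in D -> x \in B -> y \in D -> y \notin B ->
  exists u v, [/\ u \in D, u \in B, v \in D, v \notin B & e u v].
Proof. by case=> h; apply: h. Qed.

Lemma conn1 x : conn [set x].
Proof. by split=> B y z; rewrite !inE => /eqP -> yB /eqP ->; rewrite yB. Qed.

Lemma connU D1 D2 x y : conn D1 -> conn D2 -> x \in D1 -> y \in D2 ->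
  (x == y) || e x y -> conn (D1 :|: D2).
Proof.
move=> c1 c2 x1 y2 xy; split=> B u v uD uB vD vB.
have in1 a b : a \in D1 -> a \in B -> b \in D1 -> b \notin B -> exists u v,
    [/\ u \in D1 :|: D2, u \in B, v \in D1 :|: D2, v \notin B & e u v].
  move=> aD aB bD bB; have [u' [v' [? ? ? ? ?]]] := conn_cut c1 aD aB bD bB.
  by exists u', v'; rewrite !inE; split=> //; apply/orP; left.
have in2 a b : a \in D2 -> a \in B -> b \in D2 -> b \notin B -> exists u v,
    [/\ u \in D1 :|: D2, u \in B, v \in D1 :|: D2, v \notin B & e u v].
  move=> aD aB bD bB; have [u' [v' [? ? ? ? ?]]] := conn_cut c2 aD aB bD bB.
  by exists u', v'; rewrite !inE; split=> //; apply/orP; right.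
have [xB|xB] := boolP (x \in B); have [yB|yB] := boolP (y \in B).
- by move: vD; rewrite inE => /orP[v1|v2]; [apply: (in1 x v)|apply: (in2 y v)].
- case/orP: xy => [/eqP xy|exy]; first by rewrite xy (negPf yB) in xB.
  by exists x, y; rewrite !inE x1 y2 orbT; split.
- case/orP: xy => [/eqP xy|exy]; first by rewrite xy yB in xB.
  by exists y, x; rewrite !inE x1 y2 orbT es; split.
- by move: uD; rewrite inE => /orP[u1|u2]; [apply: (in1 u x)|apply: (in2 u y)].
Qed.

Lemma conn_ext D D' : D =i D' -> conn D -> conn D'.
Proof. by move=> /setP ->. Qed.

Lemma conn_ipath s : ipath s -> conn [set x in s].
Proof.
elim: s => [_|x [|y s] IH p].
- by split=> B x y; rewrite inE.
- by apply: conn_ext (conn1 x) => z; rewrite !inE.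
have /ipath_cons[py l] := p.
have exy : e x y by have /andP[_ /eqP ->] := l x y (mem_head _ _) (mem_head _ _); rewrite !eqxx.
have := connU (conn1 x) (IH py) (set11 x) (y := y); rewrite inE mem_head exy orbT.
move=> /(_ isT isT); by apply: conn_ext => z; rewrite !inE.
Qed.

Lemma split_last_sat (P : pred T) s : has P s ->
  exists s1 z s2, [/\ s = s1 ++ z :: s2, P z & ~~ has P s2].
Proof.
elim: s => //= x s IH; have [hs _|hs] := boolP (has P s).
  by have [s1 [z [s2 [-> Pz hz]]]] := IH hs; exists (x :: s1), z, s2.
by rewrite orbF => Px; exists [::], x, s.
Qed.

Lemma split_first_sat (P : pred T) s : has P s ->
  exists s1 z s2, [/\ s = s1 ++ z :: s2, P z & ~~ has P s1].
Proof.
elim: s => //= x s IH; have [Px _|Px hs] := boolP (P x); first by exists [::], x, s.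
have [s1 [z [s2 [-> Pz hz]]]] := IH hs; exists (x :: s1), z, s2; split=> //=.
by rewrite (negPf Px).
Qed.

Lemma split_mem x s : x \in s -> exists s1 s2, s = s1 ++ x :: s2.
Proof. by case/splitPr=> s1 s2; exists s1, s2. Qed.

(** Shortcut a path at its last neighbour of its first vertex. *)
Lemma ipath_of_path x p (P : pred T) : path e x p -> all P (x :: p) ->
  exists2 q, ipath (x :: q) & (last x q = last x p /\ all P (x :: q)).
Proof.
elim: p x => [|y p IH] x; first by exists [::].
rewrite [path _ _ _]/= [all _ _]/= => /andP[exy pth] /andP[Px Py].
have [q pq [lq Pq]] := IH y pth Py.
suff [r [rq rP rl]] : exists r, [/\ {subset r <= y :: q}, ipath (x :: r) & last x r = last y q].
  exists r => //; split; first by rewrite rl lq.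
  apply/allP => z; rewrite inE => /predU1P[-> //|/rq zq].
  by apply: (allP Pq).
have lastE s1 z s2 w : last w (s1 ++ z :: s2) = last z s2 by rewrite last_cat.
have [xq|xq] := boolP (x \in y :: q).
  have [q1 [q2 qE]] := split_mem xq; exists q2; split.
  - by move=> z zq; rewrite qE mem_cat inE zq !orbT.
  - by apply: (@ipath_suffix q1); rewrite -qE.
  - by rewrite -[RHS]/(last y (y :: q)) qE lastE.
have : has (e x) (y :: q) by rewrite /= exy.
case/split_last_sat=> q1 [z [q2 [qE xz nz]]]; exists (z :: q2); split.
- by move=> w wq; rewrite qE mem_cat wq orbT.
- apply/ipath_cons; split; first by apply: (@ipath_suffix q1); rewrite -qE.
  move=> x' w; rewrite inE => /eqP -> wq; rewrite eqxx /=; apply/andP; split.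
    by apply: contraNneq xq => ->; rewrite qE mem_cat wq orbT.
  move: wq; rewrite inE => /predU1P[->|wq]; first by rewrite xz eqxx.
  have xw : e x w = false by apply/negP => xw; case/hasP: nz; exists w.
  rewrite xw; apply/eqP; symmetry; apply/eqP => wz.
  by rewrite wz xz in xw.
- by rewrite -[RHS]/(last y (y :: q)) qE lastE.
Qed.

Lemma conn_has_ipath D x y : conn D -> x \in D -> y \in D ->
  exists2 q, ipath (x :: q) & last x q = y /\ {subset x :: q <= D}.
Proof.
move=> cD xD yD; pose r := [rel a b | e a b && (b \in D)].
have : connect r x y.
  apply: contraT => nxy.
  have [||u [v [uD]]] := @conn_cut D [set z | connect r x z] x y cD xD _ yD.
  - by rewrite inE.
  - by rewrite inE.
  rewrite !inE => xu vD xv euv; case/negP: xv; apply: connect_trans xu _.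
  by apply: connect1; rewrite /= euv.
case/connectP=> p pth yE.
have pe : path e x p by apply: sub_path pth => a b /andP[].
have Dp : all (mem D) (x :: p).
  rewrite /= xD /=; elim: p x xD pth {yE pe} => //= z p IH w _ /andP[/andP[_ zD] pz].
  by rewrite zD /= (IH z).
have [q pq [lq /allP Dq]] := ipath_of_path pe Dp.
by exists q => //; rewrite lq.
Qed.

Lemma path_cut (p : seq T) x y (B : {set T}) : path e x p -> last x p = y -> x \in B ->
  y \notin B -> exists u v, [/\ u \in x :: p, u \in B, v \in x :: p, v \notin B & e u v].
Proof.
elim: p x => [|z p IH] x /=; first by move=> _ -> yB; rewrite yB.
move=> /andP[exz pz] ly xB yB; have [zB|zB] := boolP (z \in B).
  have [u [v [up uB vp vB euv]]] := IH z pz ly zB yB.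
  by exists u, v; split=> //; rewrite inE ?up ?vp orbT.
by exists x, z; rewrite !inE !eqxx ?orbT; split.
Qed.

End InducedPaths.
Arguments ipath : simpl never.
Arguments icycle : simpl never.

(** * Cycles attached to a connected set *)

Section Violation.
Variables (T : finType) (e : rel T).
Hypotheses (es : symmetric e) (ei : irreflexive e).
Implicit Types (s t : seq T) (x y z u v c d : T) (A B : {set T}).

Local Notation ipath := (ipath e).
Local Notation icycle := (icycle e).
Local Notation conn := (conn e).
Local Notation linked := (linked e).

(** The elements of this set are called the feet of D on C below. *)
Definition att (C : seq T) (D : {set T}) : {set T} :=
  [set c in C | [exists d in D, e d c]].

Definition attaches3 (C : seq T) (D : {set T}) :=
  [/\ icycle C, 4 <= size C, conn D, {in C, forall c, c \notin D} & 3 <= #|att C D|].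

(** A tree in which every vertex is listed before the neighbour through which it is
    joined to the remaining ones. *)
Fixpoint itree (s : seq T) : Prop :=
  if s is x :: s' then
    (s' = [::] \/ exists2 y, y \in s' & {in s', forall z, e x z = (z == y)}) /\ itree s'
  else True.

(** The configuration that contracts to a wheel: contracting the tree D to the hub,
    and the arcs of C between consecutive feet to the vertices of the rim, meets no
    double edge, because a foot has only one neighbour in D. The last condition
    excludes leaves, so that every step of the contraction inverts a vertex
    splitting. *)
Definition tree_config (C D : seq T) :=
  [/\ icycle C, 4 <= size C, uniq D, itree D & {in C, forall c, c \notin D}] /\
  [/\ {in C, forall c d d', d \in D -> d' \in D -> e d c -> e d' c -> d = d'},
      3 <= #|att C [set x in D]|
    & {in D, forall d, exists y z, [/\ y != z, y \in C ++ D, z \in C ++ D, e d y & e d z]}].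

Lemma attP C (D : {set T}) c : reflect (c \in C /\ exists2 d, d \in D & e d c) (c \in att C D).
Proof.
rewrite inE; apply: (iffP andP) => [[cC /existsP[d /andP[dD edc]]]|[cC [d dD edc]]].
  by split=> //; exists d.
by split=> //; apply/existsP; exists d; rewrite dD.
Qed.

Lemma card3 (A : {set T}) x y z : x \in A -> y \in A -> z \in A ->
  x != y -> x != z -> y != z -> 3 <= #|A|.
Proof.
move=> xA yA zA xy xz yz; have <- : #|[set x; y; z]| = 3.
  by rewrite setUC cardsU1 cards2 !inE negb_or ![z == _]eq_sym xz xy yz.
by apply: subset_leq_card; apply/subsetP => w; rewrite !inE => /orP[/orP[]|]/eqP->.
Qed.

Lemma att_perm C C' D : C =i C' -> att C D = att C' D.
Proof. by move=> CC; apply/setP => c; rewrite !inE CC. Qed.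

Lemma ipath_itree s : ipath s -> itree s.
Proof.
elim: s => // x [|y s] IH p; first by split; [left|].
have /(ipath_cons)[py l] := p; split; last exact: IH.
right; exists y; rewrite ?mem_head // => z zs.
by have /andP[_ /eqP ->] := l x z (mem_head _ _) zs; rewrite eqxx.
Qed.

Lemma itree_cat s x t y : ipath (rcons s x) -> itree t -> y \in t ->
  linked (rcons s x) t x y -> itree (rcons s x ++ t).
Proof.
move=> p it yt; elim: s p => [|z s IH] p h.
  split=> //; right; exists y => // w wt.
  by have /andP[_ /eqP ->] := h x w (mem_head _ _) wt; rewrite eqxx.
have ps : ipath (rcons s x) by case/and3P: p.
split; last by apply: IH => // a b az bt; apply: h => //; rewrite inE az orbT.
right; have [w [r sE]] : exists w r, rcons s x = w :: r by case: (s) => [|w r] /=; eauto.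
move: p; rewrite rcons_cons sE => /ipath_cons[_ l].
have zx : z != x.
  have xr : x \in w :: r by rewrite -sE mem_rcons mem_head.
  by have /andP[] := l z x (mem_head _ _) xr.
exists w; first by rewrite mem_cat mem_head.
move=> b; rewrite mem_cat => /orP[br|bt].
  by have /andP[_ /eqP ->] := l z b (mem_head _ _) br; rewrite eqxx.
have /andP[_ /eqP ->] := h z b (mem_head _ _) bt; rewrite (negPf zx) /=.
have wr : w \in rcons (z :: s) x by rewrite rcons_cons sE !inE eqxx orbT.
by have /andP[wb _] := h w b wr bt; rewrite eq_sym (negPf wb).
Qed.

Lemma ipath_prev s x : ipath s -> x \in s -> x = head x s \/
  exists y, [/\ y \in s, y != x, e x y & exists s1 s2, s = s1 ++ y :: x :: s2].
Proof.
move=> p /split_mem[s1 [s2 sE]]; case: (lastP s1) sE => [|r y] sE; subst s; first by left.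
right; exists y; rewrite cat_rcons in p *.
have /ipath_suffix /ipath_cons[_ /(_ y x)] := p.
rewrite !mem_head !eqxx => /(_ isT isT)/andP[yx /eqP eyx].
split=> //; last by exists r, s2.
  by rewrite mem_cat mem_head orbT.
by rewrite es.
Qed.

Lemma ipath_next s x : ipath s -> x \in s -> x = last x s \/
  exists y, [/\ y \in s, y != x, e x y & exists s1 s2, s = s1 ++ x :: y :: s2].
Proof.
move=> p /split_mem[s1 [s2 sE]]; case: s2 sE => [|y r] sE; subst s.
  by left; rewrite last_cat.
right; exists y; have /ipath_suffix /ipath_cons[_ /(_ x y)] := p.
rewrite !mem_head !eqxx => /(_ isT isT)/andP[yx /eqP eyx].
split=> //; last by exists s1, r.
  by rewrite mem_cat !inE eqxx !orbT.
by rewrite eq_sym.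
Qed.

Lemma ipath_two_nbrs s x : ipath s -> x \in s ->
  [\/ x = head x s, x = last x s |
      exists y z, [/\ y != z, y \in s, z \in s, e x y & e x z]].
Proof.
move=> p xs; have [|[y [ys yx exy [s1 [s2 sE]]]]] := ipath_prev p xs; first by constructor 1.
have [|[z [zs zx exz [s3 [s4 sE']]]]] := ipath_next p xs; first by constructor 2.
constructor 3; exists y, z; split=> //.
have us := ipath_uniq p.
have i1 : index x s = (size s1).+1.
  rewrite sE in us *; rewrite index_cat.
  have := us; rewrite cat_uniq => /and3P[_ /hasPn h /andP[yn /andP[xn _]]].
  have /negPf -> : x \notin s1 by apply: h; rewrite !inE eqxx orbT.
  by rewrite /= (negPf yx) eqxx addn1.
have i2 : index x s = size s3.
  rewrite sE' in us *; rewrite index_cat.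
  have := us; rewrite cat_uniq => /and3P[_ /hasPn h _].
  have /negPf -> : x \notin s3 by apply: h; rewrite !inE eqxx.
  by rewrite /= eqxx addn0.
have yE : nth x s (size s1) = y by rewrite sE nth_cat ltnn subnn.
have zE : nth x s (size s3).+1 = z.
  by rewrite sE' nth_cat ltnNge leqnSn /= subSnn.
rewrite -yE -zE nth_uniq //.
- by rewrite -i2 i1 neq_ltn ltnS leqnSn.
- by rewrite sE size_cat /= addnS ltnS leq_addr.
- by rewrite sE' size_cat /= !addnS !ltnS leq_addr.
Qed.

Hypothesis no_config : forall C D, ~ tree_config C D.

Lemma hub_absurd C h : icycle C -> 4 <= size C -> h \notin C ->
  3 <= #|att C [set h]| -> False.
Proof.
move=> cC sC hC a3; apply: (no_config (C := C) (D := [:: h])); split; split=> //.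
- by split=> //; left.
- by move=> c cC'; rewrite inE; apply: contraNneq hC => <-.
- by move=> c _ d d'; rewrite !inE => /eqP dh /eqP d'h _ _; rewrite dh d'h.
- by have -> : [set x in [:: h]] = [set h] by apply/setP => x; rewrite !inE.
move=> d; rewrite inE => /eqP ->.
have : 1 < #|att C [set h]| by apply: leq_trans a3.
case/card_gt1P => y [z [/attP[yC [d1]]]]; rewrite inE => /eqP -> hy.
case/attP=> zC [d2]; rewrite inE => /eqP -> hz yz.
by exists y, z; rewrite !mem_cat yC zC; split.
Qed.

Lemma card_set_seq s : #|[set x in s]| <= size s.
Proof. by rewrite cardsE card_size. Qed.

Lemma shortest_seq (P : pred (seq T)) : (exists s, P s) ->
  exists s, P s /\ forall s', P s' -> size s <= size s'.
Proof.
case=> s; have [k] := ubnP (size s); elim: k s => // k IH s lek Ps.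
have [/existsP[j /existsP[r Pr]]|no] :=
    boolP [exists j : 'I_(size s), [exists r : j.-tuple T, P r]].
  by apply: (IH r) => //; rewrite size_tuple; apply: leq_trans (ltn_ord j) _.
exists s; split=> // s' Ps'; rewrite leqNgt; apply: contra no => lt.
by apply/existsP; exists (Ordinal lt); apply/existsP; exists (in_tuple s').
Qed.

Section Minimal.
Variable m : nat.
Hypothesis minimal : forall C D, attaches3 C D -> m <= size C + #|D|.

(** The path joining b to c outside C closes the arc b S2 c to another induced cycle,
    to which a :: S1 is attached at two vertices of the path and at b. By minimality
    this cycle together with a :: S1 is not smaller than C with the path, so S3 is
    empty. Then a is adjacent to c, and a single vertex with three feet is a tree. *)
Lemma theta_absurd C a S1 b S2 c S3 x s : C = a :: S1 ++ b :: S2 ++ c :: S3 ->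
  icycle C -> ipath (x :: s) -> m = size C + size (x :: s) ->
  {in x :: s & C, forall r w, r != w} ->
  {in x :: s & C, forall r w, w != a ->
     e r w = (r == last x s) && (w == b) || (r == x) && (w == c)} ->
  1 < #|[set r in x :: s | e r a]| -> False.
Proof.
move=> CE cC pR mE dis attE two; have uC := icycle_uniq cC.
have := cC; rewrite CE => /icycle_cat[pa pbc l1].
have aE w : w \in C -> w \in S1 ++ b :: S2 ++ c :: S3 -> w != a.
  by move=> _ wS; apply: contraTneq wS => ->; move: uC; rewrite CE => /andP[].
pose C' := x :: s ++ b :: S2 ++ [:: c].
have subC w : w \in b :: S2 ++ [:: c] -> w \in S1 ++ b :: S2 ++ c :: S3.
  rewrite !mem_cat !inE !mem_cat !inE => /or3P[->|->|->]; rewrite ?orbT //.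
have subC' w : w \in b :: S2 ++ [:: c] -> w \in C.
  by move/subC => h; rewrite CE inE h orbT.
have cC' : icycle C'.
  apply/icycle_cat; split=> //.
    by apply: (@ipath_prefix _ _ _ S3); rewrite /= -catA.
  move=> r w rR wS; rewrite dis ?subC' //= attE ?subC' //; last by apply: aE; auto.
  by rewrite last_cat eqxx.
have sC' : 4 <= size C'.
  have : 1 < size (x :: s).
    by apply: leq_trans two _; apply: leq_trans (card_set_seq (x :: s));
      apply: subset_leq_card; apply/subsetP => r; rewrite !inE => /andP[].
  by rewrite /C' /= !size_cat /= size_cat /=; lia.
have [r1 [r2 [r1R r2R r12]]] := card_gt1P two.
move: r1R r2R; rewrite !inE -!in_cons => /andP[r1R r1a] /andP[r2R r2a].
have aS : a \in C by rewrite CE mem_head.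
have notC' w : w \in (a :: S1) ++ S3 -> w \notin C'.
  move=> wS; have wC : w \in C.
    move: wS; rewrite CE !inE !mem_cat !inE !mem_cat !inE.
    by case/or3P=> ->; rewrite ?orbT.
  rewrite /C' -cat_cons mem_cat negb_or; apply/andP; split.
    by apply/negP => wR; have := dis w w wR wC; rewrite eqxx.
  have : uniq ((b :: S2 ++ [:: c]) ++ (a :: S1) ++ S3).
    by rewrite uniq_catCA; move: uC; rewrite CE /= -!catA /=.
  by rewrite cat_uniq => /and3P[_ /hasPn/(_ w wS)].
have lab : e (last a S1) b.
  by have /andP[_ /eqP ->] := l1 _ _ (mem_last a S1) (mem_head _ _); rewrite !eqxx.
have bC' : b \in C' by rewrite /C' -cat_cons mem_cat mem_head orbT.
have rC' r : r \in x :: s -> r \in C' by move=> rR; rewrite /C' -cat_cons mem_cat rR.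
have rb r : r \in x :: s -> r != b by move=> rR; apply: dis; rewrite // subC' ?mem_head.
have S3E : S3 = [::].
  have /minimal : attaches3 C' [set w in a :: S1].
    split=> //; first exact: conn_ipath.
      by move=> w wC'; apply: contraL wC'; rewrite inE => wS; apply: notC'; rewrite mem_cat wS.
    apply: (@card3 _ r1 r2 b); rewrite ?rb //.
    - by apply/attP; split; [exact: rC'|exists a; rewrite ?inE ?eqxx // es].
    - by apply/attP; split; [exact: rC'|exists a; rewrite ?inE ?eqxx // es].
    - by apply/attP; split=> //; exists (last a S1); rewrite // inE mem_last.
  rewrite mE CE /C'; have := card_set_seq (a :: S1).
  case: (S3) => // w S4; rewrite /= !size_cat /= !size_cat /= => h1 h2; clear - h1 h2; lia.
apply: (hub_absurd cC' sC' (h := a)); first by apply: notC'; exact: mem_head.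
have cb : c \in b :: S2 ++ [:: c] by rewrite inE mem_cat mem_head !orbT.
have cC'' : c \in C' by rewrite /C' -cat_cons mem_cat cb orbT.
have rc r : r \in x :: s -> r != c.
  by move=> rR; apply: dis; rewrite // subC'.
apply: (@card3 _ r1 r2 c); rewrite ?rc //.
- by apply/attP; split; [exact: rC'|exists a; rewrite ?inE ?eqxx // es].
- by apply/attP; split; [exact: rC'|exists a; rewrite ?inE ?eqxx // es].
apply/attP; split=> //; exists a; rewrite ?inE //.
move: cC; rewrite CE S3E -[b :: S2 ++ _]cat_cons catA => /icycle_cat[_ _ l].
have /andP[_ /eqP ->] := l a c (mem_head _ _) (mem_head _ _).
by rewrite !eqxx orbT.
Qed.

(** The legs ending at a and b, with the arc between a and b through S1, form an
    induced cycle. The third leg, prolonged by c :: S3, is attached to it at the inner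
    ends of the two legs and at a. Minimality then forces S2 to be empty. *)
Lemma tripod_arc C a S1 b S2 c S3 xa ta xb tb xc tc :
  C = a :: S1 ++ b :: S2 ++ c :: S3 -> icycle C ->
  ipath (xa :: ta) -> ipath (xb :: tb) -> ipath (xc :: tc) ->
  m = size C + (size (xa :: ta) + size (xb :: tb) + size (xc :: tc)) ->
  linked (xa :: ta) (xb :: tb) (last xa ta) (last xb tb) ->
  linked (xa :: ta) (xc :: tc) (last xa ta) (last xc tc) ->
  linked (xb :: tb) (xc :: tc) (last xb tb) (last xc tc) ->
  linked (xa :: ta) C xa a -> linked (xb :: tb) C xb b -> linked (xc :: tc) C xc c ->
  S2 = [::].
Proof.
move=> CE cC pa pb pc mE lab lac lbc lA lB lC; have uC := icycle_uniq cC.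
have [t' [t'E t'l]] := rev_cons_last xb tb.
have mrev w : w \in last xb tb :: t' = (w \in xb :: tb) by rewrite -t'E mem_rev.
pose arc := b :: rev S1 ++ [:: a].
have arcE : arc = rev (a :: S1 ++ [:: b]).
  by rewrite rev_cons rev_cat /= -cats1.
have marc w : w \in arc = (w \in a :: S1 ++ [:: b]) by rewrite arcE mem_rev.
have arcC w : w \in arc -> w \in C.
  by rewrite marc CE !inE !mem_cat !inE => /or3P[->|->|->]; rewrite ?orbT.
have parc : ipath arc.
  rewrite arcE; apply: ipath_rev => //.
  have : icycle ((c :: S3) ++ (a :: S1 ++ b :: S2)).
    have := @icycle_rot _ _ es (a :: S1 ++ b :: S2) (c :: S3).
    by rewrite /= -catA /= -CE; apply.
  case/icycle_cat=> _ p _; apply: (@ipath_prefix _ _ _ S2).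
  by rewrite /= -catA.
have pR : ipath (xa :: ta ++ last xb tb :: t').
  apply/ipath_cat; split=> //; first by rewrite -t'E; exact: ipath_rev.
  by move=> z w zA; rewrite mrev; apply: lab.
have uAB z : z \in xa :: ta -> z \notin xb :: tb.
  by move=> zA; apply/negP => zB; have := lab z z zA zB; rewrite eqxx.
pose C' := xa :: (ta ++ last xb tb :: t') ++ arc.
have mC' w : w \in C' = [|| w \in xa :: ta, w \in xb :: tb | w \in arc].
  by rewrite /C' -cat_cons mem_cat -cat_cons mem_cat mrev orbA.
have cC' : icycle C'.
  apply/icycle_cat; split=> //.
  rewrite last_cat /= t'l last_cat /= => z w; rewrite -cat_cons mem_cat mrev.
  move=> zAB wa; have wC := arcC w wa.
  case/orP: zAB => [zA|zB].
    have /andP[-> /eqP ->] := lA z w zA wC.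
    have /negPf -> : z != xb by apply: contraNneq (uAB z zA) => ->; exact: mem_head.
    by rewrite /= eqxx.
  have /andP[-> /eqP ->] := lB z w zB wC.
  have /negPf -> : z != xa by apply: contraTneq zB => ->; apply: uAB; exact: mem_head.
  by rewrite /= orbF eqxx.
have sC' : size C' = size (xa :: ta) + size (xb :: tb) + (size S1 + 2).
  rewrite /C' -cat_cons size_cat -cat_cons size_cat -t'E size_rev.
  by rewrite /arc [size (b :: _)]/= size_cat size_rev /= addn1 addn2.
pose D' := [set w in xc :: tc] :|: [set w in c :: S3].
have S3C w : w \in c :: S3 -> w \in C.
  by move=> h; rewrite CE -[b :: _]cat_cons catA -cat_cons mem_cat h orbT.
have : attaches3 C' D'.
  split=> //.
  - by rewrite sC' /= addn2 !addSn !addnS.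
  - apply: (connU es (conn_ipath es pc) (conn_ipath es _) (x := xc) (y := c));
      rewrite ?inE ?eqxx //; last first.
      have cC0 : c \in C by apply: S3C; exact: mem_head.
      by have /andP[_ /eqP ->] := lC xc c (mem_head _ _) cC0; rewrite !eqxx orbT.
    move: cC; rewrite CE -[b :: _]cat_cons catA => /icycle_cat[_ p _] //.
  - move=> w; rewrite mC' => h; rewrite !inE -!in_cons negb_or; apply/andP; split.
      apply/negP => wc; case/or3P: h => [wA|wB|wa].
      + by have := lac w w wA wc; rewrite eqxx.
      + by have := lbc w w wB wc; rewrite eqxx.
      + by have := lC w w wc (arcC w wa); rewrite eqxx.
    apply/negP => wS; case/or3P: h => [wA|wB|wa].
    + by have := lA w w wA (S3C w wS); rewrite eqxx.
    + by have := lB w w wB (S3C w wS); rewrite eqxx.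
    move: uC; rewrite CE (_ : _ :: _ = (a :: S1 ++ [:: b]) ++ S2 ++ c :: S3); last first.
      by rewrite /= -catA.
    rewrite cat_uniq => /and3P[_ /hasPn/(_ w) h _]; move: h; rewrite mem_cat wS orbT.
    by rewrite -marc /= wa => /(_ isT).
  have lcD : last xc tc \in D' by rewrite !inE -in_cons mem_last.
  have lab' : e (last xa ta) (last xc tc).
    by have /andP[_ /eqP ->] := lac _ _ (mem_last xa ta) (mem_last xc tc); rewrite !eqxx.
  have lbb' : e (last xb tb) (last xc tc).
    by have /andP[_ /eqP ->] := lbc _ _ (mem_last xb tb) (mem_last xc tc); rewrite !eqxx.
  have aC : a \in C by rewrite CE mem_head.
  apply: (@card3 _ (last xa ta) (last xb tb) a).
  - by apply/attP; rewrite mC' mem_last; split=> //; exists (last xc tc); rewrite // es.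
  - by apply/attP; rewrite mC' mem_last orbT; split=> //; exists (last xc tc); rewrite // es.
  - apply/attP; split; first by rewrite mC' marc mem_head !orbT.
    exists (last c S3); first by rewrite !inE -!in_cons mem_last orbT.
    move: cC; rewrite CE -[b :: _]cat_cons catA => /icycle_cat[_ _ l].
    have /andP[_ /eqP h] := l a (last c S3) (mem_head _ _) (mem_last _ _).
    by rewrite es h !eqxx orbT.
  - by have /andP[] := lab _ _ (mem_last xa ta) (mem_last xb tb).
  - by have /andP[] := lA _ _ (mem_last xa ta) aC.
  - by have /andP[] := lB _ _ (mem_last xb tb) aC.
move/minimal; rewrite mE sC' CE.
have : #|D'| <= size (xc :: tc) + size (c :: S3).
  by rewrite cardsU; apply: leq_trans (leq_subr _ _) _; apply: leq_add; exact: card_set_seq.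
case: (S2) => // w S4; rewrite /= !size_cat /= !size_cat /= => h1 h2; clear - h1 h2; lia.
Qed.

(** By symmetry all three arcs of C are empty, and C is a triangle. *)
Lemma tripod_absurd C a S1 b S2 c S3 xa ta xb tb xc tc :
  C = a :: S1 ++ b :: S2 ++ c :: S3 -> icycle C -> 4 <= size C ->
  ipath (xa :: ta) -> ipath (xb :: tb) -> ipath (xc :: tc) ->
  m = size C + (size (xa :: ta) + size (xb :: tb) + size (xc :: tc)) ->
  linked (xa :: ta) (xb :: tb) (last xa ta) (last xb tb) ->
  linked (xa :: ta) (xc :: tc) (last xa ta) (last xc tc) ->
  linked (xb :: tb) (xc :: tc) (last xb tb) (last xc tc) ->
  linked (xa :: ta) C xa a -> linked (xb :: tb) C xb b -> linked (xc :: tc) C xc c ->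
  False.
Proof.
move=> CE cC sC pa pb pc mE lab lac lbc lA lB lC.
have S2E := tripod_arc CE cC pa pb pc mE lab lac lbc lA lB lC.
have lC' C' z w : C' =i C -> forall l, linked l C z w -> linked l C' z w.
  by move=> CC l; apply: linked_mem => y; rewrite ?CC.
have cat3 (u1 u2 u3 : seq T) : icycle (u1 ++ u2 ++ u3) -> icycle (u2 ++ u3 ++ u1).
  by move/icycle_rot => /(_ es); rewrite catA.
have C2 : icycle (b :: S2 ++ c :: S3 ++ a :: S1).
  by have := cat3 (a :: S1) (b :: S2) (c :: S3); rewrite /= -CE; apply.
have C3 : icycle (c :: S3 ++ a :: S1 ++ b :: S2).
  by have := cat3 (b :: S2) (c :: S3) (a :: S1); apply.
have m2 : b :: S2 ++ c :: S3 ++ a :: S1 =i C.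
  by move=> z; rewrite CE -!cat_cons !mem_cat; do ![case: (_ \in _)].
have m3 : c :: S3 ++ a :: S1 ++ b :: S2 =i C.
  by move=> z; rewrite CE -!cat_cons !mem_cat; do ![case: (_ \in _)].
have s2 : size (b :: S2 ++ c :: S3 ++ a :: S1) = size C.
  by rewrite CE -!cat_cons !size_cat [RHS]addnC addnA.
have s3 : size (c :: S3 ++ a :: S1 ++ b :: S2) = size C.
  by rewrite CE -!cat_cons !size_cat [RHS]addnA [RHS]addnC.
have S3E : S3 = [::].
  apply: (tripod_arc erefl C2 pb pc pa _ lbc (linkedC es lab) (linkedC es lac)
    (lC' _ _ _ m2 _ lB) (lC' _ _ _ m2 _ lC) (lC' _ _ _ m2 _ lA)).
  by rewrite mE s2; congr (_ + _); rewrite addnAC addnC addnA addnAC.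
have S1E : S1 = [::].
  apply: (tripod_arc erefl C3 pc pa pb _ (linkedC es lac) (linkedC es lbc) lab
    (lC' _ _ _ m3 _ lC) (lC' _ _ _ m3 _ lA) (lC' _ _ _ m3 _ lB)).
  by rewrite mE s3; congr (_ + _); rewrite addnC addnA.
by move: sC; rewrite CE S1E S2E S3E.
Qed.

Lemma cycle_at_three C a b c : icycle C -> a \in C -> b \in C -> c \in C ->
  a != b -> a != c -> b != c -> exists C' S1 S2 S3,
  [/\ icycle C', C' =i C, size C' = size C &
    C' = a :: S1 ++ b :: S2 ++ c :: S3 \/ C' = a :: S1 ++ c :: S2 ++ b :: S3].
Proof.
move=> cC /split_mem[s1 [s2 CE]] bC cC0 ab ac bc; rewrite CE in cC bC cC0 *.
have cC' := icycle_rot es cC.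
have mem : (a :: s2) ++ s1 =i s1 ++ a :: s2 by move=> z; rewrite !mem_cat orbC.
have bs : b \in s2 ++ s1 by move: bC; rewrite -mem inE eq_sym (negPf ab).
have cs : c \in s2 ++ s1 by move: cC0; rewrite -mem inE eq_sym (negPf ac).
have sz : size ((a :: s2) ++ s1) = size (s1 ++ a :: s2) by rewrite !size_cat addnC.
have [r1 [r2 rE]] := split_mem bs; rewrite cat_cons in cC' mem sz.
move: cs; rewrite rE mem_cat inE eq_sym (negPf bc) /= => /orP[/split_mem[r3 [r4 r1E]]|/split_mem[r3 [r4 r2E]]].
  exists (a :: s2 ++ s1), r3, r4, r2; split=> //; right.
  by rewrite rE r1E -catA.
by exists (a :: s2 ++ s1), r1, r3, r4; split=> //; left; rewrite rE r2E.
Qed.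

(** In a minimal violation D consists of a path P joining two feet a and b of C and a
    path Q from P to a third foot c. *)
Section Ear.
Variables (C : seq T) (D : {set T}).
Hypotheses (CD : attaches3 C D) (mE : m = size C + #|D|).

Lemma proper_attaches2 (X : {set T}) : X \proper D -> conn X -> #|att C X| <= 2.
Proof.
move=> XD cX; rewrite leqNgt; apply/negP => a3; case: CD => cC sC _ dis _.
have /minimal : attaches3 C X.
  by split=> // c /dis; apply: contra => /(subsetP (proper_sub XD)).
by rewrite mE leq_add2l leqNgt (proper_card XD).
Qed.

Variables (p0 q0 c : T) (s t : seq T).
Let P := p0 :: s.
Let Q := q0 :: t.
Hypotheses (pP : ipath P) (pQ : ipath Q) (QP : {in Q & P, forall q p, q != p}).
Hypothesis (DE : D =i Q ++ P).
Hypothesis Qinner : {in Q & P, forall q p, q != last q0 t -> e q p = false}.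
Hypotheses (cC : c \in C) (q0c : e q0 c).
Hypothesis Qlink : exists2 p, p \in P & e (last q0 t) p.

Definition path_ends (a b : T) (P0 : T) (P1 : T) :=
  {in P & C, forall p w, e p w = (p == P0) && (w == a) || (p == P1) && (w == b)}.

Definition feet_outside a b :=
  [/\ c != a, c != b &
      {in Q & C, forall q w, q != q0 -> e q w -> (w == a) || (w == b)}].

Lemma size_ear : #|D| = size Q + size P.
Proof.
have -> : #|D| = #|Q ++ P| by apply: eq_card => x; rewrite DE.
rewrite -size_cat; apply/card_uniqP; rewrite cat_uniq (ipath_uniq pQ) (ipath_uniq pP) andbT andTb.
by apply/hasPn => p pp; apply/negP => pq; have := QP pq pp; rewrite eqxx.
Qed.

Lemma earD x : (x \in D) = (x \in Q) || (x \in P).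
Proof. by rewrite DE mem_cat. Qed.

Lemma ear_dis x : x \in D -> x \notin C.
Proof. by case: CD => _ _ _ dis _; apply: contraL => /dis. Qed.

Lemma conn_Q : conn [set x in Q]. Proof. exact: conn_ipath. Qed.

Lemma setQ_proper : [set x in Q] \proper D.
Proof.
apply/properP; split; first by apply/subsetP => x; rewrite inE earD => ->.
exists p0; first by rewrite earD mem_head orbT.
by rewrite inE; apply/negP => h; have := QP h (mem_head p0 s); rewrite eqxx.
Qed.

(** If Q has a as a foot too, then the only neighbour of Q in P is the end of P next
    to a, as the rest of P, joined to Q, would have three feet already. Thus Q and P
    form one induced path, from a neighbour of c to a neighbour of b, that sees a at
    least twice. *)
Lemma ear_sees_foot a b : a \in C -> b \in C -> a != b ->
  path_ends a b p0 (last p0 s) -> feet_outside a b ->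
  (exists2 q, q \in Q & e q a) -> False.
Proof.
move=> aC bC ab pe [ca cb fo] [q qQ qa].
have [_ sC _ _ _] := CD; have icC : icycle C by case: CD.
have attQ w : w \in C -> {in Q, forall q, e q w -> w = a \/ w = c}.
  move=> wC q' q'Q q'w; have := proper_attaches2 setQ_proper conn_Q.
  have aA : a \in att C [set x in Q] by apply/attP; split=> //; exists q; rewrite ?inE.
  have cA : c \in att C [set x in Q] by apply/attP; split=> //; exists q0; rewrite ?inE ?eqxx.
  have wA : w \in att C [set x in Q] by apply/attP; split=> //; exists q'; rewrite ?inE.
  move=> le2; have [->|wa] := eqVneq w a; first by left.
  have [->|wc] := eqVneq w c; first by right.
  have : 3 <= #|att C [set x in Q]| by apply: (@card3 _ w a c); rewrite // eq_sym.
  by rewrite ltnNge le2.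
have Qb q' : q' \in Q -> e q' b = false.
  by move=> q'Q; apply/negP => /(attQ b bC q' q'Q)[/esym/eqP|/esym/eqP]; rewrite ?(negPf ab) ?(negPf cb).
have p0a : e p0 a by rewrite pe ?mem_head // !eqxx.
have lpb : e (last p0 s) b by rewrite pe ?mem_last // !eqxx orbT.
have only_p0 p : p \in P -> e (last q0 t) p -> p = p0.
  move=> pP' elp; apply/eqP; apply: contraT => pp0.
  have ps : p \in s by move: pP'; rewrite inE (negPf pp0).
  have ps' : ipath s by case/and3P: pP.
  have p0s : p0 \notin s by case/and3P: pP.
  have sN : last p0 s \in s by case: (s) ps => //= x r _; rewrite mem_last.
  pose X := [set x in Q] :|: [set x in s].
  have cX : conn X.
    apply: (connU es conn_Q (conn_ipath es ps') (x := last q0 t) (y := p)).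
    - by rewrite inE mem_last.
    - by rewrite inE.
    - by rewrite elp orbT.
  have XD : X \proper D.
    apply/properP; split.
      by apply/subsetP => x; rewrite !(inE, earD) => /orP[->|->]; rewrite ?orbT.
    exists p0; first by rewrite earD mem_head orbT.
    rewrite 2!inE [_ \in [set x in s]]inE (negPf p0s) orbF.
    by apply/negP => h; have := QP h (mem_head p0 s); rewrite eqxx.
  have := proper_attaches2 XD cX; rewrite leqNgt.
  rewrite (@card3 _ a b c) //; last by rewrite eq_sym.
  - by apply/attP; split=> //; exists q; rewrite // 2!inE qQ.
  - by apply/attP; split=> //; exists (last p0 s); rewrite // inE [_ \in [set x in s]]inE sN orbT.
  - by apply/attP; split=> //; exists q0; rewrite // 2!inE mem_head.
  - by rewrite eq_sym.
have [p1 p1P elp1] := Qlink; have p1E := only_p0 p1 p1P elp1; subst p1.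
have lk : linked Q P (last q0 t) p0.
  move=> x y xQ yP; rewrite QP //=; have [->|xl] := eqVneq x (last q0 t); last by rewrite Qinner.
  have [->|yp] := eqVneq y p0; first by rewrite elp1.
  by apply/eqP; apply/negP => exy; case/eqP: yp; apply: only_p0.
have pR : ipath (q0 :: t ++ p0 :: s) by apply/ipath_cat.
pose R := q0 :: t ++ p0 :: s.
have memR r : (r \in R) = (r \in Q) || (r \in P) by rewrite /R -cat_cons mem_cat.
have lR : last q0 (t ++ p0 :: s) = last p0 s by rewrite last_cat.
have RE : {in R & C, forall r w, w != a ->
     e r w = (r == last p0 s) && (w == b) || (r == q0) && (w == c)}.
  move=> r w; rewrite memR => /orP[rQ|rP] wC wa.
    have /negPf -> : r != last p0 s by apply: QP => //; exact: mem_last.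
    rewrite /=; have [->|wc] := eqVneq w c; last first.
      rewrite andbF; apply/negP => /(attQ w wC r rQ)[wE|wE].
        by rewrite wE eqxx in wa.
      by rewrite wE eqxx in wc.
    rewrite andbT; have [->//|rq] := eqVneq r q0.
    by apply/negP => rc; have := fo r c rQ cC rq rc; rewrite (negPf ca) (negPf cb).
  rewrite pe // (negPf wa) andbF /=.
  have /negPf -> : r != q0 by rewrite eq_sym; apply: QP => //; exact: mem_head.
  by rewrite orbF.
have two : 1 < #|[set r in R | e r a]|.
  apply/card_gt1P; exists q, p0; rewrite !inE -!in_cons !memR qQ qa p0a mem_head orbT.
  by split=> //; apply: QP => //; exact: mem_head.
have disR : {in R & C, forall r w, r != w}.
  move=> r w rR wC; apply: contraTneq wC => <-; apply: ear_dis.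
  by rewrite earD -memR.
have [||C' [S1 [S2 [S3 [cC' memC szC [C'E|C'E]]]]]] := cycle_at_three icC aC bC cC ab.
- by rewrite eq_sym.
- by rewrite eq_sym.
- apply: (theta_absurd C'E cC' pR _ _ _ two).
  + by rewrite mE size_ear szC -[in RHS]cat_cons size_cat.
  + by move=> r w rR; rewrite memC; apply: disR.
  + by move=> r w rR; rewrite memC lR; apply: RE.
have [t' [t'E t'l]] := rev_cons_last q0 (t ++ p0 :: s); rewrite lR -/R in t'E t'l.
have pR' : ipath (last p0 s :: t') by rewrite -t'E; apply: ipath_rev.
have memR' r : (r \in last p0 s :: t') = (r \in R) by rewrite -t'E mem_rev.
apply: (theta_absurd C'E cC' pR').
- by rewrite mE size_ear szC -t'E size_rev /R -[in RHS]cat_cons size_cat.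
- by move=> r w; rewrite memR' memC; apply: disR.
- by move=> r w; rewrite memR' memC t'l => rR wC wa; rewrite RE // orbC.
- by apply: leq_trans two _; apply: subset_leq_card; apply/subsetP => r; rewrite !inE -!in_cons memR'.
Qed.

(** If Q has neither a nor b as a foot, its last vertex has one neighbour on P, and
    then D is a tree, or two consecutive ones, and then D is a triangle with three
    legs; with more of them a smaller set would have three feet. *)
Lemma ear_blind a b : a \in C -> b \in C -> a != b ->
  path_ends a b p0 (last p0 s) -> feet_outside a b ->
  {in Q, forall q, e q a = false /\ e q b = false} -> False.
Proof.
move=> aC bC ab pe [ca cb fo] blind.
have [_ sC _ _ a3] := CD; have icC : icycle C by case: CD.
have disC x : x \in D -> {in C, forall w, x != w}.
  by move=> xD w wC; apply: contraTneq wC => <-; apply: ear_dis.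
have disQ q : q \in Q -> {in C, forall w, q != w}.
  by move=> qQ; apply: disC; rewrite earD qQ.
have disP p : p \in P -> {in C, forall w, p != w}.
  by move=> qP; apply: disC; rewrite earD qP orbT.
have attQ q w : q \in Q -> w \in C -> e q w -> [/\ q = q0, w != a & w != b].
  move=> qQ wC qw; have [qa qb] := blind q qQ.
  have wa : w != a by apply: contraTneq qw => ->; rewrite qa.
  have wb : w != b by apply: contraTneq qw => ->; rewrite qb.
  split=> //; apply/eqP; apply: contraT => qq0.
  by have := fo q w qQ wC qq0 qw; rewrite (negPf wa) (negPf wb).
have p0a : e p0 a by rewrite pe ?mem_head // !eqxx.
have lpb : e (last p0 s) b by rewrite pe ?mem_last // !eqxx orbT.
have [hp hpP hpE] := Qlink.
have : has (e (last q0 t)) P by apply/hasP; exists hp.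
case/split_first_sat => P1 [p [T1 [PE lqp nP1]]].
have uP := ipath_uniq pP.
have pP' : p \in P by rewrite PE mem_cat mem_head orbT.
have QE : Q = rcons (belast q0 t) (last q0 t) by rewrite /Q lastI.
have [hT|nT] := boolP (has (e (last q0 t)) T1); last first.
  have lk : linked Q P (last q0 t) p.
    move=> x y xQ yP; rewrite QP //=; have [->|xl] := eqVneq x (last q0 t); last by rewrite Qinner.
    have [->|yp] := eqVneq y p; first by rewrite lqp.
    apply/eqP/negP => exy; move: yP; rewrite PE mem_cat inE (negPf yp) /= => /orP[yP|yT].
      by case/hasP: nP1; exists y.
    by case/hasP: nT; exists y.
  apply: (no_config (C := C) (D := Q ++ P)); split; split=> //.
  - rewrite cat_uniq (ipath_uniq pQ) uP andbT andTb.
    by apply/hasPn => x xP; apply/negP => xQ; have := QP xQ xP; rewrite eqxx.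
  - have pQ' := pQ; rewrite QE in lk pQ' *.
    exact: (itree_cat pQ' (ipath_itree pP) pP' lk).
  - by move=> w wC; apply/negP => wQP; have := disC w; rewrite DE wQP => /(_ isT w wC); rewrite eqxx.
  - move=> w wC d d'; rewrite !mem_cat => /orP[dQ|dP] /orP[dQ'|dP'] dw dw'.
    + by have [-> _ _] := attQ d w dQ wC dw; have [-> _ _] := attQ d' w dQ' wC dw'.
    + have [_ wa wb] := attQ d w dQ wC dw; move: dw'.
      by rewrite pe // (negPf wa) (negPf wb) !andbF.
    + have [_ wa wb] := attQ d' w dQ' wC dw'; move: dw.
      by rewrite pe // (negPf wa) (negPf wb) !andbF.
    + move: dw dw'; rewrite !pe //.
      case/orP=> /andP[/eqP-> /eqP wE] /orP[]/andP[/eqP-> /eqP wE'] //.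
        by move: ab; rewrite -wE -wE' eqxx.
      by move: ab; rewrite -wE -wE' eqxx.
  - by have -> : [set x in Q ++ P] = D by apply/setP => x; rewrite inE DE.
  move=> d; rewrite mem_cat => /orP[dQ|dP].
    have plq : forall y, y \in Q -> y != p by move=> y yQ; apply: QP.
    have q0case : exists y z, [/\ y != z, y \in C ++ Q ++ P, z \in C ++ Q ++ P, e q0 y & e q0 z].
      exists c; have [ql|[y [yQ _ qy _]]] := ipath_next pQ (mem_head _ _).
        exists p; rewrite !mem_cat cC pP' !orbT; split=> //.
          by rewrite eq_sym; apply: disP.
        by rewrite ql.
      exists y; rewrite !mem_cat cC yQ !orbT; split=> //.
      by rewrite eq_sym; apply: disQ.
    have [dE|dE|[y [z [yz yQ zQ dy dz]]]] := ipath_two_nbrs pQ dQ.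
    + by rewrite dE.
    + have [dE'|[y [yQ _ dy _]]] := ipath_prev pQ dQ; first by rewrite dE'.
      exists y, p; rewrite !mem_cat yQ pP' !orbT; split=> //; first exact: plq.
      by rewrite dE.
    + by exists y, z; rewrite !mem_cat yQ zQ !orbT; split.
  have p0case : exists y z, [/\ y != z, y \in C ++ Q ++ P, z \in C ++ Q ++ P, e p0 y & e p0 z].
    exists a; have [pl|[y [yP _ py _]]] := ipath_next pP (mem_head _ _).
      by exists b; rewrite !mem_cat aC bC; split=> //; rewrite {1}pl.
    exists y; rewrite !mem_cat aC yP !orbT; split=> //.
    by rewrite eq_sym; apply: disP.
  have [dE|dE|[y [z [yz yP zP dy dz]]]] := ipath_two_nbrs pP dP.
  + by rewrite dE.
  + have [dE'|[y [yP _ dy _]]] := ipath_prev pP dP; first by rewrite dE'.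
    exists y, b; rewrite !mem_cat yP bC !orbT; split=> //; first exact: disP.
    by rewrite dE.
  + by exists y, z; rewrite !mem_cat yP zP !orbT; split.
case: T1 PE hT => // p1 T2 PE hT.
have PE' : P = (P1 ++ [:: p]) ++ p1 :: T2 by rewrite -catA.
have p0La : p0 \in P1 ++ [:: p].
  by move: PE; rewrite /P; case: (P1) => [|x r] [-> _]; rewrite mem_head.
have lastT2 : last p0 s = last p1 T2.
  have -> : last p0 s = last p0 P by [].
  by rewrite PE' last_cat.
have dLaLb x : x \in P1 ++ [:: p] -> x \notin p1 :: T2.
  move: uP; rewrite PE' cat_uniq => /and3P[_ /hasPn h _] xl.
  by apply/negP => /h; rewrite xl.
have LaP x : x \in P1 ++ [:: p] -> x \in P by move=> h; rewrite PE' mem_cat h.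
have LbP x : x \in p1 :: T2 -> x \in P by move=> h; rewrite PE' mem_cat h orbT.
have pLa : ipath (P1 ++ [:: p]) by apply: (@ipath_prefix _ _ _ (p1 :: T2)); rewrite -PE'.
have pLb : ipath (p1 :: T2) by apply: (@ipath_suffix _ _ (P1 ++ [:: p])); rewrite -PE'.
have cD : c \in att C [set x in Q] by apply/attP; split=> //; exists q0; rewrite // inE mem_head.
have three (X : {set T}) w1 w2 w3 : X \proper D -> conn X ->
    w1 \in att C X -> w2 \in att C X -> w3 \in att C X ->
    w1 != w2 -> w1 != w3 -> w2 != w3 -> False.
  move=> XD cX h1 h2 h3 n1 n2 n3; have := proper_attaches2 XD cX.
  by rewrite leqNgt (card3 h1 h2 h3).
have attX (X : {set T}) x w : x \in X -> w \in C -> e x w -> w \in att C X.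
  by move=> xX wC xw; apply/attP; split=> //; exists x.
have XQ (X : {set T}) x : x \in P -> x \notin X -> X \subset D -> X \proper D.
  by move=> xP xX XD; apply/properP; split=> //; exists x; rewrite // earD xP orbT.
have QsubD : [set x in Q] \subset D by apply: proper_sub; exact: setQ_proper.
have notQ x : x \in P -> x \notin Q.
  by move=> xP; apply/negP => xQ; have := QP xQ xP; rewrite eqxx.
have [hT2|nT2] := boolP (has (e (last q0 t)) T2).
  case/hasP: hT2 => p' p'T lqp'.
  have pT2 : ipath T2 by apply: (@ipath_suffix _ _ [:: p1]).
  have cX1 : conn ([set x in Q] :|: [set x in P1 ++ [:: p]]).
    apply: (connU es conn_Q (conn_ipath es pLa) (x := last q0 t) (y := p)).
    - by rewrite inE mem_last.
    - by rewrite inE mem_cat mem_head orbT.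
    - by rewrite lqp orbT.
  have cX := connU es cX1 (conn_ipath es pT2) (x := last q0 t) (y := p').
  apply: (three _ a b c _ (cX _ _ _)).
  - apply: (@XQ _ p1); first by apply: LbP; exact: mem_head.
      rewrite !in_setU !in_set; apply/norP; split; last by have := ipath_uniq pLb; case/andP.
      apply/norP; split; first by apply: notQ; apply: LbP; exact: mem_head.
      by apply/negP => /dLaLb; rewrite mem_head.
    apply/subsetP => x; rewrite !in_setU !in_set earD.
    case/orP=> [/orP[->//|/LaP ->]|xT]; rewrite ?orbT // LbP ?orbT //.
    by rewrite inE xT orbT.
  - by rewrite in_setU inE mem_last.
  - by rewrite inE.
  - by rewrite lqp' orbT.
  - by apply: (attX _ p0) => //; rewrite !in_setU !in_set p0La orbT.
  - apply: (attX _ (last p0 s)) => //; rewrite !in_setU !in_set lastT2.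
    by case: (T2) p'T => // x r _; rewrite /= mem_last orbT.
  - by apply: (attX _ q0) => //; rewrite !in_setU !in_set mem_head.
  - by [].
  - by rewrite eq_sym.
  - by rewrite eq_sym.
have lqp1 : e (last q0 t) p1 by move: hT; rewrite /= (negPf nT2) orbF.
have onlyc w : w \in C -> e q0 w -> w = c.
  move=> wC qw; apply/eqP; apply: contraT => wc.
  have [_ wa wb] := attQ q0 w (mem_head _ _) wC qw.
  have cX := connU es conn_Q (conn_ipath es pLb) (x := last q0 t) (y := p1).
  case: (three _ w b c _ (cX _ _ _)) => //.
  - apply: (@XQ _ p0); first exact: mem_head.
      rewrite in_setU !in_set; apply/norP; split; last exact: dLaLb.
      by apply: notQ; exact: mem_head.
    apply/subsetP => x; rewrite !in_setU !in_set earD.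
    by case/orP=> [->//|/LbP ->]; rewrite orbT.
  - by rewrite inE mem_last.
  - by rewrite inE mem_head.
  - by rewrite lqp1 orbT.
  - by apply: (attX _ q0) => //; rewrite !in_setU !in_set mem_head.
  - by apply: (attX _ (last p0 s)) => //; rewrite in_setU !in_set lastT2 mem_last orbT.
  - by apply: (attX _ q0) => //; rewrite !in_setU !in_set mem_head.
  - by rewrite eq_sym.
have LaE : exists ta, P1 ++ [:: p] = p0 :: ta /\ last p0 ta = p.
  move: PE; rewrite /P; case: (P1) => [|x r] [-> _]; first by exists [::].
  by exists (r ++ [:: p]); rewrite last_cat.
have [ta [taE tal]] := LaE.
have [tb [tbE tbl]] := rev_cons_last p1 T2; rewrite -lastT2 in tbE tbl.
have mLb x : (x \in last p0 s :: tb) = (x \in p1 :: T2) by rewrite -tbE mem_rev.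
have mLa x : (x \in p0 :: ta) = (x \in P1 ++ [:: p]) by rewrite -taE.
have pLa' : ipath (p0 :: ta) by rewrite -taE.
have pLb' : ipath (last p0 s :: tb) by rewrite -tbE; apply: ipath_rev.
have lab : linked (p0 :: ta) (last p0 s :: tb) p p1.
  have : ipath (p0 :: ta ++ p1 :: T2) by rewrite -cat_cons -taE -PE'.
  case/ipath_cat=> _ _; rewrite tal.
  by apply: linked_mem => x; rewrite ?mLb.
have lac : linked (p0 :: ta) Q p (last q0 t).
  move=> x y; rewrite mLa => xL yQ; have xP := LaP x xL.
  rewrite eq_sym QP //= es; have [->|yl] := eqVneq y (last q0 t); last by rewrite Qinner // andbF.
  rewrite andbT; move: xL; rewrite mem_cat inE; have [-> _|xp] := eqVneq x p; first by rewrite lqp.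
  rewrite orbF => xP1; apply/eqP/negP => h; case/hasP: nP1.
  by exists x.
have lbc : linked (last p0 s :: tb) Q p1 (last q0 t).
  move=> x y; rewrite mLb => xL yQ; have xP := LbP x xL.
  rewrite eq_sym QP //= es; have [->|yl] := eqVneq y (last q0 t); last by rewrite Qinner // andbF.
  rewrite andbT; move: xL; rewrite inE; have [-> _|xp] := eqVneq x p1; first by rewrite lqp1.
  move=> /= xP1; apply/eqP/negP => h; case/hasP: nT2.
  by exists x.
have lA : linked (p0 :: ta) C p0 a.
  move=> x w; rewrite mLa => xL wC; rewrite (disP x (LaP x xL) w wC) /= pe ?LaP //.
  have /negPf -> : x != last p0 s.
    by apply/negP => /eqP xl; move: (dLaLb x xL); rewrite xl lastT2 mem_last.
  by rewrite orbF.
have lB : linked (last p0 s :: tb) C (last p0 s) b.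
  move=> x w; rewrite mLb => xL wC; rewrite (disP x (LbP x xL) w wC) /= pe ?LbP //.
  have /negPf -> : x != p0.
    by apply: contraTneq xL => ->; apply: dLaLb.
  by [].
have lC : linked Q C q0 c.
  move=> x w xQ wC; rewrite (disQ x xQ w wC) /=; apply/eqP.
  apply/idP/andP => [xw|[/eqP-> /eqP->] //]; have [xE _ _] := attQ x w xQ wC xw.
  by subst x; split=> //; apply/eqP; apply: onlyc.
have szP : size P = size (p0 :: ta) + size (last p0 s :: tb).
  by rewrite -taE -tbE size_rev -size_cat -PE'.
rewrite -{1}tal -tbl in lab; rewrite -tal in lac; rewrite -tbl in lbc.
have [||C' [S1 [S2 [S3 [cC' memC szC C'E]]]]] := cycle_at_three icC aC bC cC ab.
- by rewrite eq_sym.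
- by rewrite eq_sym.
have sC' : 4 <= size C' by rewrite szC.
have lC' z w l : linked l C z w -> linked l C' z w.
  by apply: linked_mem => y; rewrite ?memC.
case: C'E => C'E.
- apply: (tripod_absurd C'E cC' sC' pLa' pLb' pQ _ lab lac lbc (lC' _ _ _ lA) (lC' _ _ _ lB)
    (lC' _ _ _ lC)).
  by rewrite mE size_ear szC szP; congr (_ + _); rewrite addnC.
- apply: (tripod_absurd C'E cC' sC' pLa' pQ pLb' _ lac lab (linkedC es lbc) (lC' _ _ _ lA)
    (lC' _ _ _ lC) (lC' _ _ _ lB)).
  by rewrite mE size_ear szC szP; congr (_ + _); rewrite addnCA addnA.
Qed.

End Ear.

Lemma minimal_absurd C D : attaches3 C D -> m = size C + #|D| -> False.
Proof.
move=> CD mE; have [icC sC cD dis a3] := CD.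
(* the base path P: being a shortest one with two feet, it sees them at its ends
   only *)
pose two (s : seq T) := [&& ipath s, all (mem D) s & 1 < #|att C [set x in s]|].
have [[|p0 s] [/and3P[pP /allP PD a2] Pmin]] : exists s, two s /\
    forall s', two s' -> size s <= size s'.
- apply: shortest_seq; have : 1 < #|att C D| by apply: ltnW.
  case/card_gt1P=> a [b [/attP[aC [x xD xa]] /attP[bC [y yD yb]] ab]].
  have [q pq [lq qD]] := conn_has_ipath cD xD yD.
  exists (x :: q); apply/and3P; split=> //; first by apply/allP.
  apply/card_gt1P; exists a, b; split=> //.
    by apply/attP; split=> //; exists x; rewrite // inE mem_head.
  by apply/attP; split=> //; exists y; rewrite // inE -lq mem_last.
- move: a2; rewrite (_ : att C _ = set0) ?cards0 //; apply/setP => c.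
  by rewrite in_set0; apply/negP => /attP[_ [d]]; rewrite !inE.
have P1 (r : seq T) : ipath r -> {subset r <= p0 :: s} -> size r < size (p0 :: s) ->
    #|att C [set x in r]| <= 1.
  move=> pr rs szr; rewrite leqNgt; apply/negP => r2; have := Pmin r.
  rewrite /two pr r2 andbT leqNgt szr; move/(_ _)/negP; apply=> //.
  by rewrite andTb; apply/allP => x /rs /PD.
have {}PD x : x \in p0 :: s -> x \in D by apply: PD.
have uP := ipath_uniq pP.
have belE : p0 :: s = belast p0 s ++ [:: last p0 s] by rewrite cats1 -lastI.
have att1 (X : {set T}) w : (exists2 x, x \in X & e x w) -> w \in C -> w \in att C X.
  by move=> [x xX xw] wC; apply/attP; split=> //; exists x.
have PU : s <> [::] -> att C [set x in p0 :: s] \subset att C [set x in belast p0 s] :|: att C [set x in s].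
  move=> sN; apply/subsetP => w /attP[wC [x]]; rewrite in_set inE => /predU1P[->|xs] xw; rewrite in_setU.
    rewrite att1 //; exists p0 => //; rewrite inE.
    by case: (s) sN => // z r _; rewrite /= mem_head.
  by rewrite orbC att1 //; exists x; rewrite ?inE.
have short : s <> [::] -> #|att C [set x in belast p0 s]| <= 1 /\ #|att C [set x in s]| <= 1.
  move=> sN; split; apply: P1.
  - by apply: (@ipath_prefix _ _ _ [:: last p0 s]); rewrite -belE.
  - by move=> x xb; rewrite belE mem_cat xb.
  - by rewrite size_belast.
  - by case/and3P: pP.
  - by move=> x xs; rewrite inE xs orbT.
  - by [].
have [PDe|PnD] := eqVneq [set x in p0 :: s] D.
  have [sE|/eqP sN] := eqVneq s [::].
    apply: (hub_absurd icC sC (h := p0)).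
      by apply/negP => /dis; rewrite PD // mem_head.
    by rewrite (_ : [set p0] = D) // -PDe sE; apply/setP => x; rewrite !inE.
  have [h1 h2] := short sN; move: a3; rewrite -PDe ltnNge.
  apply/negP; rewrite negbK; apply: leq_trans (subset_leq_card (PU sN)) _.
  by rewrite cardsU; apply: leq_trans (leq_subr _ _) _; rewrite -(addn1 1) leq_add.
have PpD : [set x in p0 :: s] \proper D.
  by rewrite properEneq PnD; apply/subsetP => x; rewrite inE => /PD.
have cP : conn [set x in p0 :: s] by exact: conn_ipath.
have P2 := proper_attaches2 CD mE PpD cP.
have [a [b [aC bC ab pe]]] : exists a b, [/\ a \in C, b \in C, a != b &
    path_ends C p0 s a b p0 (last p0 s)].
  have [sE|/eqP sN] := eqVneq s [::].
    case/card_gt1P: (a2) => a [b [aA bA ab]]; exists a, b.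
    have [aC [x xP xa]] := attP _ _ _ aA; have [bC [y yP yb]] := attP _ _ _ bA.
    rewrite sE; split=> //= p w; rewrite inE => /eqP -> wC; rewrite eqxx /=.
    move: xP yP xa yb; rewrite sE !inE => /eqP -> /eqP -> pa pb.
    apply/idP/orP => [pw|[/eqP->//|/eqP->//]].
    have [wa|wa] := eqVneq w a; first by left.
    have [wb|wb] := eqVneq w b; first by right.
    have wA : w \in att C [set x in p0 :: s] by apply: att1 => //; exists p0; rewrite // inE mem_head.
    by move: P2; rewrite leqNgt (card3 wA aA bA).
  have {}PU := PU sN; have [h1 h2] := short sN; set A1 := att C [set x in belast p0 s] in h1 PU.
  set A2 := att C [set x in s] in h2 PU.
  have := leq_trans a2 (subset_leq_card PU); rewrite cardsU => /leq_trans/(_ (leq_subr _ _)).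
  move=> h3; have e1 : #|A1| == 1.
    by rewrite eqn_leq h1 -(leq_add2r #|A2|); apply: leq_trans h3; rewrite add1n ltnS.
  have e2 : #|A2| == 1.
    by rewrite eqn_leq h2 -(leq_add2l #|A1|); apply: leq_trans h3; rewrite addn1 ltnS.
  have /cards1P[a A1E] := e1; have /cards1P[b A2E] := e2.
  have ab : a != b.
    apply/eqP => ab; have := leq_trans a2 (subset_leq_card PU).
    by rewrite A1E A2E ab setUid cards1.
  have inA1 p w : p \in belast p0 s -> w \in C -> e p w -> w = a.
    by move=> pb wC pw; apply/set1P; rewrite -A1E; apply: att1 => //; exists p; rewrite ?inE.
  have inA2 p w : p \in s -> w \in C -> e p w -> w = b.
    by move=> pb wC pw; apply/set1P; rewrite -A2E; apply: att1 => //; exists p; rewrite ?inE.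
  have aA1 : a \in A1 by rewrite A1E set11.
  have bA2 : b \in A2 by rewrite A2E set11.
  have [aC [x xb xa]] := attP _ _ _ aA1; have [bC [y ys yb]] := attP _ _ _ bA2.
  rewrite inE in xb; rewrite inE in ys.
  have p0b : p0 \in belast p0 s by case: (s) sN => // z r _; rewrite /= mem_head.
  have ls : last p0 s \in s by case: (s) sN => //= z r _; exact: mem_last.
  have belP p : p \in p0 :: s -> p = last p0 s \/ p \in belast p0 s.
    by rewrite belE mem_cat inE => /orP[->|/eqP]; [right|left].
  have bP p : p \in belast p0 s -> p \in p0 :: s by move=> pb; rewrite belE mem_cat pb.
  exists a, b; split=> // p w pP' wC; apply/idP/orP.
    move=> pw; move: (pP'); rewrite inE => /predU1P[pE|ps].
      by left; rewrite pE eqxx; apply/eqP; apply: inA1 pw => //; rewrite pE.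
    have wb := inA2 p w ps wC pw; have [pl|pb] := belP p pP'.
      by right; rewrite pl wb !eqxx.
    by case/eqP: ab; rewrite -(inA1 p w pb wC pw).
  case=> /andP[/eqP-> /eqP->].
    move: (bP x xb); rewrite inE => /predU1P[<-//|xs].
    by case/eqP: ab; apply: inA2 xs aC xa.
  have yP : y \in p0 :: s by rewrite inE ys orbT.
  have [<-//|yb'] := belP y yP.
  by case/eqP: ab; apply/esym; apply: inA1 yb' bC yb.
(* the path Q: a shortest one outside P from a third foot to a neighbour of P *)
pose ear (r : seq T) := [&& ipath r, all [pred x | (x \in D) && (x \notin p0 :: s)] r,
   [exists c, [&& c \in C, c != a, c != b & has (fun q => (q == head p0 r) && e q c) r]] &
   has (e (last p0 r)) (p0 :: s)].
have [[|q0 t] [/and4P[pQ /allP QD fQ lQ] Qmin]] : exists s, ear s /\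
    forall s', ear s' -> size s <= size s'.
- apply: shortest_seq.
  have [c cA] : exists c, c \in att C D :\: [set a; b].
    apply/set0Pn; apply: contraTneq a3 => h; rewrite -leqNgt.
    have := subset_leq_card (_ : att C D \subset [set a; b]); rewrite cards2 ab; apply.
    by rewrite -setD_eq0 h.
  move: cA; rewrite in_setD in_set2 negb_or => /andP[/andP[ca cb] /attP[cC [z zD zc]]].
  have zP : z \notin p0 :: s.
    by apply/negP => zP; move: zc; rewrite pe // (negPf ca) (negPf cb) !andbF.
  have p0D : p0 \in D by apply: PD; exact: mem_head.
  have [r pr [lr rD]] := conn_has_ipath cD zD p0D.
  have : has (mem (p0 :: s)) (z :: r).
    by apply/hasP; exists p0; rewrite /= ?mem_head // -lr mem_last.
  case/split_first_sat => [[|z' r1] [y [r2 [rE yP nr1]]]].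
    by case: rE => zy _; rewrite -zy /= in yP; rewrite yP in zP.
  case: (rE) => zz _; subst z'; exists (z :: r1); apply/and4P; split.
  - by apply: (@ipath_prefix _ _ _ (y :: r2)); rewrite -rE.
  - apply/allP => x xr; rewrite /= rD ?rE ?mem_cat ?xr //=.
    by apply: contra nr1 => xP; apply/hasP; exists x.
  - by apply/existsP; exists c; rewrite cC ca cb /= eqxx zc.
  - apply/hasP; exists y => //; rewrite rE in pr; case/ipath_cat: pr => _ _ l.
    by have /andP[_ /eqP ->] := l _ _ (mem_last z r1) (mem_head _ _); rewrite !eqxx.
- by move: fQ => /existsP[c /and4P[_ _ _]].
move: fQ => /existsP[c /and4P[cC ca cb /hasP[q' _ /andP[/eqP -> q0c]]]].
have QP : {in q0 :: t & p0 :: s, forall q p, q != p}.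
  move=> q p qQ pP'; apply: contraTneq pP' => <-.
  by have /andP[] := QD q qQ.
have Qinner : {in q0 :: t & p0 :: s, forall q p, q != last q0 t -> e q p = false}.
  move=> q p qQ pP' ql; apply/negP => qp; have [Q1 [Q2 QE]] := split_mem qQ.
  have earQ : ear (rcons Q1 q).
    apply/and4P; split.
    - by apply: (@ipath_prefix _ _ _ Q2); rewrite cat_rcons -QE.
    - by apply/allP => x xr; apply: QD; rewrite QE -cat_rcons mem_cat xr.
    - have [r rE] : exists r, rcons Q1 q = q0 :: r.
        by move: QE; case: (Q1) => [|x r] [-> _]; [exists [::]|exists (rcons r q)].
      apply/existsP; exists c; rewrite cC ca cb /=; apply/hasP; exists q0; rewrite rE.
        exact: mem_head.
      by rewrite /= eqxx.
    - by apply/hasP; exists p; rewrite // last_rcons.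
  have := Qmin _ earQ; rewrite QE -cat_rcons size_cat -{2}(addn0 (size (rcons _ _))) leq_add2l.
  case: (Q2) QE => // QE _; move: ql; rewrite -[last q0 t]/(last q0 (q0 :: t)) QE.
  by rewrite last_cat eqxx.
have fo : feet_outside C q0 c t a b.
  split=> // q w qQ wC qq0 qw; apply: contraT; rewrite negb_or => /andP[wa wb].
  have [Q1 [Q2 QE]] := split_mem qQ.
  have earQ : ear (q :: Q2).
    apply/and4P; split.
    - by apply: (@ipath_suffix _ _ Q1); rewrite -QE.
    - by apply/allP => x xr; apply: QD; rewrite QE mem_cat xr orbT.
    - by apply/existsP; exists w; rewrite wC wa wb /= eqxx qw.
    - have -> : last p0 (q :: Q2) = last q0 t; last by [].
      by rewrite -[last q0 t]/(last q0 (q0 :: t)) QE last_cat.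
  have := Qmin _ earQ; rewrite QE size_cat -{2}(add0n (size (q :: _))) leq_add2r.
  by case: (Q1) QE => // -[qE _] _; rewrite qE eqxx in qq0.
have Qlink : exists2 p, p \in p0 :: s & e (last q0 t) p by apply/hasP.
have DE : D =i (q0 :: t) ++ (p0 :: s).
  have [p pP' lp] := Qlink; pose X := [set x in q0 :: t] :|: [set x in p0 :: s].
  have cX : conn X.
    apply: (connU es (conn_ipath es pQ) cP (x := last q0 t) (y := p)); rewrite ?in_set //.
      exact: mem_last.
    by rewrite lp orbT.
  have XD : X \subset D.
    by apply/subsetP => x; rewrite in_setU !in_set => /orP[/QD/andP[]|/PD].
  have inX x : (x \in X) = (x \in (q0 :: t) ++ (p0 :: s)) by rewrite in_setU !in_set mem_cat.
  have [XE|XnD] := eqVneq X D; first by move=> x; rewrite -XE inX.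
  have XpD : X \proper D by rewrite properEneq XnD.
  have := proper_attaches2 CD mE XpD cX; rewrite leqNgt (@card3 _ a b c) //.
  - by apply: att1 => //; exists p0; rewrite ?inX ?mem_cat ?mem_head ?orbT // pe ?mem_head // !eqxx.
  - apply: att1 => //; exists (last p0 s); first by rewrite inX mem_cat mem_last orbT.
    by rewrite pe ?mem_last // !eqxx orbT.
  - by apply: att1 => //; exists q0; rewrite // inX mem_cat mem_head.
  - by rewrite eq_sym.
  - by rewrite eq_sym.
have [/existsP[q /andP[qQ qab]]|blind] :=
    boolP [exists q, (q \in q0 :: t) && (e q a || e q b)]; last first.
  apply: (ear_blind CD mE pP pQ QP DE Qinner cC q0c Qlink aC bC ab pe fo) => q qQ.
  by split; apply: contraNF blind => h; apply/existsP; exists q; rewrite qQ h ?orbT.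
case/orP: qab => qab.
  by apply: (ear_sees_foot CD mE pP pQ QP DE Qinner cC q0c Qlink aC bC ab pe fo); exists q.
have [s' [s'E s'l]] := rev_cons_last p0 s.
have memr x : (x \in last p0 s :: s') = (x \in p0 :: s) by rewrite -s'E mem_rev.
apply: (@ear_sees_foot C D CD mE (last p0 s) q0 c s' t _ pQ _ _ _ cC q0c _ b a) => //.
- by rewrite -s'E; apply: ipath_rev.
- by move=> q1 p; rewrite memr; apply: QP.
- by move=> x; rewrite DE !mem_cat memr.
- by move=> q1 p qQ1; rewrite memr; apply: Qinner.
- by have [p pP' lp] := Qlink; exists p; rewrite ?memr.
- by rewrite eq_sym.
- by move=> p w; rewrite memr s'l orbC; apply: pe.
- by have [h1 h2 h3] := fo; split=> // q1 w q1Q wC n1 /(h3 q1 w q1Q wC n1); rewrite orbC.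
- by exists q.
Qed.

End Minimal.

Theorem no_attaches3 C D : ~ attaches3 C D.
Proof.
have [k] := ubnP (size C + #|D|); elim: k C D => // k IH C D lek CD.
apply: (@minimal_absurd (size C + #|D|) _ C D CD) => // C' D' CD'.
rewrite leqNgt; apply/negP => lt; apply: (IH C' D') => //.
exact: leq_trans lt _.
Qed.

End Violation.

(** * Tree models and vertex splitting *)

Section Model.

(** A minor model of W that exhausts H, whose fibres are trees joined by single edges.
    That a fibre is a connected graph all of whose edges are bridges is expressed by
    cuts, which are easy to push through a contraction. Minimum degree 2 provides the
    edges that both halves of a split vertex must receive. *)
Record tree_model m k (W : sgraph m) (H : sgraph k) (f : 'I_k -> 'I_m) : Prop := TreeModel {
  tm_surj : forall i, exists x, f x = i;
  tm_adj : forall i j, i != j -> adj W i j <-> exists x y, [/\ f x = i, f y = j & adj H x y];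
  tm_uniq : forall x y x' y', f x <> f y -> f x = f x' -> f y = f y' ->
    adj H x y -> adj H x' y' -> x = x' /\ y = y';
  tm_cut : forall x y, f x = f y -> adj H x y -> exists A : {set 'I_k},
    [/\ x \in A, y \notin A & forall u w, f u = f x -> f w = f x -> adj H u w ->
      u \in A -> w \notin A -> u = x /\ w = y];
  tm_conn : forall x y (A : {set 'I_k}), f x = f y -> x \in A -> y \notin A ->
    exists u w, [/\ f u = f x, f w = f x, u \in A, w \notin A & adj H u w];
  tm_deg : forall x, exists y z, [/\ y != z, adj H x y & adj H x z]
}.

(** A triangle on an edge of a fibre would be a cycle in a fibre or a double edge
    between two fibres. *)
Lemma tree_model_no_common m k (W : sgraph m) (H : sgraph k) f v1 v2 x :
  tree_model W H f -> adj H v1 v2 -> f v1 = f v2 -> adj H x v1 -> adj H x v2 -> False.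
Proof.
move=> M a12 f12 x1 x2; have v12 : v1 != v2 by apply: contraTneq a12 => ->; rewrite adj_irr.
have [fx|fx] := eqVneq (f x) (f v1); last first.
  have fx2 : f x <> f v1 by move/eqP: fx.
  by have [_ /eqP] := tm_uniq M fx2 erefl f12 x1 x2; rewrite (negPf v12).
have [A [A1 A2 h]] := tm_cut M f12 a12; have [xA|xA] := boolP (x \in A).
  have [x1E _] := h x v2 fx (esym f12) x2 xA A2.
  by rewrite x1E adj_irr in x1.
have [|_ x2E] := h v1 x erefl fx _ A1 xA; first by rewrite adj_sym.
by rewrite x2E adj_irr in x2.
Qed.

Lemma tree_model_edge m k (W : sgraph m) (H : sgraph k) f : tree_model W H f -> m < k ->
  exists v1 v2, adj H v1 v2 /\ f v1 = f v2.
Proof.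
move=> M mk; have : ~~ injectiveb f.
  by apply/negP => /injectiveP /leq_card; rewrite !card_ord leqNgt mk.
case/injectivePn => x [y yx fxy].
have [|u [w [fu fw _ _ auw]]] := tm_conn M fxy (set11 x); first by rewrite in_set1 eq_sym.
by exists u, w; rewrite fu fw.
Qed.

Lemma surj_endo_inj (T : finType) (h : T -> T) : (forall i, exists x, h x = i) -> injective h.
Proof.
case/fin_all_exists => r hr; have rI : injective r by apply: can_inj hr.
have [r' r'r rr'] := injF_bij rI.
have hE x : h x = r' x by rewrite -{1}(rr' x) hr.
by move=> x y; rewrite !hE => /(can_inj rr').
Qed.

Lemma tree_model_iso m k (W : sgraph m) (H : sgraph k) f : tree_model W H f -> k <= m ->
  exists s : 'I_m -> 'I_k, injective s /\ forall i j, adj H (s i) (s j) = adj W i j.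
Proof.
move=> M km; have [s sE] := fin_all_exists (tm_surj M).
have si : injective s by apply: can_inj sE.
have mk : m <= k by have := leq_card s si; rewrite !card_ord.
have E : m = k by apply/eqP; rewrite eqn_leq mk.
subst k; exists s; split=> // i j.
have fi : injective f by apply: surj_endo_inj (tm_surj M).
have [->|ij] := eqVneq i j; first by rewrite !adj_irr.
apply/idP/idP => [h|/(tm_adj M ij)[x [y [fx fy axy]]]].
  by apply/(tm_adj M ij); exists (s i), (s j); rewrite !sE.
have sf z : s (f z) = z by apply: fi; rewrite sE.
by rewrite -fx -fy !sf.
Qed.

Lemma tree_model_split m (W : sgraph m) (H : sgraph m.+1) f :
  tree_model W H f -> vertex_split W H.
Proof.
move=> M; have [v1 [v2 [a12 f12]]] := tree_model_edge M (leqnn _).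
have v12 : v2 != v1 by apply: contraTneq a12 => ->; rewrite adj_irr.
have [j1 v1E _] := unlift_some v12.
have inj : injective (fun i => f (lift v2 i)).
  apply: surj_endo_inj => i; have [x <-] := tm_surj M i.
  case: (unliftP v2 x) => [j ->|->]; first by exists j.
  by exists j1; rewrite -v1E.
have collide x y : f x = f y -> x = y \/ (x \in [:: v1; v2]) && (y \in [:: v1; v2]).
  case: (unliftP v2 x) => [j ->|->]; case: (unliftP v2 y) => [j' ->|->].
  - by move/inj => ->; left.
  - by rewrite -f12 v1E => /inj ->; right; rewrite !inE !eqxx orbT.
  - by rewrite -f12 v1E => /inj <-; right; rewrite !inE !eqxx orbT.
  - by left.
have rest x y : x \notin [:: v1; v2] -> f y = f x -> y = x.
  by move=> xn /collide[//|/andP[_ h]]; rewrite h in xn.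
have common x := tree_model_no_common (x := x) M a12 f12.
have frest x : x \notin [:: v1; v2] -> f x != f v1.
  by move=> xn; apply/eqP => h; have := rest x v1 xn (esym h) => v1x; rewrite -v1x inE eqxx in xn.
exists v1, v2, f; split=> //.
- split=> [|x y]; first exact: tm_surj M.
  apply/eqP/idP => [/collide[->|->]|]; rewrite ?eqxx ?orbT //.
  case/orP => [/eqP -> //|]; rewrite !inE => /andP[/orP[]/eqP -> /orP[]/eqP ->] //.
- move=> x y xn yn /=; rewrite inE in xn; rewrite inE in yn.
  have [xy|xy] := eqVneq x y; first by rewrite xy !adj_irr.
  have fxy : f x != f y by apply: contraNneq xy => h; rewrite (rest x y xn).
  apply/idP/idP => [axy|/(tm_adj M fxy)[x' [y' [fx fy axy]]]].
    by apply/(tm_adj M fxy); exists x, y.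
  by rewrite -(rest x x' xn fx) -(rest y y' yn fy).
- move=> x xn; rewrite inE in xn; split; last first.
    by apply/negP => /andP[x1 x2]; exact: common x1 x2.
  apply/idP/orP => [/(tm_adj M (frest x xn))[x' [y' [fx fy axy]]]|h].
    rewrite -(rest x x' xn fx).
    have [<-|/andP[]] := collide y' v1 fy; first by left.
    by rewrite !inE => /orP[]/eqP yE _; rewrite yE in axy; [left|right].
  by apply/(tm_adj M (frest x xn)); case: h => h; [exists x, v1|exists x, v2].
have side v v' : v \in [:: v1; v2] -> v' \in [:: v1; v2] -> v != v' ->
    exists2 x, x \in [pred x | x \notin [:: v1; v2]] & adj H x v.
  move=> vv vv' nv; have [y [z [yz vy vz]]] := tm_deg M v.
  have outside w : adj H v w -> w != v' -> exists2 x, x \in [pred x | x \notin [:: v1; v2]] & adj H x v.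
    move=> vw wv'; exists w; last by rewrite adj_sym.
    have wv : w != v by apply: contraTneq vw => ->; rewrite adj_irr.
    move: vv vv' nv; rewrite !inE.
    by case/orP=> /eqP vE /orP[]/eqP vE'; rewrite vE vE' ?eqxx // in wv wv' *;
       rewrite negb_or wv wv'.
  by have [yv|] := eqVneq y v'; [apply: (outside z) => //; rewrite -yv eq_sym|apply: outside].
by split; [apply: (side v1 v2)|apply: (side v2 v1)]; rewrite ?inE ?eqxx ?orbT // eq_sym.
Qed.

(** H1 is H with the edge v1 v2 of a fibre contracted; it is still a model of W, and H
    is a model of H1 with a single nontrivial fibre, that is, a vertex splitting. *)
Lemma contract_edge m k (W : sgraph m) (H : sgraph k.+1) f v1 v2 :
  tree_model W H f -> adj H v1 v2 -> f v1 = f v2 ->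
  exists H1 : sgraph k, exists g f1, tree_model H1 H g /\ tree_model W H1 f1.
Proof.
move=> M a12 f12; have common x := tree_model_no_common (x := x) M a12 f12.
have v12 : v2 != v1 by apply: contraTneq a12 => ->; rewrite adj_irr.
have [j1 v1E _] := unlift_some v12.
pose g x := odflt j1 (unlift v2 x).
have gl j : g (lift v2 j) = j by rewrite /g liftK.
have g2 : g v2 = j1 by rewrite /g unlift_none.
have g1 : g v1 = j1 by rewrite v1E gl.
have lg x : x != v2 -> lift v2 (g x) = x.
  by case: (unliftP v2 x) => [j ->|->]; rewrite ?eqxx // gl.
have gE x y : g x = g y -> [\/ x = y, x = v1 /\ y = v2 | x = v2 /\ y = v1].
  case: (unliftP v2 x) => [j ->|->]; case: (unliftP v2 y) => [j' ->|->]; rewrite ?gl ?g2.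
  - by move=> ->; constructor 1.
  - by move=> ->; constructor 2; rewrite v1E.
  - by move=> <-; constructor 3; rewrite v1E.
  - by constructor 1.
pose r : rel 'I_k := fun i j => (i != j) &&
  [exists x, [exists y, [&& g x == i, g y == j & adj H x y]]].
have rP i j : reflect (i != j /\ exists x y, [/\ g x = i, g y = j & adj H x y]) (r i j).
  apply: (iffP andP) => [[ij /existsP[x /existsP[y /and3P[/eqP gx /eqP gy axy]]]]|].
    by split=> //; exists x, y.
  move=> [ij [x [y [gx gy axy]]]]; split=> //.
  by apply/existsP; exists x; apply/existsP; exists y; rewrite gx gy axy !eqxx.
have rsym : symmetric r.
  by move=> i j; apply/rP/rP => -[ij [x [y [gx gy axy]]]]; (split; first by rewrite eq_sym);
    exists y, x; split=> //; rewrite adj_sym.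
have rirr : irreflexive r by move=> i; rewrite /r eqxx.
pose H1 := SGraph rsym rirr.
pose f1 i := f (lift v2 i).
have f1g x : f1 (g x) = f x.
  have [->|xv] := eqVneq x v2; first by rewrite g2 /f1 -v1E.
  by rewrite /f1 lg.
have nadj x : adj H x x = false by rewrite adj_irr.
have fH1 x y : adj H x y -> g x <> g y -> adj H1 (g x) (g y).
  by move=> axy /eqP gxy; apply/rP; split=> //; exists x, y.
exists H1, g, f1; split; split.
- by move=> i; exists (lift v2 i).
- move=> i j ij; split=> [/rP[_]//|h]; exact/rP.
- move=> x y x' y' gxy gx gy axy ax'y'.
  case: (gE _ _ gx) => [xE|[xE xE']|[xE xE']]; case: (gE _ _ gy) => [yE|[yE yE']|[yE yE']].
  + by [].
  + by rewrite yE in axy; rewrite -xE yE' in ax'y'; case: (common x axy ax'y').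
  + by rewrite yE in axy; rewrite -xE yE' in ax'y'; case: (common x ax'y' axy).
  + by rewrite xE adj_sym in axy; rewrite -yE xE' adj_sym in ax'y'; case: (common y axy ax'y').
  + by rewrite xE yE in gxy.
  + by rewrite xE yE g1 g2 in gxy.
  + by rewrite xE adj_sym in axy; rewrite -yE xE' adj_sym in ax'y'; case: (common y ax'y' axy).
  + by rewrite xE yE g1 g2 in gxy.
  + by rewrite xE yE in gxy.
- move=> x y gxy axy; exists [set x]; rewrite !inE eqxx; split=> //.
    by apply: contraTneq axy => ->; rewrite adj_irr.
  move=> u w gu gw auw; rewrite !inE => /eqP uE; rewrite uE in auw * => wx; split=> //.
  have {}gw : g w = g y by rewrite -gxy.
  case: (gE _ _ gxy) => [xE|[xE xE']|[xE xE']].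
  + by rewrite xE adj_irr in axy.
  + by case: (gE _ _ gw) => [//|[wE _]|[_ yE]]; [rewrite wE xE eqxx in wx|
      rewrite xE' in yE; rewrite yE eqxx in v12].
  + by case: (gE _ _ gw) => [//|[_ yE]|[wE _]]; [rewrite xE' in yE; rewrite yE eqxx in v12|
      rewrite wE xE eqxx in wx].
- move=> x y A gxy xA yA; exists x, y; split=> //.
  case: (gE _ _ gxy) => [xE|[-> ->]|[-> ->]] //; first by rewrite xE (negPf yA) in xA.
  by rewrite adj_sym.
- exact: tm_deg M.
- by move=> i; have [x <-] := tm_surj M i; exists (g x).
- move=> i j ij; rewrite (tm_adj M ij); split=> [[x [y [fx fy axy]]]|].
    exists (g x), (g y); rewrite !f1g; split=> //; apply: fH1 => // gxy.
    by case/eqP: ij; rewrite -fx -fy -!f1g gxy.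
  by move=> [a [b [fa fb /rP[_ [x [y [gx gy axy]]]]]]]; exists x, y; rewrite -!f1g gx gy.
- move=> a b a' b' fab fa fb /rP[_ [x [y [gx gy axy]]]] /rP[_ [x' [y' [gx' gy' axy']]]].
  subst a b a' b'; rewrite !f1g in fab fa fb.
  by have [-> ->] := tm_uniq M fab fa fb axy axy'.
- move=> a b fab /rP[ab [x [y [gx gy axy]]]]; subst a b; rewrite !f1g in fab.
  have [A [xA yA Acut]] := tm_cut M fab axy.
  have A12 : f v1 = f x -> (v1 \in A) = (v2 \in A).
    move=> fv; have fv2 : f v2 = f x by rewrite -f12.
    apply/idP/idP => h; apply: contraT => h'.
      by have [vx vy] := Acut v1 v2 fv fv2 a12 h h'; rewrite -vx -vy g1 g2 eqxx in ab.
    have a21 : adj H v2 v1 by rewrite adj_sym.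
    by have [vx vy] := Acut v2 v1 fv2 fv a21 h h'; rewrite -vx -vy g1 g2 eqxx in ab.
  have memA u : f u = f x -> (lift v2 (g u) \in A) = (u \in A).
    move=> fu; have [uE|uv] := eqVneq u v2; last by rewrite lg.
    by rewrite uE g2 -v1E A12 // f12 -uE.
  exists [set i | lift v2 i \in A]; rewrite !inE memA // memA //; split=> //.
  move=> u w fu fw /rP[_ [u' [w' [gu gw auw]]]]; subst u w; rewrite !f1g in fu fw.
  rewrite !inE memA // memA // => uA wA.
  by have [-> ->] := Acut u' w' fu fw auw uA wA.
- move=> a b A fab aA bA.
  have [||u [w [fu fw uA wA auw]]] := tm_conn M (A := [set z | g z \in A]) fab.
  + by rewrite inE gl.
  + by rewrite inE gl.
  rewrite !inE in uA wA; exists (g u), (g w); rewrite !f1g; split=> //.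
  by apply: fH1 => // guw; rewrite guw (negPf wA) in uA.
move=> a; have common' x y z : adj H x y -> adj H x z -> y != z -> g y != g z.
  move=> axy axz yz; apply/eqP => /gE[yE|[yE zE]|[yE zE]].
  - by rewrite yE eqxx in yz.
  - by rewrite yE in axy; rewrite zE in axz; exact: common axy axz.
  - by rewrite yE in axy; rewrite zE in axz; exact: common axz axy.
have nbr x y : adj H x y -> (x != v1) || (y != v2) -> (x != v2) || (y != v1) -> adj H1 (g x) (g y).
  move=> axy n1 n2; apply: fH1 => // /gE[xE|[xE yE]|[xE yE]].
  - by rewrite xE adj_irr in axy.
  - by rewrite xE yE !eqxx in n1.
  - by rewrite xE yE !eqxx in n2.
have other v v' : exists2 y, adj H v y & y != v'.
  have [y [z [yz ay az]]] := tm_deg M v.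
  by have [yv|yv] := eqVneq y v'; [exists z => //; rewrite -yv eq_sym|exists y].
have [aE|aE] := eqVneq a j1.
  have [y ay y2] := other v1 v2; have [z az z1] := other v2 v1.
  have y1 : y != v1 by apply: contraTneq ay => ->; rewrite adj_irr.
  have z2 : z != v2 by apply: contraTneq az => ->; rewrite adj_irr.
  exists (g y), (g z); split.
  - apply/eqP => /gE[yE|[yE _]|[yE _]]; [|by rewrite yE eqxx in y1|by rewrite yE eqxx in y2].
    by rewrite adj_sym yE in ay; rewrite adj_sym in az; exact: common ay az.
  - by rewrite aE -g1; apply: nbr; rewrite ?y2 ?y1 ?orbT.
  - by rewrite aE -g2; apply: nbr; rewrite ?z2 ?z1 ?orbT.
have [y [z [yz ay az]]] := tm_deg M (lift v2 a).
have l1 : lift v2 a != v1 by apply: contraNneq aE => h; rewrite -g1 -h gl.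
have l2 : lift v2 a != v2 by rewrite eq_sym neq_lift.
exists (g y), (g z); split; first exact: common' ay az yz.
- by rewrite -[a]gl; apply: nbr; rewrite ?l1 ?l2.
- by rewrite -[a]gl; apply: nbr; rewrite ?l1 ?l2.
Qed.

Lemma tree_model_splitting m k (W : sgraph m) (H : sgraph k) f :
  m < k -> tree_model W H f -> splitting W H.
Proof.
elim: k H f => // k IH H f; rewrite ltnS leq_eqVlt => /predU1P[mk|mk] M.
  subst k; apply: splitting_step (splitting_refl W) _; exact: tree_model_split M.
have [v1 [v2 [a12 f12]]] := tree_model_edge M (leq_trans mk (leqnSn _)).
have [H1 [g [f1 [Mg M1]]]] := contract_edge M a12 f12.
apply: splitting_step (IH H1 f1 mk M1) _; exact: tree_model_split Mg.
Qed.

End Model.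

(** * Positions on a cycle *)

(** The rank of a position counts the marked positions up to it, so the ranks number
    the arcs that begin at marked positions. *)
Section Rank.
Variables (T : eqType) (x0 : T) (a : pred T) (s : seq T).

Definition rk p := count a (take p.+1 s).

Lemma rkS p : p.+1 < size s -> rk p.+1 = rk p + a (nth x0 s p.+1).
Proof. by move=> ps; rewrite /rk (take_nth x0) // -cats1 count_cat /= addn0. Qed.

Lemma rk_mono p q : p <= q -> q < size s -> rk p <= rk q.
Proof.
elim: q => [|q IH]; first by rewrite leqn0 => /eqP ->.
rewrite leq_eqVlt => /predU1P[-> //|pq] qs; rewrite rkS //.
by apply: leq_trans (IH pq (ltnW qs)) (leq_addr _ _).
Qed.

Lemma rk_lt p q : p < q -> q < size s -> a (nth x0 s q) -> rk p < rk q.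
Proof.
case: q => // q pq qs aq; rewrite rkS // aq addn1 ltnS.
by apply: rk_mono => //; apply: ltnW.
Qed.

Lemma rk_last : 0 < size s -> rk (size s).-1 = count a s.
Proof. by move=> s0; rewrite /rk prednK // take_size. Qed.

Lemma rk_le p : rk p <= count a s.
Proof. by rewrite /rk -[X in _ <= count _ X](cat_take_drop p.+1) count_cat leq_addr. Qed.

End Rank.

Lemma rk_ex (T : eqType) (x0 : T) (a : pred T) (s : seq T) j : 0 < j -> j <= count a s ->
  exists p, [/\ p < size s, a (nth x0 s p) & rk a s p = j].
Proof.
elim: s j => [|x s IH] j j0 /=; first by rewrite leqn0 => /eqP jE; rewrite jE in j0.
case ax: (a x) => /=; last first.
  rewrite add0n => /(IH j j0)[p [ps ap rp]]; exists p.+1; split=> //.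
  by rewrite /rk /= ax.
have [->|j1] := eqVneq j 1.
  by move=> _; exists 0; rewrite /rk /= take0 ax.
move=> jc; have [||p [ps ap rp]] := IH j.-1.
- by case: (j) j0 j1 => [|[|]].
- by move: jc; case: (j) j0.
exists p.+1; split=> //; rewrite /rk /= ax -[count a _]/(rk a s p) rp.
by case: (j) j0.
Qed.

(** The arcs of the directed cycle 0, 1, ..., l - 1, 0. *)
Definition carc l p q := (q == p.+1) || (q == 0) && (p.+1 == l).

(** Position 0 is marked, so that no arc wraps around: contracting the arcs maps the
    cycle onto the cycle of the ranks 1, ..., t. *)
Section RimRank.
Variables (T : eqType) (x0 : T) (a : pred T) (s : seq T).
Let l := size s.
Let t := count a s.
Local Notation r := (rk a s).
Hypotheses (a0 : a (nth x0 s 0)) (l0 : 0 < l) (t3 : 3 <= t).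

Lemma rk0 : r 0 = 1.
Proof. by move: a0 l0; rewrite /l /rk; case: (s) => //= x s' ->; rewrite take0. Qed.

Lemma carc_step p q : p < l -> q < l -> carc l p q ->
  (q = p.+1 /\ r q = r p + a (nth x0 s q)) \/ [/\ p = l.-1, q = 0, r p = t & r q = 1].
Proof.
move=> pl ql /orP[/eqP qE|/andP[/eqP q0 /eqP pE]]; first by left; subst q; rewrite (rkS x0).
by right; subst q; rewrite rk0 -pE /= /t -(rk_last a l0) -/l -pE.
Qed.

Lemma carc_inj p q p' q' : p < l -> q < l -> p' < l -> q' < l ->
  carc l p q -> carc l p' q' -> r p <> r q -> r p = r p' -> r q = r q' -> p = p' /\ q = q'.
Proof.
move=> pl ql pl' ql' c c' pq pp qq.
have tt := rk_le a s.
have [[qE rq]|[pE qE rp rq]] := carc_step pl ql c; have [[qE' rq']|[pE' qE' rp' rq']] := carc_step pl' ql' c'.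
- have aq : a (nth x0 s q) by apply: contra_notT pq => h; rewrite rq (negPf h) addn0.
  have aq' : a (nth x0 s q').
    by apply: contraT => h; case: pq; rewrite pp qq rq' (negPf h) addn0.
  suff qq' : q = q' by split=> //; apply: succn_inj; rewrite -qE -qE'.
  have [lt|gt|//] := ltngtP q q'.
    by have := rk_lt lt ql' aq'; rewrite qq ltnn.
  by have := rk_lt gt ql aq; rewrite qq ltnn.
- have := tt q; have := rk_lt; clear - rq rp' rq' pp qq t3; move=> _; lia.
- clear - rp rq rq' pp qq t3 tt; have := tt q'; lia.
- by rewrite pE pE' qE qE'.
Qed.

Lemma carc_asym p q p' q' : p < l -> q < l -> p' < l -> q' < l ->
  carc l p q -> carc l q' p' -> r p <> r q -> r p = r p' -> r q = r q' -> False.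
Proof.
move=> pl ql pl' ql' c c' pq pp qq.
have [[qE rq]|[pE qE rp rq]] := carc_step pl ql c;
  have [[qE' rq']|[pE' qE' rp' rq']] := carc_step ql' pl' c'.
- clear - rq rq' pq pp qq; lia.
- clear - rq rp' rq' pp qq t3; lia.
- clear - rp rq rq' pp qq t3; lia.
- clear - rp rq rq' pp t3; lia.
Qed.

Lemma carc_wheel p q : p < l -> q < l -> carc l p q -> r p <> r q ->
  (r q).-1 = (r p).-1.+1 %% t /\ 0 < r p /\ 0 < r q.
Proof.
move=> pl ql c pq; have p0 : 0 < r p by rewrite -rk0 rk_mono.
have [[qE rq]|[pE qE rp rq]] := carc_step pl ql c; last by rewrite rp rq prednK ?modnn //; lia.
have aq : a (nth x0 s q) by apply: contra_notT pq => h; rewrite rq (negPf h) addn0.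
rewrite rq aq addn1 prednK //=; split=> //; rewrite modn_small //.
by have := rk_le a s q; rewrite rq aq addn1.
Qed.

Lemma carc_of_wheel i j : 0 < i <= t -> 0 < j <= t -> j.-1 = i.-1.+1 %% t ->
  exists p q, [/\ p < l, q < l, carc l p q, r p = i & r q = j].
Proof.
move=> /andP[i0 it] /andP[j0 jt]; rewrite prednK // => jE.
have [iE|ni] := eqVneq i t.
  have j1 : 1 = j by move: jE; rewrite iE modnn; case: (j) j0 => // -[].
  by exists l.-1, 0; rewrite /carc eqxx prednK // eqxx orbT rk0 rk_last // iE -j1; split.
have it' : i < t by rewrite ltn_neqAle ni.
rewrite modn_small // in jE.
have [q [ql aq rq]] := rk_ex x0 j0 jt.
have q0 : 0 < q by rewrite lt0n; apply/eqP => qE; move: rq; rewrite qE rk0; lia.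
exists q.-1, q; rewrite /carc prednK // eqxx; split=> //; first exact: ltnW.
have rS : r q = r q.-1 + 1.
  by rewrite -{1}(prednK q0) (rkS x0) prednK // aq.
clear - rS rq jE; lia.
Qed.

End RimRank.

Section Cycles.
Variables (T : finType) (e : rel T).
Hypotheses (es : symmetric e) (ei : irreflexive e).

Lemma ipath_nth x0 s i j : ipath e s -> i < j -> j < size s ->
  e (nth x0 s i) (nth x0 s j) = (j == i.+1).
Proof.
elim: s i j => // x s IH i [//|j] p ij js.
case: i ij => [|i] ij; last by rewrite /= IH //; case/and3P: p.
case/and3P: p => xs /allP xa p; rewrite /= (eqP (xa _ (mem_nth x0 _))) //.
have us : uniq s := ipath_uniq p.
by case: (s) us js => // y r us js; rewrite -[head _ _]/(nth x0 (y :: r) 0) nth_uniq.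
Qed.

Lemma icycle_nth x0 s i j : icycle e s -> 3 <= size s -> i < size s -> j < size s ->
  e (nth x0 s i) (nth x0 s j) = carc (size s) i j || carc (size s) j i.
Proof.
move=> c s3; wlog ij : i j / i <= j.
  move=> H il jl; case: (leqP i j) => ij; first exact: H.
  by rewrite es orbC; apply: H => //; apply: ltnW.
move=> il jl; move: ij; rewrite leq_eqVlt => /predU1P[->|ij].
  rewrite ei /carc orbb; symmetry; apply/negbTE; lia.
case: s c s3 il jl => // x s /and3P[p xs /allP xa] s3 il.
case: j ij => // j ij js; case: i il ij => [|i] il ij.
  rewrite /= (eqP (xa _ (mem_nth x0 _))) //.
  have us : uniq s := ipath_uniq p.
  case: (s) us js s3 => // y r us js s3.
  rewrite -[head _ _]/(nth x0 (y :: r) 0) -[last _ _]/(last x0 (y :: r)) -nth_last.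
  rewrite !nth_uniq //=.
  rewrite /carc; clear - js s3; move: js s3; rewrite /=; lia.
rewrite /= ipath_nth // /carc; clear - ij js s3; move: ij js s3; rewrite /=; lia.
Qed.

End Cycles.

(** * A tree attached to a cycle is a split wheel *)

Section Trees.
Variables (T : finType) (e : rel T).
Hypotheses (es : symmetric e) (ei : irreflexive e).

Lemma itree_cut s x y : itree e s -> uniq s -> x \in s -> y \in s -> e x y ->
  exists B : {set T}, [/\ x \in B, y \notin B & {in s &, forall u w, e u w -> u \in B ->
    w \notin B -> u = x /\ w = y}].
Proof.
elim: s => // z s IH [zs it] /andP[zn us] xs ys exy.
case: zs => [sE|[y0 y0s zE]].
  by move: xs ys; rewrite sE !inE => /eqP xz /eqP yz; rewrite xz yz ei in exy.
have y0z : y0 != z by apply: contraNneq zn => <-.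
move: xs ys; rewrite !inE => /predU1P[xz|xs] /predU1P[yz|ys].
- by rewrite xz yz ei in exy.
- have yE : y = y0 by apply/eqP; rewrite -zE // -xz.
  exists [set z]; rewrite !inE xz eqxx yE (negPf y0z); split=> //.
  move=> u w us' ws' euw; rewrite !inE => /eqP uE /negPf wz; split=> //.
  by move: ws'; rewrite inE wz => /= ws'; apply/eqP; rewrite -zE // -uE.
- have xE : x = y0 by apply/eqP; rewrite -zE // -yz es.
  exists (~: [set z]); rewrite !inE yz eqxx xE (negPf y0z); split=> //.
  move=> u w us' ws' euw; rewrite !inE negbK => /negPf uz /eqP wE; split=> //.
  by move: us'; rewrite inE uz => /= us'; apply/eqP; rewrite -zE // -wE es.
have [B [xB yB hB]] := IH it us xs ys exy.
have nz u : u \in s -> u != z by move=> us'; apply: contraNneq zn => <-.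
exists (if y0 \in B then z |: B else B :\ z).
have memB u : u \in s -> (u \in if y0 \in B then z |: B else B :\ z) = (u \in B).
  by move=> us'; case: ifP => _; rewrite !inE (negPf (nz u us')).
have memz : (z \in if y0 \in B then z |: B else B :\ z) = (y0 \in B).
  by case: ifP => yB0; rewrite !inE eqxx.
rewrite !memB //; split=> //.
move=> u w; rewrite !in_cons => /predU1P[uz|us'] /predU1P[wz|ws'] euw.
- by rewrite uz wz ei in euw.
- rewrite uz memz memB // => h1 h2.
  have wE : w = y0 by apply/eqP; rewrite -zE // -uz.
  by rewrite wE h1 in h2.
- rewrite wz memz memB // => h1 h2.
  have uE : u = y0 by apply/eqP; rewrite -zE // -wz es.
  by rewrite -uE h1 in h2.
- by rewrite !memB //; apply: hB.
Qed.

Lemma itree_conn s : itree e s -> conn e [set x in s].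
Proof.
elim: s => [_|z s IH [zs it]].
  by split=> B x y; rewrite inE.
case: zs => [->|[y0 y0s zE]].
  by apply: conn_ext (@conn1 _ e z) => x; rewrite !inE.
have := connU es (@conn1 _ e z) (IH it) (set11 z) (y := y0).
rewrite inE => /(_ y0s); rewrite zE // eqxx orbT => /(_ isT).
by apply: conn_ext => x; rewrite !inE.
Qed.

End Trees.

Lemma switch_point (P : pred nat) p q : p <= q -> P p -> ~~ P q ->
  exists i, [/\ p <= i, i < q, P i & ~~ P i.+1].
Proof.
elim: q => [|q IH]; first by rewrite leqn0 => /eqP -> ->.
rewrite leq_eqVlt => /predU1P[-> -> //|pq] Pp nq.
have [Pq|nPq] := boolP (P q); first by exists q; rewrite Pq nq; split.
by have [i [pi iq Pi nPi]] := IH pq Pp nPq; exists i; split=> //; apply: leq_trans iq _.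
Qed.

Section Config.
Variables (n : nat) (G : sgraph n) (c0 : 'I_n) (C D : seq 'I_n).
Local Notation e := (adj G).
Local Notation T := 'I_n.
Hypothesis conf : tree_config e C D.
Let a : pred T := fun c => has (fun d => e d c) D.
Hypothesis a0 : a (nth c0 C 0).
Let t := count a C.
Let l := size C.
Let r := rk a C.
Let pos x := index x C.
Let es : symmetric e := @adj_sym _ G.
Let ei : irreflexive e := @adj_irr _ G.
Let icC : icycle e C. Proof. by case: conf => [[]]. Qed.
Let l4 : 4 <= l. Proof. by case: conf => [[]]. Qed.
Let l0 : 0 < l. Proof. exact: leq_trans l4. Qed.
Let uC : uniq C. Proof. exact: icycle_uniq icC. Qed.
Let uD : uniq D. Proof. by case: conf => [[]]. Qed.
Let tD : itree e D. Proof. by case: conf => [[]]. Qed.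
Let CnD c : c \in C -> c \notin D. Proof. by case: conf => [[_ _ _ _ h] _]; apply: h. Qed.
Let one c d d' : c \in C -> d \in D -> d' \in D -> e d c -> e d' c -> d = d'.
Proof. by case: conf => [_ [h _ _]] cC; apply: h. Qed.

Let aP c : reflect (exists2 d, d \in D & e d c) (a c). Proof. exact: hasP. Qed.

Lemma rim_count : t = #|att e C [set x in D]|.
Proof.
rewrite /t -size_filter -(card_uniqP (filter_uniq a uC)); apply: eq_card => c.
rewrite mem_filter; apply/andP/attP => [[/aP[d dD edc] cC]|[cC [d]]].
  by split=> //; exists d; rewrite ?inE.
by rewrite inE => dD edc; split=> //; apply/aP; exists d.
Qed.

Let t3 : 3 <= t. Proof. by rewrite rim_count; case: conf => [_ []]. Qed.

Let posl x : x \in C -> pos x < l. Proof. by rewrite index_mem. Qed.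
Let posK x : x \in C -> nth c0 C (pos x) = x. Proof. exact: nth_index. Qed.
Let pos_nth p : p < l -> pos (nth c0 C p) = p. Proof. by move=> pl; exact: index_uniq. Qed.
Let pos_inj x y : x \in C -> y \in C -> pos x = pos y -> x = y.
Proof. by move=> xC yC h; rewrite -(posK xC) -(posK yC) h. Qed.

Lemma rim_edge x y : x \in C -> y \in C ->
  e x y = carc l (pos x) (pos y) || carc l (pos y) (pos x).
Proof.
move=> xC yC; rewrite -{1}(posK xC) -{1}(posK yC).
by apply: icycle_nth; rewrite ?posl //; apply: ltnW.
Qed.

(** The contraction onto the wheel: the tree goes to the hub 0, and a vertex of C to
    the number of its arc. *)
Definition fibre x := if x \in D then 0 else r (pos x).

Lemma fibre_le x : fibre x <= t.
Proof. by rewrite /fibre; case: ifP => // _; apply: rk_le. Qed.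

Lemma fibre_hub x : x \in D -> fibre x = 0. Proof. by rewrite /fibre => ->. Qed.

Lemma fibre_rim x : x \in C -> fibre x = r (pos x).
Proof. by move=> xC; rewrite /fibre (negPf (CnD xC)). Qed.

Lemma r_gt0 p : p < l -> 0 < r p.
Proof. by move=> pl; rewrite -(rk0 a0 l0) rk_mono. Qed.

Lemma fibre_gt0 x : x \in C -> 0 < fibre x.
Proof. by move=> xC; rewrite fibre_rim // r_gt0 // posl. Qed.

Let S := C ++ D.
Let SP x : x \in S -> x \in C \/ x \in D. Proof. by rewrite mem_cat => /orP. Qed.
Let CS x : x \in C -> x \in S. Proof. by rewrite mem_cat => ->. Qed.
Let DS x : x \in D -> x \in S. Proof. by rewrite mem_cat orbC => ->. Qed.

Definition wheel_rel i j := [|| i == 0, j == 0 | cycle_adj t i.-1 j.-1].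

Lemma fibre_wheel x y : x \in S -> y \in S -> e x y -> fibre x != fibre y ->
  wheel_rel (fibre x) (fibre y).
Proof.
move=> /SP[xC|xD] /SP[yC|yD] exy nxy; rewrite /wheel_rel;
  try (by rewrite (fibre_hub xD)); try (by rewrite (fibre_hub yD) orbT).
have := exy; rewrite rim_edge // => /orP[c|c].
  have [|h _] := carc_wheel a0 l0 t3 (posl xC) (posl yC) c.
    by rewrite -/r -!fibre_rim //; apply/eqP.
  by rewrite /cycle_adj !fibre_rim // -/r h eqxx !orbT.
have [|h _] := carc_wheel a0 l0 t3 (posl yC) (posl xC) c.
  by rewrite -/r -!fibre_rim //; apply/eqP; rewrite eq_sym.
by rewrite /cycle_adj !fibre_rim // -/r h eqxx !orbT.
Qed.

Lemma rim_of_rank p : p < l -> nth c0 C p \in C /\ fibre (nth c0 C p) = r p.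
Proof. by move=> pl; rewrite fibre_rim ?mem_nth // pos_nth. Qed.

Lemma wheel_fibre i j : i <= t -> j <= t -> i != j -> wheel_rel i j ->
  exists x y, [/\ x \in S, y \in S, fibre x = i, fibre y = j & e x y].
Proof.
wlog suff : i j / i <= t -> j <= t -> i != j -> (i == 0) || (0 < i) && (0 < j) && (j.-1 == i.-1.+1 %% t) ->
    exists x y, [/\ x \in S, y \in S, fibre x = i, fibre y = j & e x y].
  move=> H it jt ij w.
  have flip : (exists x y, [/\ x \in S, y \in S, fibre x = j, fibre y = i & e x y]) ->
      exists x y, [/\ x \in S, y \in S, fibre x = i, fibre y = j & e x y].
    by move=> [x [y [xS yS fx fy exy]]]; exists y, x; rewrite es.
  have ji : j != i by rewrite eq_sym.
  have [i0|i0] := posnP i; first by apply: H => //; rewrite i0.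
  have [j0|j0] := posnP j; first by apply: flip; apply: H => //; rewrite j0.
  move: w; rewrite /wheel_rel /cycle_adj !eqn0Ngt i0 j0 /= => /orP[w|w].
    by apply: H => //; rewrite i0 j0 w orbT.
  by apply: flip; apply: H => //; rewrite i0 j0 w orbT.
move=> it jt ij /orP[/eqP i0|/andP[/andP[i0 j0] /eqP w]].
  have j0 : 0 < j by rewrite lt0n -i0 eq_sym.
  have [p [pl ap rp]] := rk_ex c0 j0 jt.
  have [yC fy] := rim_of_rank pl; have [d dD edy] := aP _ ap.
  by exists d, (nth c0 C p); rewrite fibre_hub // fy; split; auto.
have [||p [q [pl ql c rp rq]]] := carc_of_wheel a0 l0 t3 (i := i) (j := j) _ _ w.
- by rewrite i0.
- by rewrite j0.
have [xC fx] := rim_of_rank pl; have [yC fy] := rim_of_rank ql.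
exists (nth c0 C p), (nth c0 C q); rewrite fx fy; split; auto.
by rewrite rim_edge // !pos_nth // c.
Qed.

Lemma fibre_onto i : i <= t -> exists2 x, x \in S & fibre x = i.
Proof.
move=> it; have [i0|i0] := posnP i.
  have [d dD _] := aP _ a0; exists d; first exact: DS.
  by rewrite fibre_hub.
have [p [pl ap rp]] := rk_ex c0 i0 it; have [xC fx] := rim_of_rank pl.
by exists (nth c0 C p); [exact: CS|rewrite fx].
Qed.

Lemma attached_rank x y : x \in C -> y \in C -> a x -> a y -> fibre x = fibre y -> x = y.
Proof.
move=> xC yC ax ay; rewrite !fibre_rim // => h; apply: pos_inj => //.
have [lt|gt|//] := ltngtP (pos x) (pos y).
  by have := @rk_lt _ c0 a C _ _ lt (posl yC); rewrite posK // -/r h ltnn => /(_ ay).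
by have := @rk_lt _ c0 a C _ _ gt (posl xC); rewrite posK // -/r h ltnn => /(_ ax).
Qed.

Lemma fibre_uniq x y x' y' : x \in S -> y \in S -> x' \in S -> y' \in S ->
  fibre x <> fibre y -> fibre x = fibre x' -> fibre y = fibre y' ->
  e x y -> e x' y' -> x = x' /\ y = y'.
Proof.
have spoke x1 y1 x2 y2 : x1 \in D -> y1 \in C -> x2 \in S -> y2 \in S ->
    fibre x1 = fibre x2 -> fibre y1 = fibre y2 -> e x1 y1 -> e x2 y2 -> x1 = x2 /\ y1 = y2.
  move=> xD yC xS' yS' fx fy exy exy'.
  have xD' : x2 \in D.
    case/SP: xS' => // xC'; have := fibre_gt0 xC'.
    by rewrite -fx fibre_hub.
  have yC' : y2 \in C.
    case/SP: yS' => // yD'; have := fibre_gt0 yC.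
    by rewrite fy fibre_hub.
  have ay : a y1 by apply/aP; exists x1.
  have ay' : a y2 by apply/aP; exists x2.
  have yE := attached_rank yC yC' ay ay' fy; subst y2.
  by split=> //; exact: one exy exy'.
move=> xS yS xS' yS' fxy fx fy exy exy'.
case/SP: (xS) => [xC|xD]; case/SP: (yS) => [yC|yD]; last by case: fxy; rewrite !fibre_hub.
- have xC' : x' \in C.
    case/SP: (xS') => // xD'; have := fibre_gt0 xC; by rewrite fx fibre_hub.
  have yC' : y' \in C.
    case/SP: (yS') => // yD'; have := fibre_gt0 yC; by rewrite fy fibre_hub.
  have rxy : r (pos x) <> r (pos y) by rewrite -!fibre_rim.
  have ryx : r (pos y) <> r (pos x) by move/esym.
  have rx : r (pos x) = r (pos x') by rewrite -!fibre_rim.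
  have ry : r (pos y) = r (pos y') by rewrite -!fibre_rim.
  have [[[px py] px'] py'] := (posl xC, posl yC, posl xC', posl yC').
  move: exy exy'; rewrite !rim_edge // => /orP[c|c] /orP[c'|c'].
  + by have [h1 h2] := carc_inj a0 l0 t3 px py px' py' c c' rxy rx ry; split; apply: pos_inj.
  + by case: (carc_asym a0 l0 t3 px py px' py' c c' rxy rx ry).
  + by case: (carc_asym a0 l0 t3 py px py' px' c c' ryx ry rx).
  + by have [h1 h2] := carc_inj a0 l0 t3 py px py' px' c c' ryx ry rx; split; apply: pos_inj.
- by have [-> ->] : y = y' /\ x = x' by apply: spoke; rewrite // es.
- exact: spoke exy exy'.
Qed.

Lemma same_fibre_hub x u : x \in D -> u \in S -> fibre u = fibre x -> u \in D.
Proof. by move=> xD /SP[uc|//]; rewrite (fibre_hub xD) => h; have := fibre_gt0 uc; rewrite h. Qed.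

Lemma same_fibre_rim x u : x \in C -> u \in S -> fibre u = fibre x -> u \in C.
Proof. by move=> xC /SP[//|ud]; rewrite (fibre_hub ud) => h; have := fibre_gt0 xC; rewrite -h. Qed.

Lemma same_fibre_arc x y : x \in C -> y \in C -> fibre x = fibre y -> e x y ->
  pos y = (pos x).+1 \/ pos x = (pos y).+1.
Proof.
have H x1 y1 : x1 \in C -> y1 \in C -> fibre x1 = fibre y1 -> carc l (pos x1) (pos y1) ->
    pos y1 = (pos x1).+1.
  move=> xC yC; rewrite !fibre_rim // => f c.
  have [[//]|[_ _ r1 r2]] := carc_step a0 l0 (posl xC) (posl yC) c.
  by move: f; rewrite /r r1 r2 => f; have := t3; rewrite /t f.
move=> xC yC f; rewrite rim_edge // => /orP[c|c]; [left|right]; apply: H => //.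
Qed.

Lemma fibre_cut x y : x \in S -> y \in S -> fibre x = fibre y -> e x y ->
  exists B : {set T}, [/\ x \in B, y \notin B & forall u w, u \in S -> w \in S ->
    fibre u = fibre x -> fibre w = fibre x -> e u w -> u \in B -> w \notin B -> u = x /\ w = y].
Proof.
move=> xS yS fxy exy; case/SP: (xS) => [xC|xD]; last first.
  have yD := same_fibre_hub xD yS (esym fxy).
  have [B [xB yB h]] := itree_cut es ei tD uD xD yD exy.
  by exists B; split=> // u w uS' wS fu fw; apply: h; apply: (same_fibre_hub xD).
have yC := same_fibre_rim xC yS (esym fxy).
have [pE|pE] := same_fibre_arc xC yC fxy exy.
  exists [set z | pos z <= pos x]; rewrite !inE leqnn pE ltnn; split=> //.
  move=> u w uS' wS fu fw euw; rewrite !inE -ltnNge => ux xw.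
  have uC' := same_fibre_rim xC uS' fu; have wC := same_fibre_rim xC wS fw.
  have [h|h] := same_fibre_arc uC' wC (etrans fu (esym fw)) euw.
    by split; apply: pos_inj => //; rewrite ?pE; clear - h ux xw; lia.
  by clear - h ux xw; lia.
exists [set z | pos x <= pos z]; rewrite !inE leqnn pE ltnn; split=> //.
move=> u w uS' wS fu fw euw; rewrite !inE -ltnNge => ux xw.
have uC' := same_fibre_rim xC uS' fu; have wC := same_fibre_rim xC wS fw.
have [h|h] := same_fibre_arc uC' wC (etrans fu (esym fw)) euw.
  by clear - h ux xw pE; lia.
by split; apply: pos_inj => //; clear - h ux xw pE; lia.
Qed.

Lemma fibre_conn x y (B : {set T}) : x \in S -> y \in S -> fibre x = fibre y ->
  x \in B -> y \notin B -> exists u w, [/\ u \in S, w \in S, fibre u = fibre x & fibre w = fibre x] /\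
    [/\ u \in B, w \notin B & e u w].
Proof.
move=> xS yS fxy xB yB; case/SP: (xS) => [xC|xD]; last first.
  have yD := same_fibre_hub xD yS (esym fxy).
  have [||u [w [uD' uB wD wB euw]]] := conn_cut (itree_conn es tD) (x := x) (y := y) (B := B) _ xB _ yB.
  - by rewrite inE.
  - by rewrite inE.
  rewrite !inE in uD' wD; exists u, w; rewrite !fibre_hub //.
  by split; split; auto.
have yC := same_fibre_rim xC yS (esym fxy).
have [px py] := (posl xC, posl yC); rewrite !fibre_rim // in fxy.
have between i : (pos x <= i <= pos y) || (pos y <= i <= pos x) ->
    [/\ i < l, nth c0 C i \in S & fibre (nth c0 C i) = r (pos x)].
  move=> h; have il : i < l by move: h px py; clear; lia.
  have [iC ->] := rim_of_rank il; split=> //; first exact: CS.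
  have m p q : p <= q -> q < l -> r p <= r q by apply: rk_mono.
  apply/eqP; rewrite eqn_leq; case/orP: h => /andP[h1 h2].
    by rewrite {1}fxy !m.
  by rewrite m //= fxy m.
have edge i : i.+1 < l -> e (nth c0 C i) (nth c0 C i.+1).
  move=> il; have il' : i < l by apply: ltnW.
  by rewrite rim_edge ?mem_nth // !pos_nth // /carc eqxx.
have [le|/ltnW le] := leqP (pos x) (pos y).
  have [||i [xi iy iB niB]] := @switch_point (fun p => nth c0 C p \in B) _ _ le.
  - by rewrite posK.
  - by rewrite posK.
  have [|il iS fi] := between i; first by rewrite xi (ltnW iy).
  have [|jl jS fj] := between i.+1; first by rewrite (leq_trans xi _) //= iy.
  by exists (nth c0 C i), (nth c0 C i.+1); rewrite fi fj fibre_rim //; split; split; auto.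
have [||i [xi iy iB niB]] := @switch_point (fun p => nth c0 C p \notin B) _ _ le.
- by rewrite posK.
- by rewrite negbK posK.
have [|il iS fi] := between i; first by rewrite xi (ltnW iy) orbT.
have [|jl jS fj] := between i.+1; first by rewrite (leq_trans xi _) //= iy orbT.
exists (nth c0 C i.+1), (nth c0 C i); rewrite negbK in niB; rewrite fi fj fibre_rim //.
by split; split=> //; rewrite es; apply: edge.
Qed.

Lemma config_deg x : x \in S -> exists y z, [/\ y \in S, z \in S, y != z, e x y & e x z].
Proof.
move=> /SP[xC|xD]; last first.
  case: conf => _ [_ _ h]; have [y [z [? ? ? ? ?]]] := h x xD.
  by exists y, z; split.
have [s1 [s2 CE]] := split_mem xC; have := icC; rewrite CE => /(icycle_rot es).
have memE z : (z \in (x :: s2) ++ s1) = (z \in C) by rewrite CE !mem_cat orbC.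
have szE : size (s2 ++ s1) = l.-1 by rewrite /l CE !size_cat /= addnS addnC.
rewrite cat_cons in memE *; case sE : (s2 ++ s1) szE memE => [|y s] szE memE.
  by have := l4; move: szE; rewrite /=; case: (l) => // -[].
move=> /icycle_cons[p h].
have ys : y \in y :: s by exact: mem_head.
have ls : last y s \in y :: s by exact: mem_last.
have sub z : z \in y :: s -> z \in S by move=> zs; apply: CS; rewrite -memE inE zs orbT.
exists y, (last y s); split; [exact: sub|exact: sub| | |].
- case: (lastP s) szE p => [|s' z] szE p; first by move: szE l4; rewrite /=; case: (l) => // -[|[]].
  by rewrite last_rcons; apply: contraTneq (ipath_uniq p) => ->; rewrite /= mem_rcons mem_head.
- by have /andP[_ /eqP ->] := h x y (mem_head _ _) ys; rewrite !eqxx.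
- by have /andP[_ /eqP ->] := h x _ (mem_head _ _) ls; rewrite !eqxx orbT.
Qed.

Let uS : uniq S.
Proof.
rewrite cat_uniq uC uD andbT andTb; apply/hasPn => x xD; apply/negP => xC.
by have := CnD xC; rewrite xD.
Qed.

Let k := size S.
Definition vtx (i : 'I_k) : T := tnth (in_tuple S) i.

Lemma vtx_mem i : vtx i \in S. Proof. exact: mem_tnth. Qed.
Lemma vtx_inj : injective vtx. Proof. by apply/tuple_uniqP. Qed.
Lemma vtx_onto x : x \in S -> exists i, vtx i = x.
Proof. by move=> /(tnthP (in_tuple S))[i ->]; exists i. Qed.

Definition config_adj : rel 'I_k := fun i j => e (vtx i) (vtx j).
Lemma config_adj_sym : symmetric config_adj. Proof. by move=> i j; exact: es. Qed.
Lemma config_adj_irr : irreflexive config_adj. Proof. by move=> i; exact: ei. Qed.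
Definition config_graph := SGraph config_adj_sym config_adj_irr.

Definition config_map (i : 'I_k) : 'I_t.+1 := inord (fibre (vtx i)).

Lemma config_mapE i : config_map i = fibre (vtx i) :> nat.
Proof. by rewrite inordK // ltnS fibre_le. Qed.

Lemma config_map_eq i j : config_map i = config_map j <-> fibre (vtx i) = fibre (vtx j).
Proof.
split=> h; first by rewrite -!config_mapE h.
by apply: val_inj; rewrite /= !config_mapE.
Qed.

Lemma config_model : tree_model (wheel t.+1) config_graph config_map.
Proof.
split.
- move=> i; have [x xS fx] := @fibre_onto i (ltn_ord i).
  by have [v vE] := vtx_onto xS; exists v; apply: val_inj; rewrite /= config_mapE vE.
- move=> i j ij; have ijn : i != j :> nat by [].
  rewrite /= /wheel_adj ij /= -/(wheel_rel i j); split=> [w|[v [w [fv fw avw]]]].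
    have [x [y [xS yS fx fy exy]]] := wheel_fibre (ltn_ord i) (ltn_ord j) ijn w.
    have [v vE] := vtx_onto xS; have [v' vE'] := vtx_onto yS; exists v, v'.
    by split; [apply: val_inj|apply: val_inj|]; rewrite /= ?config_mapE /config_adj ?vE ?vE'.
  rewrite -fv -fw !config_mapE; apply: fibre_wheel; rewrite ?vtx_mem //.
  by rewrite -!config_mapE fv fw.
- move=> x y x' y' nxy /config_map_eq fx /config_map_eq fy axy axy'.
  have fxy : fibre (vtx x) <> fibre (vtx y) by move/config_map_eq.
  have [h1 h2] := fibre_uniq (vtx_mem x) (vtx_mem y) (vtx_mem x') (vtx_mem y') fxy fx fy axy axy'.
  by split; apply: vtx_inj.
- move=> x y /config_map_eq fxy axy.
  have [B [xB yB h]] := fibre_cut (vtx_mem x) (vtx_mem y) fxy axy.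
  exists [set i | vtx i \in B]; rewrite !inE; split=> //.
  move=> u w /config_map_eq fu /config_map_eq fw auw; rewrite !inE => uB wB.
  have [h1 h2] := h _ _ (vtx_mem u) (vtx_mem w) fu fw auw uB wB.
  by split; apply: vtx_inj.
- move=> x y A /config_map_eq fxy xA yA.
  have [||u [w [[uS' wS fu fw] [uB wB euw]]]] :=
    @fibre_conn (vtx x) (vtx y) [set vtx i | i in A] (vtx_mem x) (vtx_mem y) fxy.
  + exact: imset_f.
  + by apply/imsetP => -[i iA /vtx_inj yE]; rewrite yE iA in yA.
  have [i iE] := vtx_onto uS'; have [j jE] := vtx_onto wS; subst u w.
  exists i, j; split; [exact/config_map_eq|exact/config_map_eq| | |exact: euw].
    by case/imsetP: uB => i' iA /vtx_inj ->.
  by apply: contra wB; apply: imset_f.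
- move=> x; have [y [z [yS zS yz xy xz]]] := config_deg (vtx_mem x).
  have [i iE] := vtx_onto yS; have [j jE] := vtx_onto zS; subst y z.
  by exists i, j; split=> //; apply: contra yz => /eqP ->.
Qed.

Hypothesis no_wheel : forall m : nat, 5 <= m -> ~ has_induced (wheel m) G.
Hypothesis no_proper_splitting : forall (m k : nat) (H : sgraph k), 4 <= m ->
  proper_splitting (wheel m) H -> ~ has_induced H G.

(** The configuration induces a graph that contracts to the wheel on t + 1 vertices.
    If it has more vertices than the wheel it is a proper splitting; otherwise it is
    the wheel itself, and t + 1 is at least 5, because C has at least 4 vertices. *)
Lemma config_absurd : False.
Proof.
have ind : has_induced config_graph G by exists vtx; split=> //; exact: vtx_inj.
have kt : t.+1 <= k.
  rewrite /k size_cat /t; have : 0 < size D by have [d] := aP _ a0; case: (D).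
  by have := count_size a C; clear; lia.
have [lt|ge] := ltnP t.+1 k.
  apply: (no_proper_splitting (m := t.+1) _ _ ind) => //; split.
    exact: tree_model_splitting lt config_model.
  move=> [f [bf _]]; have := bij_eq_card bf; rewrite !card_ord => h.
  by move: lt; rewrite h ltnn.
have kE : k = t.+1 by apply/eqP; rewrite eqn_leq ge kt.
have sD : size D = 1 /\ t = l.
  have := count_size a C; have : 0 < size D by have [d] := aP _ a0; case: (D).
  by move: kE; rewrite /k size_cat -/t -/l; clear; lia.
have [_ tl] := sD.
apply: (no_wheel (m := t.+1)); first by rewrite tl; exact: l4.
have [v [vi vE]] := tree_model_iso config_model ge.
exists (fun i => vtx (v i)); split=> [i j /vtx_inj /vi //|i j].
exact: vE.
Qed.

End Config.

(** * Recognizing networks *)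

Section Networks.
Variables (T : finType) (e : rel T).
Hypotheses (es : symmetric e) (ei : irreflexive e).
Implicit Types (A B D : {set T}) (u v w x y z : T) (p q : seq T).

Definition component B x : {set T} := [set y | connect [rel a b | e a b && (b \in B)] x y].

Lemma component_refl B x : x \in component B x. Proof. by rewrite inE connect0. Qed.

Lemma component_sub B x : x \in B -> component B x \subset B.
Proof.
move=> xB; apply/subsetP => y; rewrite inE => /connectP[p pth ->].
by elim: p x xB pth => //= z p IH x _ /andP[/andP[_ zB] pz]; apply: (IH z).
Qed.

Lemma component_closed B x y z : y \in component B x -> z \in B -> e y z ->
  z \in component B x.
Proof.
rewrite !inE => xy zB yz; apply: connect_trans xy _.
by apply: connect1; rewrite /= yz.
Qed.

Lemma component_conn B x : x \in B -> conn e (component B x).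
Proof.
move=> xB; have out (Y : {set T}) y : x \in Y -> y \in component B x -> y \notin Y ->
    exists u v, [/\ u \in component B x, u \in Y, v \in component B x, v \notin Y & e u v].
  move=> xY; rewrite inE => /connectP[p pth yE] yY.
  have aux : forall p' x', x' \in component B x ->
      path [rel a b | e a b && (b \in B)] x' p' ->
      path e x' p' /\ {subset x' :: p' <= component B x}.
    elim=> [|z p' IH] x' x'c /=; first by split=> // w; rewrite inE => /eqP ->.
    move=> /andP[/andP[xz zB] pz]; have zc := component_closed x'c zB xz.
    have [pe pc] := IH z zc pz; rewrite xz; split=> // w; rewrite inE => /predU1P[-> //|].
    exact: pc.
  have [pe pc] := aux p x (component_refl B x) pth.
  have [u [v [up uY vp vY euv]]] := path_cut pe (esym yE) xY yY.
  by exists u, v; split=> //; apply: pc.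
split=> Y y z yc yY zc zY; have [xY|xY] := boolP (x \in Y); first exact: out zc zY.
have [||u [v [uc uY vc vY euv]]] := out (~: Y) y _ yc.
- by rewrite inE.
- by rewrite inE negbK.
exists v, u; rewrite inE in uY; rewrite inE negbK in vY; split=> //.
by rewrite es.
Qed.

Lemma component_eq B x y : x \in B -> y \in component B x -> component B y = component B x.
Proof.
move=> xB yx; have yB := subsetP (component_sub xB) y yx.
apply/setP => z; rewrite !inE.
have sym a b : a \in B -> connect [rel a b | e a b && (b \in B)] a b ->
    connect [rel a b | e a b && (b \in B)] b a.
  move=> aB /connectP[p pth ->]; elim: p a aB pth => [|c p IH] a aB /=; first by rewrite connect0.
  move=> /andP[/andP[ac cB] pc]; apply: connect_trans (IH c cB pc) _.
  by apply: connect1; rewrite /= es ac.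
rewrite inE in yx; apply/idP/idP => h; first exact: connect_trans yx h.
by apply: connect_trans h; apply: sym.
Qed.

Definition two_feet A u v := forall q D, ipath e (u :: q) -> last u q = v ->
  {subset u :: q <= A} -> conn e D -> D \subset A -> {in u :: q, forall x, x \notin D} ->
  #|att e (u :: q) D| <= 2.

Lemma two_feet_sub A A' u v : A' \subset A -> two_feet A u v -> two_feet A' u v.
Proof.
move=> AA h q D pq lq qA cD DA dis; apply: h => //; last exact: subset_trans AA.
by move=> x /qA; apply: (subsetP AA).
Qed.

Lemma separation_component A D (K : {set T}) : D \subset A ->
  (forall x y, x \in D -> y \in A -> y \notin D -> e x y -> y \in K) -> K \subset A :\: D ->
  separation e A (A :\: D) (D :|: K) /\ (A :\: D) :&: (D :|: K) = K.
Proof.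
move=> /subsetP DA DK /subsetP KA; split; last first.
  apply/setP => x; rewrite !inE; have := KA x; rewrite inE.
  by case: (x \in K); case: (x \in D); case: (x \in A) => // /(_ isT).
split.
  apply/setP => x; rewrite !inE; have := KA x; rewrite inE; have := DA x.
  by case: (x \in K); case: (x \in D); case: (x \in A) => //= h1 h2;
    first [by have := h1 isT | by have := h2 isT].
move=> x y; rewrite !inE negb_or => /andP[/andP[xD xK] /andP[_ xA]] /andP[yD /orP[yD'|yK]].
  apply/negP => exy; case/negP: xK; apply: (DK y x) => //; by rewrite es.
by move: yD; rewrite negb_and negbK; have := KA y yK; rewrite inE => /andP[/negPf-> ->].
Qed.

Lemma conn_add_pair D u v x y : conn e D -> x \in D -> e u x -> y \in D -> e v y ->
  conn e (u |: (v |: D)).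
Proof.
move=> cD xD ux yD vy.
have c1 : conn e (v |: D).
  by apply: (connU es (@conn1 _ e v) cD (set11 v) yD); rewrite vy orbT.
by apply: (connU es (@conn1 _ e u) c1 (set11 u) (y := x)); rewrite ?ux ?orbT // !inE xD orbT.
Qed.

Lemma clique_or_pair (K : {set T}) :
  clique e K \/ exists u v, [/\ u \in K, v \in K, u != v & ~~ e u v].
Proof.
have [/existsP[u /existsP[v /and4P[uK vK uv euv]]]|h] :=
    boolP [exists u, [exists v, [&& u \in K, v \in K, u != v & ~~ e u v]]].
  by right; exists u, v.
left=> u v uK vK uv; apply: contraT => euv; case/negP: h.
by apply/existsP; exists u; apply/existsP; exists v; rewrite uK vK uv.
Qed.

Lemma clique_or_card2 (K : {set T}) : #|K| <= 2 ->
  clique e K \/ exists u v, [/\ K = [set u; v], u != v & ~~ e u v].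
Proof.
move=> K2; have [|[u [v [uK vK uv euv]]]] := clique_or_pair K; first by left.
right; exists u, v; split=> //; apply/esym/eqP; rewrite eqEcard cards2 uv K2 andbT.
by apply/subsetP => z; rewrite !inE => /orP[]/eqP->.
Qed.

Lemma conn_pair_path A u v : conn e A -> u \in A -> v \in A ->
  exists q, [/\ ipath e (u :: q), last u q = v & {subset u :: q <= A}].
Proof.
by move=> cA uA vA; have [q pq [lq qA]] := conn_has_ipath cA uA vA; exists q.
Qed.

Lemma component_boundary A (Q : seq T) x : x \in A -> x \notin Q -> {subset Q <= A} ->
  let D := component (A :\: [set z in Q]) x in
  [/\ D \subset A, {in Q, forall z, z \notin D}, x \in D, conn e D &
      forall a b, a \in D -> b \in A -> b \notin D -> e a b -> b \in att e Q D] /\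
  att e Q D \subset A :\: D.
Proof.
move=> xA xQ QA D; have xB : x \in A :\: [set z in Q] by rewrite !inE xQ.
have DB := component_sub xB; rewrite -/D in DB.
have DQ z : z \in Q -> z \notin D.
  by move=> zQ; apply/negP => /(subsetP DB); rewrite !inE zQ.
split; first split=> //.
- by apply: subset_trans DB _; apply: subsetDl.
- exact: component_refl.
- exact: component_conn.
- move=> a b aD bA bD eab; apply/attP; split; last by exists a.
  apply: contraNT bD => bQ; apply: component_closed aD _ eab.
  by rewrite !inE bQ.
- by apply/subsetP => z /attP[zQ _]; rewrite inE DQ // QA.
Qed.

(** Fix an induced path Q from u to v. Every component off Q is attached to at most
    two of its vertices. A component attached to a clique is pendant; one attached to
    both u and v splits the network in parallel. Otherwise the farthest vertex w of Q
    that some component joins to u is a cut vertex, and the network splits there in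
    series. *)
Theorem network_of_paths A u v : u \in A -> v \in A -> u != v ->
  (exists q, [/\ ipath e (u :: q), last u q = v & {subset u :: q <= A}]) ->
  two_feet A u v -> network e A u v.
Proof.
have [k] := ubnP #|A|; elim: k A u v => // k IH A u v Ak uA vA uv [q [pq lq qA]] tf.
have [euv|neuv] := boolP (e u v); first exact: network_edge.
have smaller A' : A' \subset A -> (exists2 z, z \in A & z \notin A') -> #|A'| < k.
  move=> AA [z zA zA']; rewrite ltnS in Ak; apply: leq_trans Ak; apply: proper_card.
  by apply/properP; split=> //; exists z.
set Q := u :: q in qA pq.
have vQ : v \in Q by rewrite -lq mem_last.
have uQ : u \in Q by exact: mem_head.
have uQu := ipath_uniq pq.
pose cmp := component (A :\: [set z in Q]).
have bnd x := @component_boundary A Q x.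
have [/existsP[x /and3P[xA xQ /'forall_forallP cl]]|npend] := boolP [exists x,
    [&& x \in A, x \notin Q & [forall a, forall b, (a \in att e Q (cmp x)) ==>
       (b \in att e Q (cmp x)) ==> (a != b) ==> e a b]]].
  have [[DA DQ xD cD Dout] KA] := bnd x xA xQ qA.
  have [sep KE] := separation_component DA Dout KA.
  apply: (network_pendant sep).
    rewrite KE => a b aK bK ab; have := cl a b; rewrite aK bK ab /=.
    by move/eqP; rewrite eqb_id.
  apply: IH => //.
  - by apply: smaller; [exact: subsetDl|exists x; rewrite // inE xD].
  - by rewrite inE DQ.
  - by rewrite inE DQ.
  - exists q; split=> // z zQ; rewrite inE DQ // qA //.
  - by apply: two_feet_sub tf; exact: subsetDl.
have foot x : x \in A -> x \notin Q -> exists a b,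
    [/\ att e Q (cmp x) = [set a; b], a != b & ~~ e a b].
  move=> xA xQ; have [[DA DQ xD cD Dout] KA] := bnd x xA xQ qA.
  have [cl|//] := clique_or_card2 (tf _ _ pq lq qA cD DA DQ).
  case/negP: npend; apply/existsP; exists x; rewrite xA xQ /=.
  apply/forallP => a; apply/forallP => b; apply/implyP => aK; apply/implyP => bK.
  by apply/implyP => ab; apply: cl.
have two x a b c : x \in A -> x \notin Q -> a \in att e Q (cmp x) ->
    b \in att e Q (cmp x) -> c \in att e Q (cmp x) -> a != b -> c = a \/ c = b.
  move=> xA xQ; have [a0 [b0 [-> _ _]]] := foot x xA xQ; rewrite !inE.
  by move=> /orP[]/eqP-> /orP[]/eqP-> /orP[]/eqP->; rewrite ?eqxx; auto.
have [m [r qE]] : exists m r, q = m :: r by case: (q) lq uv => [/= ->|m r]; [rewrite eqxx|eauto].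
have mv : m != v.
  apply: contraNneq neuv => <-; have := pq; rewrite /Q qE => /ipath_cons[_ l].
  by have /andP[_ /eqP ->] := l u m (mem_head _ _) (mem_head _ _); rewrite !eqxx.
have mQ : m \in Q by rewrite /Q qE !inE eqxx orbT.
have mu : m != u by move: uQu; rewrite /Q qE /= inE negb_or eq_sym => /andP[/andP[]].
have [/existsP[x /and4P[xA xQ ux vx]]|npar] := boolP [exists x,
    [&& x \in A, x \notin Q, u \in att e Q (cmp x) & v \in att e Q (cmp x)]].
  have [[DA DQ xD cD Dout] KA] := bnd x xA xQ qA; rewrite -/(cmp x) in DA DQ xD cD Dout KA.
  have [sep KE] := separation_component DA Dout KA.
  have KE' : att e Q (cmp x) = [set u; v].
    apply/setP => z; rewrite in_set2; apply/idP/orP => [zK|[]/eqP-> //].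
    by have [->|->] := two x u v z xA xQ ux vx zK uv; rewrite eqxx; [left|right].
  rewrite KE' in sep KE.
  have [_ [d1 d1D d1u]] := attP _ _ _ _ ux; have [_ [d2 d2D d2v]] := attP _ _ _ _ vx.
  have DuvA : cmp x :|: [set u; v] \subset A.
    by rewrite subUset DA; apply/subsetP => z; rewrite !inE => /orP[]/eqP->.
  apply: (network_parallel sep KE).
    apply: IH => //.
    - by apply: smaller; [exact: subsetDl|exists x; rewrite // inE xD].
    - by rewrite inE DQ.
    - by rewrite inE DQ.
    - by exists q; split=> // z zQ; rewrite inE DQ // qA.
    - by apply: two_feet_sub tf; exact: subsetDl.
  apply: IH => //.
  - apply: smaller => //; exists m; first exact: qA.
    by rewrite in_setU in_set2 negb_or DQ //= (negPf mu) (negPf mv).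
  - by rewrite !inE eqxx orbT.
  - by rewrite !inE eqxx !orbT.
  - have c2 : conn e (u |: (v |: cmp x)).
      by apply: (conn_add_pair cD d1D _ d2D); rewrite es.
    apply: conn_pair_path; rewrite ?inE ?eqxx ?orbT //.
    by apply: conn_ext c2 => z; rewrite !inE orbA orbC.
  - exact: two_feet_sub tf.
(* position 1, the neighbour of u on Q, always counts, so that w is not u *)
pose far i := (i == 1) || [exists x, [&& x \in A, x \notin Q, u \in att e Q (cmp x) &
  nth u Q i \in att e Q (cmp x)]].
pose cand i := (i < size Q) && far i.
have cand1 : cand 1 by rewrite /cand /far /Q qE.
have candb i : cand i -> i <= size Q by case/andP=> /ltnW.
have [j /andP[jQ farj] jmax] := ex_maxnP (ex_intro (fun i => cand i) 1 cand1) candb.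
have j1 : 0 < j by apply: jmax.
have jv : nth u Q j != v.
  apply/negP => /eqP jE; move: farj; rewrite /far => /orP[/eqP j1'|].
    by move: jE; rewrite j1' /Q qE /= => mE; rewrite mE eqxx in mv.
  move=> /existsP[x h]; case/negP: npar; apply/existsP; exists x; by rewrite -jE.
set w := nth u Q j in jv.
have wQ : w \in Q by rewrite mem_nth.
have wu : w != u.
  have -> : u = nth u Q 0 by []. by rewrite nth_uniq // -lt0n.
pose Q1 := take j Q; pose Q2 := drop j.+1 Q.
have QE : Q = Q1 ++ w :: Q2 by rewrite -drop_nth // cat_take_drop.
have [s1 Q1E] : exists s1, Q1 = u :: s1 by rewrite /Q1 /Q; case: (j) j1 => // i _; exists (take i q).
have lastQ2 : last w Q2 = v by rewrite -lq -[last u q]/(last u Q) QE last_cat.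
have [y2 [s2 Q2E]] : exists y2 s2, Q2 = y2 :: s2.
  by move: lastQ2 jv; case: (Q2) => [/= ->|y2 s2]; [rewrite eqxx|eauto].
have vQ2 : v \in Q2 by rewrite -lastQ2 Q2E /= mem_last.
have pQ := pq; rewrite QE Q1E in pQ; have /ipath_cat[pQ1 pwQ2 l1] := pQ.
have memQ z : z \in Q = [|| z \in Q1, z == w | z \in Q2] by rewrite QE mem_cat inE.
have Q12 z : z \in Q1 -> z \notin w :: Q2.
  move: uQu; rewrite QE cat_uniq => /and3P[_ /hasPn h _] z1.
  by apply/negP => /h; rewrite z1.
have idx1 z : z \in Q1 -> index z Q < j.
  move=> z1; rewrite QE index_cat z1.
  by apply: leq_trans (_ : size Q1 <= j); rewrite ?index_mem // size_take; case: ltnP.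
have idx2 z : z \in Q2 -> j < index z Q.
  move=> z2; have zw : z \notin Q1 by apply/negP => /Q12; rewrite inE z2 orbT.
  rewrite QE index_cat (negPf zw) /=.
  have -> : (w == z) = false.
    by move: (ipath_uniq pwQ2); rewrite /= => /andP[wn _]; apply: contraNF wn => /eqP ->.
  by rewrite addnS ltnS /Q1 size_take jQ leq_addr.
(* A component joined to Q on both sides of w would have three feet on another path
   from u to v, the one that goes from u to w through the component that defines w,
   once the part of Q between u and w is added to it. *)
have straddle x a b : x \in A -> x \notin Q -> a \in att e Q (cmp x) -> b \in att e Q (cmp x) ->
    a \in Q1 -> b \in Q2 -> False.
  move=> xA xQ ax bx a1 b2.
  have ab : a != b by apply: contraTneq a1 => ->; apply/negP => /Q12; rewrite inE b2 orbT.
  have bQ : b \in Q by rewrite memQ b2 !orbT.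
  have [aE|au] := eqVneq a u.
    subst a; have : index b Q <= j.
      apply: jmax; rewrite /cand index_mem bQ /far; apply/orP; right; apply/existsP; exists x.
      by rewrite nth_index // xA xQ ax bx.
    by rewrite leqNgt idx2.
  have j2 : j != 1.
    apply: contraNneq au => j1'; move: a1; rewrite /Q1 j1' /Q /= take0 inE //.
  move: farj; rewrite /far (negPf j2) /= => /existsP[x0 /and4P[x0A x0Q u0 w0]].
  rewrite -/w in w0.
  have [[D0A D0Q x0D cD0 D0out] K0A] := bnd x0 x0A x0Q qA.
  rewrite -/(cmp x0) in D0A D0Q x0D cD0 D0out K0A.
  have uw : u != w by rewrite eq_sym.
  have foot0 z : z \in Q -> (exists2 d, d \in cmp x0 & e d z) -> z = u \/ z = w.
    by move=> zQ h; apply: (two x0) => //; apply/attP.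
  have [[DA DQ xD cD Dout] KA] := bnd x xA xQ qA; rewrite -/(cmp x) in DA DQ xD cD Dout KA.
  have disj z : z \in cmp x -> z \notin cmp x0.
    move=> zx; apply/negP => zx0.
    have xB : x \in A :\: [set z in Q] by rewrite !inE xQ.
    have x0B : x0 \in A :\: [set z in Q] by rewrite !inE x0Q.
    have E : cmp x = cmp x0.
      exact: etrans (esym (component_eq xB zx)) (component_eq x0B zx0).
    have [bu|bw] : b = u \/ b = w.
      by apply: (two x0) => //; rewrite -E.
      by move: b2; rewrite bu => /idx2; rewrite /Q /= eqxx ltn0.
    by move: (ipath_uniq pwQ2); rewrite /= -bw b2.
  have [_ [d1 d1D d1u]] := attP _ _ _ _ u0; have [_ [d2 d2D d2w]] := attP _ _ _ _ w0.
  have [|||p0 [pp0 lp0 p0A]] := @conn_pair_path (u |: (w |: cmp x0)) u w.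
  - by apply: (conn_add_pair cD0 d1D _ d2D); rewrite es.
  - by rewrite !inE eqxx.
  - by rewrite !inE eqxx orbT.
  have pR : ipath e (u :: p0 ++ Q2).
    rewrite Q2E; apply/ipath_cat; split=> //; first by rewrite -Q2E; case/and3P: pwQ2.
    rewrite lp0 -Q2E => z z' zp z2; have z'Q : z' \in Q by rewrite memQ z2 !orbT.
    have := p0A z zp; rewrite !in_setU1 => /or3P[/eqP zE|/eqP zE|zD].
    - have uQ1 : u \in u :: s1 by exact: mem_head.
      have z2' : z' \in w :: Q2 by rewrite inE z2 orbT.
      have /andP[uz' /eqP ezz] := l1 u z' uQ1 z2'; rewrite zE uz' ezz (negPf uw) /=.
      have /negPf -> : z' != w by apply: contraTneq z2 => ->; move: (ipath_uniq pwQ2) => /andP[].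
      by rewrite andbF.
    - move: pwQ2; rewrite Q2E => /ipath_cons[_ /(_ w z' (mem_head _ _))].
      by rewrite -Q2E => /(_ z2); rewrite zE.
    have -> : z != z' by apply: contraTneq zD => ->; exact: D0Q z' z'Q.
    have /negPf -> : z != w by apply: contraTneq zD => ->; exact: D0Q w wQ.
    apply/eqP/negP => ezz; have [zu|zw] : z' = u \/ z' = w by apply: foot0 => //; exists z.
      by move: (Q12 u); rewrite Q1E mem_head inE -zu z2 orbT => /(_ isT).
    by move: (ipath_uniq pwQ2); rewrite /= -zw z2.
  have s1a : a \in s1 by move: a1; rewrite Q1E inE (negPf au).
  have ps1 : ipath e s1 by case/and3P: pQ1.
  have [_ [d dD da]] := attP _ _ _ _ ax.
  pose D' := [set z in s1] :|: cmp x.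
  have cD' : conn e D'.
    apply: (connU es (conn_ipath es ps1) cD (x := a) (y := d)) => //.
      by rewrite inE.
    by rewrite es da orbT.
  have lR : last u (p0 ++ Q2) = v by rewrite last_cat lp0 lastQ2.
  have inR z : z \in u :: p0 ++ Q2 -> [\/ z = u, z = w, z \in cmp x0 | z \in Q2].
    rewrite -cat_cons mem_cat => /orP[/p0A|z2]; last by constructor 4.
    by rewrite !in_setU1 => /or3P[/eqP->|/eqP->|zD]; [constructor 1|constructor 2|constructor 3].
  have RA : {subset u :: p0 ++ Q2 <= A}.
    move=> z /inR[->|->|/(subsetP D0A)//|z2] //; first exact: qA.
    by apply: qA; rewrite memQ z2 !orbT.
  have s1Q z : z \in s1 -> z \in Q1 by move=> zs; rewrite Q1E inE zs orbT.
  have D'A : D' \subset A.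
    rewrite subUset DA andbT; apply/subsetP => z; rewrite inE => /s1Q z1.
    by apply: qA; rewrite memQ z1.
  have us1 : u \notin s1 by case/and3P: pQ1.
  have dis : {in u :: p0 ++ Q2, forall z, z \notin D'}.
    move=> z /inR zR; rewrite in_setU in_set; apply/norP; split.
      case: zR => [->//|->|zD|z2].
      - by apply/negP => /s1Q /Q12; rewrite mem_head.
      - apply/negP => /s1Q z1; have := D0Q z; rewrite memQ z1 => /(_ isT).
        by rewrite zD.
      - by apply/negP => /s1Q /Q12; rewrite inE z2 orbT.
    case: zR => [->|->|zD|z2]; [exact: DQ|exact: DQ| |by apply: DQ; rewrite memQ z2 !orbT].
    by apply: contraL zD => /disj.
  have := tf _ _ pR lR RA cD' D'A dis; rewrite leqNgt (@card3 _ _ u w b) //.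
  - apply/attP; split; first exact: mem_head.
    have [y [s1' s1E]] : exists y s1', s1 = y :: s1' by case: (s1) s1a => // y s1'; eauto.
    move: (pQ1); rewrite s1E => /ipath_cons[_ l].
    exists y; first by rewrite in_setU in_set s1E mem_head.
    by have /andP[_ /eqP h] := l u y (mem_head _ _) (mem_head _ _); rewrite es h !eqxx.
  - apply/attP; split.
      by rewrite -cat_cons mem_cat -lp0 mem_last.
    exists (last u s1); last first.
      by have /andP[_ /eqP ->] := l1 _ w (mem_last u s1) (mem_head _ _); rewrite !eqxx.
    by rewrite in_setU in_set; case: (s1) s1a => // y s1' _; rewrite /= mem_last.
  - apply/attP; split; first by rewrite -cat_cons mem_cat b2 orbT.
    have [_ [d' d'D d'b]] := attP _ _ _ _ bx.
    by exists d'; rewrite // in_setU d'D orbT.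
  - by apply: contraTneq b2 => <-; apply/negP => /idx2; rewrite /Q /= eqxx.
  - by apply: contraTneq b2 => <-; move: (ipath_uniq pwQ2) => /andP[].
(* the side of u: the part of Q before w with all components attached to it *)
pose A1 := [set z in A | (z \in Q1) || (z == w) || (z \notin Q) &&
  [exists y in Q1, y \in att e Q (cmp z)]].
pose A2 := w |: (A :\: A1).
have wA : w \in A by exact: qA.
have wA1 : w \in A1 by rewrite inE wA eqxx orbT.
have Q1A1 z : z \in Q1 -> z \in A1.
  by move=> z1; rewrite inE z1 qA // memQ z1.
have Q2A1 z : z \in Q2 -> z \notin A1.
  move=> z2; apply/negP; rewrite inE => /andP[_ /orP[/orP[z1|/eqP zw]|/andP[zQ _]]].
  - by have := Q12 z z1; rewrite inE z2 orbT.
  - by move: (ipath_uniq pwQ2); rewrite /= -zw z2.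
  - by move: zQ; rewrite memQ z2 !orbT.
have Q2A2 z : z \in Q2 -> z \in A2.
  by move=> z2; rewrite !in_setU1 in_setD Q2A1 // qA ?orbT // memQ z2 !orbT.
have A1A : A1 \subset A by apply/subsetP => z; rewrite inE => /andP[].
have A2A : A2 \subset A by rewrite subUset sub1set wA subsetDl.
have cmp_edge a b : a \in A -> a \notin Q -> b \in A -> b \notin Q -> e a b -> cmp a = cmp b.
  move=> aA aQ bA bQ eab; have aB : a \in A :\: [set z in Q] by rewrite !inE aQ.
  apply/esym; apply: component_eq => //; apply: component_closed (component_refl _ _) _ eab.
  by rewrite !inE bQ.
have cross a b : a \in A1 -> a != w -> b \in A -> b \notin A1 -> ~~ e a b.
  move=> a1 aw bA b1; apply/negP => eab; move: (a1); rewrite inE (negPf aw) orbF => /andP[aA].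
  have bw : b != w by apply: contraNneq b1 => ->.
  have bQ1 : b \notin Q1 by apply: contra b1 => /Q1A1.
  have bQ2 : b \in Q -> b \in Q2 by rewrite memQ (negPf bQ1) (negPf bw).
  case/orP=> [aQ1|/andP[aQ /existsP[y /andP[yQ1 ya]]]].
    have [bQ|bQ] := boolP (b \in Q).
      have bwQ : b \in w :: Q2 by rewrite inE bQ2 ?orbT.
      rewrite Q1E in aQ1; have /andP[_ /eqP h] := l1 a b aQ1 bwQ.
      by move: eab; rewrite h (negPf bw) andbF.
    case/negP: b1; rewrite inE bA bQ /=; apply/orP; right; apply/existsP; exists a.
    rewrite aQ1; apply/attP; split; first by rewrite memQ aQ1.
    by exists b; [exact: component_refl|rewrite es].
  have [bQ|bQ] := boolP (b \in Q).
    apply: (straddle a y b aA aQ ya _ yQ1 (bQ2 bQ)); apply/attP; split=> //.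
    by exists a => //; exact: component_refl.
  case/negP: b1; rewrite inE bA bQ /=; apply/orP; right; apply/existsP; exists y.
  by rewrite yQ1 -(cmp_edge a b).
have K12 : A1 :&: A2 = [set w].
  apply/setP => z; rewrite !in_setI in_setU1 in_setD in_set1.
  by have [->|zw] := eqVneq z w; [rewrite wA1|case: (z \in A1)].
have sep : separation e A A1 A2.
  split.
    apply/setP => z; rewrite in_setU in_setU1 in_setD.
    have [->|zw] := eqVneq z w; first by rewrite wA wA1.
    by have := subsetP A1A z; case: (z \in A1) => //= ->.
  move=> a b; rewrite !in_setD !in_setU1 !in_setD negb_or => /andP[/andP[aw _] a1].
  move=> /andP[b1 /orP[/eqP bw|/andP[_ bA]]]; first by rewrite bw wA1 in b1.
  exact: cross.
have wv : w != v by [].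
have uQ1 : u \in Q1 by rewrite Q1E mem_head.
apply: (network_series sep K12); apply: IH; rewrite ?(Q1A1 u) ?(Q2A2 v) //.
- by apply: smaller => //; exists v; rewrite // Q2A1.
- by rewrite eq_sym.
- exists (s1 ++ [:: w]); rewrite last_cat /=; split=> //.
    by apply: (@ipath_prefix _ _ _ Q2); rewrite /= -catA.
  move=> z; rewrite -cat_cons -Q1E mem_cat inE => /orP[/Q1A1//|/eqP->//].
- move=> q1 D pq1 lq1 q1A cD DA1 dis.
  have pext : ipath e (u :: q1 ++ Q2).
    rewrite Q2E; apply/ipath_cat; split=> //; first by rewrite -Q2E; case/and3P: pwQ2.
    rewrite lq1 -Q2E => z z' zq z2; have z1 := q1A z zq; have z'1 := Q2A1 z' z2.
    have zz' : z != z' by apply: contraTneq z1 => ->.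
    rewrite zz'; have [->|zw] := eqVneq z w.
      move: pwQ2; rewrite Q2E => /ipath_cons[_ /(_ w z' (mem_head _ _))].
      by rewrite -Q2E => /(_ z2) /andP[_ /eqP ->]; rewrite eqxx /= eqxx.
    apply/eqP/negP => ezz; have := cross z z' z1 zw _ z'1; rewrite ezz.
    by rewrite qA ?memQ ?z2 ?orbT // => /(_ isT).
  have lext : last u (q1 ++ Q2) = v by rewrite last_cat lq1.
  apply: leq_trans (tf _ _ pext lext _ cD _ _); first last.
  + move=> z; rewrite -cat_cons mem_cat => /orP[/dis//|/Q2A1 zA1].
    by apply: contra zA1; apply: (subsetP DA1).
  + exact: subset_trans DA1 A1A.
  + move=> z; rewrite -cat_cons mem_cat => /orP[/q1A|z2]; first exact: (subsetP A1A).
    by apply: qA; rewrite memQ z2 !orbT.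
  apply: subset_leq_card; apply/subsetP => z /attP[zq h]; apply/attP; split=> //.
  by rewrite -cat_cons mem_cat zq.
- apply: smaller => //; exists u => //.
  by rewrite in_setU1 in_setD Q1A1 //= orbF eq_sym.
- by rewrite in_setU1 eqxx.
- exists Q2; split=> // z; rewrite inE => /predU1P[->|/Q2A2//].
  by rewrite in_setU1 eqxx.
move=> q2 D pq2 lq2 q2A cD DA2 dis.
have notA1 z : z \in A2 -> z != w -> z \notin A1.
  by rewrite in_setU1 in_setD => /predU1P[->|/andP[]//]; rewrite eqxx.
have pext : ipath e (u :: s1 ++ w :: q2).
  apply/ipath_cat; split=> // z z' zs zq.
  have z1 : z \in Q1 by rewrite Q1E.
  have [->|z'w] := eqVneq z' w; first by have := l1 z w zs (mem_head _ _); rewrite eqxx.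
  have z'A := q2A z' zq; have z'1 := notA1 z' z'A z'w.
  have zw : z != w by apply: contraTneq z1 => ->; apply/negP => /Q12; rewrite mem_head.
  have -> : z != z' by apply: contraNneq z'1 => <-; exact: Q1A1.
  rewrite andbF; apply/eqP/negP => ezz.
  by have := cross z z' (Q1A1 z z1) zw (subsetP A2A z' z'A) z'1; rewrite ezz.
have lext : last u (s1 ++ w :: q2) = v by rewrite last_cat.
apply: leq_trans (tf _ _ pext lext _ cD _ _); first last.
- move=> z; rewrite -cat_cons -Q1E mem_cat => /orP[z1|/dis//].
  have zw : z != w by apply: contraTneq z1 => ->; apply/negP => /Q12; rewrite mem_head.
  by apply: contraL (Q1A1 z z1) => /(subsetP DA2)/notA1; apply.
- exact: subset_trans DA2 A2A.
- move=> z; rewrite -cat_cons -Q1E mem_cat => /orP[z1|/q2A]; last exact: (subsetP A2A).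
  by apply: qA; rewrite memQ z1.
apply: subset_leq_card; apply/subsetP => z /attP[zq h]; apply/attP; split=> //.
by rewrite -cat_cons mem_cat zq orbT.
Qed.

End Networks.

(** * Decomposing graphs without attached cycles *)

Section Decomposition.
Variable T : finType.
Implicit Types (e : rel T) (A B D K : {set T}) (u v w x y z : T) (p q : seq T).

Definition cycle_sparse e A := forall C D, {subset C <= A} -> D \subset A -> ~ attaches3 e C D.

Lemma cycle_sparse_sub e A A' : A' \subset A -> cycle_sparse e A -> cycle_sparse e A'.
Proof.
move=> AA h C D CA DA; apply: h; last exact: subset_trans AA.
by move=> x /CA; apply: (subsetP AA).
Qed.

Lemma ipath_eq_in e e' s : {in s &, e =2 e'} -> ipath e s = ipath e' s.
Proof.
elim: s => // x s IH h; rewrite /ipath -/(ipath e) -/(ipath e') IH; last first.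
  by move=> a b as_ bs; apply: h; rewrite inE ?as_ ?bs orbT.
congr [&& _, _ & _]; apply: eq_in_all => y ys.
by rewrite h ?mem_head // inE ys orbT.
Qed.

Lemma icycle_eq_in e e' s : {in s &, e =2 e'} -> icycle e s = icycle e' s.
Proof.
case: s => // x s h; rewrite /icycle (@ipath_eq_in e e'); last first.
  by move=> a b as_ bs; apply: h; rewrite inE ?as_ ?bs orbT.
congr [&& _, _ & _]; apply: eq_in_all => y ys.
by rewrite h ?mem_head // inE ys orbT.
Qed.

Lemma icycle_open e C u v : symmetric e -> icycle e C -> u \in C -> v \in C -> e u v ->
  u != v -> exists s, [/\ icycle e (u :: s), last u s = v, u :: s =i C & size (u :: s) = size C].
Proof.
move=> es cC /split_mem[s1 [s2 CE]] vC euv uv.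
rewrite CE in cC vC *; have {cC} := icycle_rot es cC.
have mE : (u :: s2) ++ s1 =i s1 ++ u :: s2 by move=> z; rewrite !mem_cat orbC.
have sE : size ((u :: s2) ++ s1) = size (s1 ++ u :: s2) by rewrite !size_cat addnC.
rewrite -mE in vC; rewrite cat_cons in mE sE vC *.
case: (s2 ++ s1) mE sE vC => [|y s] mE sE vC cs.
  by move: vC; rewrite inE eq_sym (negPf uv).
have vs : v \in y :: s by move: vC; rewrite inE eq_sym (negPf uv).
have /icycle_cons[_ /(_ u v (mem_head _ _) vs) /andP[_]] := cs.
rewrite euv eqxx /= eq_sym => /eqP /orP[/eqP vy|/eqP vl]; last by exists (y :: s).
exists (rev (y :: s)); split.
- have : icycle e (rev (u :: y :: s)) by apply: icycle_rev.
  by rewrite rev_cons -cats1 => /(icycle_rot es).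
- by rewrite rev_cons last_rcons vy.
- by move=> z; rewrite -mE !inE mem_rev inE.
- by rewrite -sE /= size_rev.
Qed.

(** A separation along a nonadjacent pair u, v, seen from the side A1. An induced path
    R through the other side, from a neighbour of u to a neighbour of v, plays the part
    of the edge uv: it closes induced paths of A1 to induced cycles, and it replaces
    the edge in connected sets. *)
Section TwoSum.
Variables (e : rel T) (A A1 A2 : {set T}) (u v : T).
Hypotheses (es : symmetric e) (ei : irreflexive e).
Hypotheses (sep : separation e A A1 A2) (K : A1 :&: A2 = [set u; v]).
Hypotheses (uv : u != v) (nuv : ~~ e u v) (spA : cycle_sparse e A).

Let uA1 : u \in A1. Proof. by have := set21 u v; rewrite -K inE => /andP[]. Qed.
Let vA1 : v \in A1. Proof. by have := set22 u v; rewrite -K inE => /andP[]. Qed.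
Let A1A : A1 \subset A. Proof. by case: sep => ->; rewrite subsetUl. Qed.
Let A2A : A2 \subset A. Proof. by case: sep => ->; rewrite subsetUr. Qed.

Variables (y0 : T) (r : seq T).
Let R := y0 :: r.
Hypotheses (pR : ipath e R) (RA2 : {subset R <= A2}) (RA1 : {in R, forall z, z \notin A1}).
Hypotheses (uR : {in R, forall z, e u z = (z == y0)}).
Hypotheses (vR : {in R, forall z, e v z = (z == last y0 r)}).

Let cross z w : z \in A1 -> z != u -> z != v -> w \in R -> e z w = false.
Proof.
move=> z1 zu zv wR; apply/negbTE; case: sep => _; apply.
  rewrite inE z1 andbT; apply/negP => z2.
  have : z \in A1 :&: A2 by rewrite inE z1.
  by rewrite K !inE (negPf zu) (negPf zv).
by rewrite inE RA1 // RA2.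
Qed.

Lemma close_cycle q : ipath e (u :: q) -> last u q = v -> {subset u :: q <= A1} ->
  [/\ icycle e ((u :: q) ++ rev R), 4 <= size ((u :: q) ++ rev R) &
      {subset (u :: q) ++ rev R <= A}].
Proof.
move=> pq lq qA.
have [t' [tE tl]] := rev_cons_last y0 r; rewrite -/R in tE.
have mR z : (z \in last y0 r :: t') = (z \in R) by rewrite -tE mem_rev.
split.
- rewrite tE; apply/icycle_cat; split=> //; first by rewrite -tE; apply: ipath_rev.
  rewrite lq tl => z w zq; rewrite mR => wR; have z1 := qA z zq.
  have -> : z != w by apply: contraTneq z1 => ->; exact: RA1.
  rewrite /=; have [zu|zu] := eqVneq z u.
    by rewrite zu uR // (negPf uv) /=.
  have [zv|zv] := eqVneq z v; first by rewrite zv vR // orbF.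
  by rewrite cross.
- rewrite size_cat size_rev /= !addSn !addnS !ltnS; case: q lq pq qA => [|y [|y' q]] //=.
    by move=> uvE; move: uv; rewrite uvE eqxx.
  move=> yv /ipath_cons[_ l]; have := l u y (mem_head _ _) (mem_head _ _).
  by rewrite yv (negPf nuv) !eqxx andbF.
move=> z; rewrite mem_cat mem_rev => /orP[/qA|/RA2]; first exact: (subsetP A1A).
exact: (subsetP A2A).
Qed.

Lemma two_sum_two_feet : two_feet e A1 u v.
Proof.
move=> q D pq lq qA cD DA dis; have [cC sC CA] := close_cycle pq lq qA.
rewrite leqNgt; apply/negP => a3; apply: (spA (C := (u :: q) ++ rev R) (D := D)) => //.
  exact: subset_trans DA A1A.
split=> //.
  move=> z; rewrite mem_cat mem_rev => /orP[/dis//|/RA1].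
  by apply: contra; apply: (subsetP DA).
apply: leq_trans a3 _; apply: subset_leq_card; apply/subsetP => z /attP[zq h].
by apply/attP; split=> //; rewrite mem_cat zq.
Qed.

Lemma two_sum_sparse : cycle_sparse (add_edge e u v) A1.
Proof.
set e' := add_edge e u v.
have es' : symmetric e' by exact: add_edge_sym.
have e'E a b : e' a b -> e a b \/ (a = u /\ b = v) \/ (a = v /\ b = u).
  by rewrite /e' /add_edge => /orP[|/orP[]/andP[/eqP-> /eqP->]]; auto.
have ee' a b : e a b -> e' a b by rewrite /e' /add_edge => ->.
have e'in (X : pred T) : ~ (u \in X /\ v \in X) -> {in X &, e =2 e'}.
  move=> nX a b aX bX; apply/idP/idP; first exact: ee'.
  by case/e'E => // -[[aE bE]|[aE bE]]; case: nX; rewrite -aE -bE.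
move=> C D CA DA [cC sC cD dis a3].
(* if u and v both lie on the cycle then R replaces the edge uv there; if one of them
   lies in D then R is added to D *)
have [[uC vC]|nC] : (u \in C /\ v \in C) \/ ~ (u \in C /\ v \in C).
  by case: (boolP (u \in C)) => uC; case: (boolP (v \in C)) => vC; [left|right..]; try case.
- have e'uv : e' u v by rewrite /e' /add_edge !eqxx orbT.
  have [s [cs ls ms ss]] := icycle_open es' cC uC vC e'uv uv.
  have [h [s' sE]] : exists h s', s = h :: s'.
    by case: (s) ss sC => [|h s'] /= <- //; eauto.
  have cs' := cs; rewrite sE in cs' ls ms ss; case/icycle_cons: cs' => ps l.
  have us : u \notin h :: s' by have := icycle_uniq cs; rewrite sE /= => /andP[].
  have vh : v != h.
    rewrite -ls /=; case: s' ss ps us l ls {sE ms} => [|z s'] ss ps us l ls.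
      by move: sC; rewrite -ss.
    have /andP[hn _] := ipath_uniq ps.
    by apply: contraNneq hn => E; rewrite -[in X in X \in _]E /= mem_last.
  have psu : ipath e (u :: h :: s').
    apply/ipath_cons; split.
      rewrite (@ipath_eq_in e e') //; apply: e'in => -[us' _].
      by case/negP: us.
    move=> a z; rewrite inE => /eqP -> zs; have /andP[uz /eqP h'] := l u z (mem_head _ _) zs.
    rewrite uz eqxx /=; have [zv|zv] := eqVneq z v.
      by rewrite zv (negPf nuv) (negPf vh).
    have <- : e' u z = e u z by rewrite /e' /add_edge eqxx (negPf zv) (negPf uv) /= !orbF.
    by rewrite h' eqxx /= -[last h s']/(last u (h :: s')) ls (negPf zv) orbF.
  have sA : {subset u :: h :: s' <= A1} by move=> z; rewrite ms; apply: CA.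
  have [cC2 sC2 CA2] := close_cycle psu ls sA.
  have uD : u \notin D by apply: dis.
  have vD : v \notin D by apply: dis.
  have eD a b : a \in D -> e' a b -> e a b.
    move=> aD /e'E[//|[[aE _]|[aE _]]]; first by rewrite -aE aD in uD.
    by rewrite -aE aD in vD.
  apply: (spA CA2 (subset_trans DA A1A)); split=> //.
  + split=> B a b aD aB bD bB; have [x [y [xD xB yD yB xy]]] := conn_cut cD aD aB bD bB.
    by exists x, y; split=> //; apply: eD.
  + move=> z; rewrite mem_cat mem_rev => /orP[|/RA1]; first by rewrite ms => /dis.
    by apply: contra; apply: (subsetP DA).
  apply: leq_trans a3 _; apply: subset_leq_card; apply/subsetP => z /attP[zC [d dD dz]].
  apply/attP; split; first by rewrite mem_cat ms zC.
  by exists d => //; apply: eD.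
have cC' : icycle e C by rewrite (@icycle_eq_in e e') //; apply: e'in.
have dR : last y0 r \in R by exact: mem_last.
have hR : y0 \in R by exact: mem_head.
have evl : e v (last y0 r) by rewrite vR ?eqxx.
have euh : e u y0 by rewrite uR ?eqxx.
have RA z : z \in R -> z \in A by move=> /RA2; apply: (subsetP A2A).
have CA' : {subset C <= A} by move=> z /CA; apply: (subsetP A1A).
have [/andP[uD vD]|nD] := boolP ((u \notin D) && (v \notin D)).
  have eD a b : a \in D -> e' a b -> e a b.
    move=> aD /e'E[//|[[aE _]|[aE _]]]; first by rewrite -aE aD in uD.
    by rewrite -aE aD in vD.
  apply: (spA CA' (subset_trans DA A1A)); split=> //.
    split=> B a b aD aB bD bB; have [x [y [xD xB yD yB xy]]] := conn_cut cD aD aB bD bB.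
    by exists x, y; split=> //; apply: eD.
  apply: leq_trans a3 _; apply: subset_leq_card; apply/subsetP => z /attP[zC [d dD dz]].
  by apply/attP; split=> //; exists d => //; apply: eD.
pose D2 := D :|: [set z in R].
have inD z : z \in D -> z \in D2 by move=> zD; rewrite in_setU zD.
have inR z : z \in R -> z \in D2 by move=> zR; rewrite in_setU in_set zR orbT.
have D2P z : z \in D2 -> z \in D \/ z \in R by rewrite in_setU in_set => /orP.
apply: (spA (C := C) (D := D2)) => //.
  apply/subsetP => z /D2P[zD|/RA//]; apply: (subsetP A1A); exact: (subsetP DA).
split=> //.
- split=> B a b aD aB bD bB.
  have [/existsP[x /existsP[y /and5P[xD yD xy xB yB]]]|no] := boolP [exists x, exists y,
      [&& x \in D2, y \in D2, e x y, x \in B & y \notin B]].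
    by exists x, y; split.
  have same x y : x \in D2 -> y \in D2 -> e x y -> (x \in B) = (y \in B).
    move=> xD yD xy; apply/idP/idP => h; apply: contraT => h'; case/negP: no.
      by apply/existsP; exists x; apply/existsP; exists y; rewrite xD yD xy h h'.
    by apply/existsP; exists y; apply/existsP; exists x; rewrite xD yD es xy h h'.
  have sameR x y : x \in R -> y \in R -> x \in B -> y \in B.
    move=> xR yR xB; apply: contraT => yB.
    have [||x' [y' [x'R x'B y'R y'B xy]]] := conn_cut (conn_ipath es pR) (x := x) (y := y) (B := B) _ xB _ yB.
    - by rewrite in_set.
    - by rewrite in_set.
    rewrite in_set in x'R; rewrite in_set in y'R.
    by rewrite -(same x' y' (inR _ x'R) (inR _ y'R) xy) x'B in y'B.
  have RB x y : x \in R -> y \in R -> (x \in B) = (y \in B).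
    by move=> xR yR; apply/idP/idP; apply: sameR.
  have uB : u \in D -> (u \in B) = (y0 \in B).
    by move=> uD; apply: same => //; [apply: inD|apply: inR].
  have vB : v \in D -> (v \in B) = (y0 \in B).
    by move=> vD; rewrite (RB _ _ hR dR); apply: same => //; [apply: inD|apply: inR].
  have sameD x y : x \in D -> y \in D -> x \in B -> y \in B.
    move=> xD yD xB; apply: contraT => yB.
    have [x' [y' [x'D x'B y'D y'B /e'E xy]]] := conn_cut cD xD xB yD yB.
    case: xy => [xy|[[xE yE]|[xE yE]]].
    - by rewrite -(same x' y' (inD _ x'D) (inD _ y'D) xy) x'B in y'B.
    - by subst x' y'; rewrite vB // -uB // x'B in y'B.
    - by subst x' y'; rewrite uB // -vB // x'B in y'B.
  have [z zD zB] : exists2 z, z \in D & (z \in B) = (y0 \in B).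
    by move: nD; rewrite negb_and !negbK => /orP[h|h]; [exists u; auto|exists v; auto].
  have all x : x \in D2 -> (x \in B) = (y0 \in B).
    move=> /D2P[xD|xR]; last exact: RB.
    by rewrite -zB; apply/idP/idP; apply: sameD.
  by move: bB; rewrite all // -(all a) // aB.
- move=> z zC; rewrite in_setU in_set negb_or dis //=; apply/negP => /RA1.
  by rewrite CA.
apply: leq_trans a3 _; apply: subset_leq_card; apply/subsetP => z /attP[zC [d dD dz]].
apply/attP; split=> //; case: (e'E _ _ dz) => [dz'|[[dE zE]|[dE zE]]].
- by exists d => //; apply: inD.
- by exists (last y0 r); [apply: inR|rewrite es zE].
- by exists y0; [apply: inR|rewrite es zE].
Qed.

End TwoSum.
End Decomposition.

Section Decomposition.
Variable T : finType.
Implicit Types (e : rel T) (A B D K : {set T}) (u v w x y z : T) (p q : seq T).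

Lemma path_inside e A1 A2 u v p : symmetric e -> A1 :&: A2 = [set u; v] -> u != v -> ~~ e u v ->
  ipath e (u :: p) -> last u p = v -> {subset u :: p <= A2} ->
  exists y r, [/\ ipath e (y :: r), {subset y :: r <= A2}, {in y :: r, forall z, z \notin A1},
    {in y :: r, forall z, e u z = (z == y)} & {in y :: r, forall z, e v z = (z == last y r)}].
Proof.
move=> es KE uv nuv; case/lastP: p => [_ /= uvE|p v']; first by rewrite uvE eqxx in uv.
rewrite last_rcons => + v'E; subst v'; case: p => [|y r].
  move=> /ipath_cons[_ l] _; have := l u v (mem_head _ _) (mem_head _ _).
  by rewrite (negPf nuv) !eqxx andbF.
rewrite rcons_cons -cats1 => pu sA; have uu := ipath_uniq pu.
have /ipath_cons[pv lu] := pu; have /ipath_cat[pr _ lv] := pv.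
have inr z : z \in y :: r -> z \in y :: r ++ [:: v] by move=> zr; rewrite -cat_cons mem_cat zr.
exists y, r; split=> //.
- by move=> z /inr zr; apply: sA; rewrite inE zr orbT.
- move=> z zr; apply/negP => z1; have : z \in A1 :&: A2.
    by rewrite inE z1 sA // inE inr ?orbT.
  rewrite KE !inE => /orP[]/eqP zE; rewrite zE in zr.
    by move: uu; rewrite /= -/(in_mem u _) -[_ \notin y :: _]/(u \notin _) inr.
  by have /andP[] := lv v v zr (mem_head _ _); rewrite eqxx.
- by move=> z /inr zr; have /andP[_ /eqP ->] := lu u z (mem_head _ _) zr; rewrite eqxx.
- by move=> z zr; have /andP[_ /eqP h] := lv z v zr (mem_head _ _); rewrite es h eqxx andbT.
Qed.

Definition cut e A D K := [/\ D \subset A, K \subset A :\: D,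
  forall x y, x \in D -> y \in A -> y \notin D -> e x y -> y \in K,
  exists x, x \in D & exists2 y, y \in A & y \notin D :|: K].

Lemma conn_icycle e C : symmetric e -> icycle e C -> conn e [set z in C].
Proof.
move=> es; case: C => [|x [|y s]]; first by move=> _; split=> B x y; rewrite inE.
  by move=> _; apply: conn_ext (@conn1 _ e x) => z; rewrite !inE.
move=> /icycle_cons[p l].
have exy : e x y by have /andP[_ /eqP ->] := l x y (mem_head _ _) (mem_head _ _); rewrite !eqxx.
have := connU es (@conn1 _ e x) (conn_ipath es p) (set11 x) (y := y).
by rewrite inE mem_head exy orbT => /(_ isT isT); apply: conn_ext => z; rewrite !inE.
Qed.

Lemma pair_path e D u v d1 d2 : symmetric e -> conn e D -> d1 \in D -> e d1 u ->
  d2 \in D -> e d2 v ->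
  exists q, [/\ ipath e (u :: q), last u q = v & {subset u :: q <= D :|: [set u; v]}].
Proof.
move=> es cD d1D d1u d2D d2v.
have [|||q [pq lq qA]] := @conn_pair_path _ e (u |: (v |: D)) u v.
- by apply: (conn_add_pair es cD d1D _ d2D); rewrite es.
- by rewrite !inE eqxx.
- by rewrite !inE eqxx orbT.
by exists q; split=> // z /qA; rewrite !inE orbA orbC.
Qed.

(** Take a and b nonadjacent and the component D of b off the closed neighbourhood of
    a; all its outside neighbours are adjacent to a. If they form a clique, this is the
    cut. Otherwise two nonadjacent ones are joined through D, and closing up at a gives
    an induced cycle C of length at least 4. A component off C has at most two feet on
    C; and if C is everything, then a vertex of C is cut off by its two neighbours. *)
Lemma cut_exists e A : symmetric e -> irreflexive e -> cycle_sparse e A -> ~ clique e A ->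
  exists D K, cut e A D K /\ (clique e K \/ exists u v, [/\ K = [set u; v], u != v, ~~ e u v &
    (exists q, [/\ ipath e (u :: q), last u q = v & {subset u :: q <= A :\: D}]) /\
    (exists q, [/\ ipath e (u :: q), last u q = v & {subset u :: q <= D :|: K}])]).
Proof.
move=> es ei sp ncl; have [//|[a [b [aA bA ab nab]]]] := clique_or_pair e A.
pose B := A :\: (a |: [set z | e a z]); pose D := component e B b.
have bB : b \in B by rewrite !inE bA (negPf nab) eq_sym (negPf ab).
have DB : {subset D <= B} := subsetP (component_sub e bB).
have DA : D \subset A by apply/subsetP => z /DB; rewrite inE => /andP[].
have bD : b \in D := component_refl e B b.
have aD z : z \in D -> (z != a) && ~~ e a z by move=> /DB; rewrite !inE negb_or => /andP[].
pose K := [set z in A | (z \notin D) && [exists d in D, e d z]].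
have KP z : z \in K -> [/\ z \in A, z \notin D & exists2 d, d \in D & e d z].
  by rewrite inE => /and3P[zA zD /existsP[d /andP[dD dz]]]; split=> //; exists d.
have aK z : z \in K -> e a z.
  move=> /KP[zA zD [d dD dz]]; have /andP[_ nad] := aD d dD.
  apply: contraNT zD => naz; apply: (component_closed dD _ dz).
  by rewrite !inE negb_or naz zA !andbT; apply: contraNneq nad => <-; rewrite es.
have aDK : a \notin D :|: K.
  rewrite in_setU negb_or; apply/andP; split; first by apply/negP => /aD; rewrite eqxx.
  by apply/negP => /aK; rewrite ei.
have cutK : cut e A D K.
  split=> //; [|by move=> x y xD yA yD xy; rewrite inE yA yD; apply/existsP; exists x; rewrite xD
    |by exists b|by exists a].
  by apply/subsetP => z /KP[zA zD _]; rewrite inE zD.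
have [clK|[s [t [sK tK st nst]]]] := clique_or_pair e K; first by exists D, K; split; last left.
have [sA sD [d1 d1D d1s]] := KP s sK; have [tA tD [d2 d2D d2t]] := KP t tK.
have [q [pq lq qD]] := pair_path es (component_conn es bB) d1D d1s d2D d2t.
have qDK z : z \in s :: q -> z \in D :|: K.
  by move=> /qD; rewrite !in_setU !in_set1 => /or3P[->//|/eqP->|/eqP->]; rewrite ?sK ?tK orbT.
pose C := a :: s :: q.
have cC : icycle e C.
  apply/icycle_cons; split=> // a' z; rewrite inE => /eqP-> zq; rewrite !eqxx lq /=.
  have -> : a != z by apply: contraNneq aDK => ->; exact: qDK.
  have := qD z zq; rewrite !in_setU !in_set1 => /or3P[zD|/eqP->|/eqP->]; last 2 first.
  - by rewrite aK ?eqxx.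
  - by rewrite aK ?eqxx ?orbT.
  have /andP[_ /negPf ->] := aD z zD.
  have /negPf -> : z != s by apply: contraNneq sD => <-.
  by have /negPf -> : z != t by apply: contraNneq tD => <-.
have CA : {subset C <= A}.
  move=> z; rewrite inE => /predU1P[->//|/qDK]; rewrite in_setU => /orP[|/KP[]//].
  exact: (subsetP DA).
have uC := icycle_uniq cC.
have [y [y' [q' qE]]] : exists y y' q', q = y :: y' :: q'.
  case: (q) lq pq => [/= sE|y [|y' q']]; first by rewrite sE eqxx in st.
    move=> /= -> /ipath_cons[_ l]; have := l s t (mem_head _ _) (mem_head _ _).
    by rewrite (negPf nst) !eqxx andbF.
  by move=> _ _; exists y, y', q'.
have [/existsP[x /andP[xA xC]]|noC] := boolP [exists x, (x \in A) && (x \notin C)].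
  have [[D'A D'C xD' cD' out] K'A] := component_boundary es xA xC CA.
  set D' := component _ _ _ in D'A D'C xD' cD' out K'A.
  have K'2 : #|att e C D'| <= 2.
    rewrite leqNgt; apply/negP => a3; apply: (sp C D') => //; split=> //.
    by rewrite /C qE.
  have cutK' : cut e A D' (att e C D').
    split=> //; first by exists x.
    have : ~~ ([set z in C] \subset att e C D').
      apply/negP => /subset_leq_card; rewrite cardsE (card_uniqP uC) => h.
      by have := leq_trans h K'2; rewrite /C qE.
    case/subsetPn=> z; rewrite inE => zC zK; exists z; first exact: CA.
    by rewrite in_setU negb_or zK D'C.
  exists D', (att e C D'); split=> //.
  have [|[u [v [KE uv nuv]]]] := clique_or_card2 e K'2; [by left|right].
  have /attP[uC' [f1 f1D f1u]] : u \in att e C D' by rewrite KE set21.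
  have /attP[vC' [f2 f2D f2v]] : v \in att e C D' by rewrite KE set22.
  exists u, v; split=> //; split; last by rewrite KE; exact: (pair_path es cD' f1D f1u f2D f2v).
  have [||p [pp lp pC]] := conn_pair_path (conn_icycle es cC) (u := u) (v := v).
  - by rewrite inE.
  - by rewrite inE.
  exists p; split=> // z /pC; rewrite inE => zC.
  by rewrite inE D'C // CA.
have AC z : z \in A -> z \in C.
  by move=> zA; apply: contraT => zC; case/negP: noC; apply/existsP; exists z; rewrite zA.
have cS : icycle e (s :: y :: (y' :: q') ++ [:: a]).
  by rewrite -[s :: _]/((s :: y :: y' :: q') ++ [:: a]) -qE; apply: (icycle_rot es (s := [:: a])).
have /icycle_cons[py l] := cS; rewrite last_cat /= in l.
have uS := icycle_uniq cS.
have memS z : (z \in s :: y :: (y' :: q') ++ [:: a]) = (z \in C).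
  by rewrite /C qE -[s :: _]/((s :: y :: y' :: q') ++ [:: a]) mem_cat orbC !inE.
have yC : y \in C by rewrite /C qE !inE eqxx !orbT.
have y'C : y' \in C by rewrite /C qE !inE eqxx !orbT.
have := uC; rewrite /C qE /= !inE !negb_or => /and4P[/and4P[as_ ay ay' _] /and3P[sy sy' _]].
move=> /andP[yy' yq'] _.
have sC : s \in C by rewrite /C !inE eqxx orbT.
exists [set s], [set y; a]; split; last right.
  split.
  - by rewrite sub1set.
  - apply/subsetP => z; rewrite !inE => /orP[]/eqP->.
      by rewrite eq_sym sy CA.
    by rewrite as_.
  - move=> x z; rewrite inE => /eqP-> /AC zC; rewrite inE => zs sz.
    have zS : z \in y :: (y' :: q') ++ [:: a].
      by move: zC; rewrite -memS inE (negPf zs).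
    have /andP[_ /eqP] := l s z (mem_head _ _) zS; rewrite sz !eqxx /= => /esym.
    by rewrite !inE.
  - by exists s; rewrite inE.
  - exists y'; first exact: CA.
    by rewrite !inE !negb_or eq_sym sy' eq_sym yy' eq_sym ay'.
exists y, a; split=> //.
- by rewrite eq_sym.
- have /icycle_cons[_ la] := cC.
  have yq : y \in s :: q by rewrite qE !inE eqxx orbT.
  have /andP[_ /eqP h] := la a y (mem_head _ _) yq; rewrite es h !eqxx eq_sym (negPf sy) /= lq.
  apply: contraNneq yq' => yt.
  have : t = last y' q' by rewrite -lq qE.
  by rewrite -yt => yl; have := mem_last y' q'; rewrite -yl inE (negPf yy').
split.
  exists ((y' :: q') ++ [:: a]); split=> //; first by rewrite last_cat.
  move=> z zS; have zS' : z \in s :: y :: (y' :: q') ++ [:: a] by rewrite inE zS orbT.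
  rewrite !inE CA -?memS // andbT; apply: contraTneq zS => ->.
  by case/andP: uS.
apply: (pair_path (d1 := s) (d2 := s)) => //.
- exact: conn1.
- by rewrite inE.
- have /andP[_ /eqP ->] := l s y (mem_head _ _) (mem_head _ _); by rewrite !eqxx.
- by rewrite inE.
- have aS : a \in y :: (y' :: q') ++ [:: a] by rewrite -cat_cons mem_cat mem_seq1 eqxx orbT.
  by have /andP[_ /eqP ->] := l s a (mem_head _ _) aS; rewrite !eqxx orbT.
Qed.

Theorem sparse_decomposable e A : symmetric e -> irreflexive e -> cycle_sparse e A ->
  decomposable e A.
Proof.
have [k] := ubnP #|A|; elim: k e A => // k IH e A Ak es ei sp.
have [cl|[a [b [aA bA ab nab]]]] := clique_or_pair e A; first exact: decomposable_clique.
have [|D [K [[DA KA out [x xD] [y yA yDK]] hK]]] := cut_exists es ei sp.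
  by move=> cl; case/negP: nab; apply: cl.
have [sep KE] := separation_component es DA out KA.
have small A' z : A' \subset A -> z \in A -> z \notin A' -> #|A'| < k.
  move=> AA zA zA'; rewrite ltnS in Ak; apply: leq_trans Ak; apply: proper_card.
  by apply/properP; split=> //; exists z.
have A1A : A :\: D \subset A by exact: subsetDl.
have A2A : D :|: K \subset A by rewrite subUset DA (subset_trans KA).
have s1 : #|A :\: D| < k by apply: (small _ x) => //; [exact: (subsetP DA)|rewrite inE xD].
have s2 : #|D :|: K| < k by apply: (small _ y).
have d1 : decomposable e (A :\: D) by apply: IH => //; apply: cycle_sparse_sub sp.
have d2 : decomposable e (D :|: K) by apply: IH => //; apply: cycle_sparse_sub sp.
case: hK => [cl|[u [v [Kuv uv nuv [[q1 [p1 l1 i1]] [q2 [p2 l2 i2]]]]]]].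
  by apply: decomposable_clique_sum sep _ d1 d2; rewrite KE.
have sep' := separationC es sep.
subst K; have KE' := KE; rewrite setIC in KE'.
have [y1 [r1 [pr1 rA1 rn1 ur1 vr1]]] := path_inside es KE' uv nuv p1 l1 i1.
have [y2 [r2 [pr2 rA2 rn2 ur2 vr2]]] := path_inside es KE uv nuv p2 l2 i2.
have memK z : z \in [set u; v] -> (z \in A :\: D) /\ (z \in D :|: [set u; v]).
  by move=> h; apply/andP; rewrite -in_setI KE.
have [u1 u2] := memK u (set21 _ _); have [v1 v2] := memK v (set22 _ _).
have es' := add_edge_sym u v es.
have ei' : irreflexive (add_edge e u v).
  move=> z; rewrite /add_edge ei /= andbC orbb; apply/negP => /andP[/eqP-> /eqP vu].
  by rewrite vu eqxx in uv.
apply: (decomposable_two_sum sep KE nuv) => //.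
- apply: network_of_paths => //; first by exists q1.
  exact: (two_sum_two_feet es sep KE uv nuv sp pr2 rA2 rn2 ur2 vr2).
- apply: network_of_paths => //; first by exists q2.
  exact: (two_sum_two_feet es sep' KE' uv nuv sp pr1 rA1 rn1 ur1 vr1).
- by apply: IH => //; apply: (two_sum_sparse es sep KE uv nuv sp pr2 rA2 rn2 ur2 vr2).
- by apply: IH => //; apply: (two_sum_sparse es sep' KE' uv nuv sp pr1 rA1 rn1 ur1 vr1).
Qed.

End Decomposition.

(** * Graphs without split wheels *)

Section Rotate.
Variables (T : finType) (e : rel T).
Hypothesis es : symmetric e.

Lemma tree_config_rot C1 C2 D : tree_config e (C1 ++ C2) D -> tree_config e (C2 ++ C1) D.
Proof.
have CC : C2 ++ C1 =i C1 ++ C2 by move=> z; rewrite !mem_cat orbC.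
move=> [[cC sC uD tD dis] [one a3 two]]; split; split.
- exact: icycle_rot.
- by move: sC; rewrite !size_cat addnC.
- by [].
- by [].
- by move=> c; rewrite CC; apply: dis.
- by move=> c; rewrite CC; apply: one.
- by rewrite (att_perm e _ CC).
- move=> d dD; have [y [z [yz yC zC dy dz]]] := two d dD; exists y, z; split=> //.
    by rewrite mem_cat CC -mem_cat.
  by rewrite mem_cat CC -mem_cat.
Qed.

End Rotate.

Lemma wheel_free_sparse n (G : sgraph n)
  (no_wheel : forall m : nat, (5 <= m)%N -> ~ has_induced (wheel m) G)
  (no_proper_splitting : forall (m k : nat) (H : sgraph k), (4 <= m)%N ->
     proper_splitting (wheel m) H -> ~ has_induced H G) :
  cycle_sparse (adj G) [set: 'I_n].
Proof.
move=> C D _ _; apply: (no_attaches3 (@adj_sym n G)) => {}C {}D conf.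
have [_ [_ a3 _]] := conf.
have [c] : exists c, c \in att (adj G) C [set x in D] by apply/set0Pn; rewrite -card_gt0; case: #|_| a3.
case/attP=> cC [d dD dc]; rewrite inE in dD.
(* the cycle is read from a foot, so that no arc between feet wraps around *)
have [C1 [C2 CE]] := split_mem cC; rewrite {}CE in conf.
apply: (@config_absurd n G c _ D (tree_config_rot (@adj_sym n G) conf)) => //.
by rewrite cat_cons /=; apply/hasP; exists d.
Qed.

Theorem corollary6p5 (R : realType) (n : nat) (n_gt0 : (0 < n)%N) (G : sgraph n)
  (no_wheel : forall m : nat, (5 <= m)%N -> ~ has_induced (wheel m) G)
  (no_proper_splitting : forall (m k : nat) (H : sgraph k), (4 <= m)%N ->
     proper_splitting (wheel m) H -> ~ has_induced H G) :
  exists2 d : nat, sd_eq R G d & (d <= 2)%N.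
Proof.
apply: decomposable_sd; apply: sparse_decomposable.
- exact: adj_sym.
- exact: adj_irr.
- exact: wheel_free_sparse.
Qed.
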